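(* Let $\epsilon(x)$ be a positive-valued function of real $x\ge 1$ that tends to $0$ as $x\to\infty$. Let $a$ and $b$ be nonzero integers that are multiplicatively independent. Then for almost all natural numbers $n$ (meaning all but $o(x)$ integers $n\le x$, as $x\to\infty$), $$ \max\{\ell_a(n), \ell_b(n), \ell_{ab}(n), \ell_{a^2 b}(n), \ell_{ab^2}(n)\} > n^{\frac{8}{15}+\epsilon(n)}. $$
   Context: For an integer $a$ and a positive integer $n$, the sequence $a,a^2,a^3,\dots$ is eventually periodic modulo $n$; $\ell_a(n)$ denotes the length of its (minimal) period. When $a$ and $n$ are coprime, $\ell_a(n)$ is the multiplicative order of $a$ modulo $n$; in general (for $a \neq 0$), $\ell_a(n)$ is the order of $a$ modulo $n'$, where $n'$ is the largest positive divisor of $n$ coprime to $a$. Nonzero rational numbers $a_1,\dots,a_k$ are multiplicatively independent if whenever $a_1^{e_1}\cdots a_k^{e_k}=1$ with integers $e_1,\dots,e_k$, we have $e_1=\dots=e_k=0$. *)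

(* Defs.v *)
From HB Require Import structures.
From mathcomp Require Import all_boot all_order all_algebra.
From mathcomp Require Import all_classical all_reals all_analysis.
Import Order.TTheory GRing.Theory Num.Theory.
Import numFieldNormedType.Exports.

Set Implicit Arguments.
Unset Strict Implicit.
Unset Printing Implicit Defensive.

Local Open Scope classical_set_scope.
Local Open Scope ring_scope.

Definition eventual_period (a : int) (n d : nat) : Prop :=
  (0 < d)%N /\
  exists N : nat, forall m : nat, (N <= m)%N ->
    (a ^+ (m + d) = a ^+ m %[mod n%:Z])%Z.

(* [eventual_period_ex] below discharges the hypothesis of the first branch
   for every n > 0; the value 0 is only ever used at n = 0, where reduction
   modulo n is the identity of int. *)
Definition ell (a : int) (n : nat) : nat :=
  if pselect (exists d, `[< eventual_period a n d >]) is left ex_d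
  then ex_minn ex_d else 0%N.

Lemma eventual_period_ex (a : int) (n : nat) :
  (0 < n)%N -> exists d, eventual_period a n d.
Proof.
move=> n_gt0.
have n_neq0 : n%:Z != 0 by rewrite -lt0n.
have absK k : `|(a ^+ k %% n%:Z)%Z|%N%:Z = (a ^+ k %% n%:Z)%Z.
  by rewrite gez0_abs // modz_ge0.
have ltP k : (`|(a ^+ k %% n%:Z)%Z| < n)%N.
  by rewrite -ltz_nat absK ltz_pmod.
pose f (i : 'I_n.+1) : 'I_n := Ordinal (ltP i).
have [i [j [ltij eqf]]] : exists i j : 'I_n.+1, (i < j)%N /\ f i = f j.
  have /injectivePn[i [j neqij eqf]] : ~~ injectiveb f.
    apply/negP => /injectiveP /leq_card.
    by rewrite !card_ord ltnn.
  have [ltij|ltji|/val_inj eqij] := ltngtP i j.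
  - by exists i, j.
  - by exists j, i.
  - by rewrite eqij eqxx in neqij.
have eqm : (a ^+ i = a ^+ j %[mod n%:Z])%Z.
  by rewrite -(absK i) -(absK j); congr (Posz _); exact: (congr1 val eqf).
exists (j - i)%N; split; first by rewrite subn_gt0.
exists (i : nat) => m leim.
rewrite -{2}(subnK leim) (_ : m + (j - i) = (m - i) + j)%N; last first.
  by rewrite addnBA ?(ltnW ltij)// addnBAC.
by rewrite !exprD -modzMmr -eqm modzMmr.
Qed.

Lemma ellP (a : int) (n : nat) : (0 < n)%N ->
  eventual_period a n (ell a n) /\
  forall d, eventual_period a n d -> (ell a n <= d)%N.
Proof.
move=> /(eventual_period_ex a)[d0 Pd0].
rewrite /ell; case: pselect => [ex_d|nex].
  case: ex_minnP => d /asboolP Pd mind; split=> // d' Pd'.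
  by apply: mind; apply/asboolP.
by case: nex; exists d0; apply/asboolP.
Qed.

Definition mult_independent (k : nat) (a : k.-tuple rat) : Prop :=
  forall e : 'I_k -> int,
    \prod_(i < k) tnth a i ^ e i = 1 -> forall i, e i = 0.

Definition count_failures (P : nat -> Prop) (N : nat) : nat :=
  (\sum_(1 <= n < N.+1) ~~ `[< P n >])%N.

Definition almost_all (R : realType) (P : nat -> Prop) : Prop :=
  (count_failures P (Num.truncn x))%:R / x @[x --> +oo%R] --> (0 : R).

(* Main.v *)
Require Import Defs.
From HB Require Import structures.
From mathcomp Require Import all_boot all_order all_algebra.
From mathcomp Require Import all_fingroup all_solvable all_field.
From mathcomp Require Import all_classical all_reals all_analysis.
From mathcomp Require Import zify ring lra.
Import Order.TTheory GRing.Theory Num.Theory.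
Import numFieldNormedType.Exports.

(** Fix a prime p not dividing ab, and let D be the order of the subgroup of
    F_p^* generated by a and b. The exponent vectors of the five numbers are
    (1,0), (0,1), (1,1), (2,1), (1,2), and two of them always have determinant
    1, 2 or 3 up to sign. If u_e denotes the index in that subgroup of the
    subgroup generated by the form of exponent e, Cramer's rule gives gcd (u_e,
    u_f) <= 3 for e <> f ([gcd_co_index_le]); since every u_e divides D, the
    product of the five u_e is at most 3^25 D, and the product of the five
    orders is at least D^4 / 3^25 ([order_log_ge]). On the other hand D >=
    p^(2/3 - k) for all but a sparse set of p: if D < K^2, two of the K^2
    products a^i b^j with i, j < K agree modulo p, so that p divides one of
    O(K^2) nonzero integers with O(K) digits, which leaves O(K^3) primes
    ([count_small_join]). The sum of the logarithms of the five orders modulo p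
    is thus, up to small losses, at least 4 * (2/3) * ln p; this is where 8/15 =
    (1/5) * (8/3) comes from.

    The statement needs a little more than 8/15, because eps is positive and may
    tend to 0 arbitrarily slowly. Call p strong when it is regular and the sum
    of the five logarithms is at least (8/3 + 1/1000) ln p. If a regular p is
    not strong, then D is close to p^(2/3), the orders are at least about
    p^(1/2), hence every u_e is at most about p^(1/6); a prime factor of D
    larger than that would be coprime to all u_e and would improve the product
    bound by that factor ([prod_co_index_prime_le]). So all prime factors of D
    are below p^(17/100), and p - 1, a multiple of D, has a friable divisor of
    size about p^(2/3) ([weak_small_log]). Selberg's sieve, applied to the
    primes p = 1 modulo q, shows that the logarithm of the squarefree
    p^(17/100)-friable part of p - 1 is on average at most (17/40) ln p
    ([sum_small_log_le]). By Markov's inequality and the Mertens estimates the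
    strong primes have a positive proportion in the logarithmic sense
    ([strong_block]), so the sum of their inverses over the interval [2^m, 2^(m
    2^J)) grows at least linearly in J ([strong_sum_ge]).

    It remains to pass to integers. Given a density d, fix J such that the
    strong primes of [2^m, 2^(m 2^J)) have inverses adding up to at least 3/d,
    where m 2^J is about log_2 N. By Turan's second moment method all but d N of
    the integers up to N have one of them as a divisor ([count_free_le]); it is
    at least a fixed power of N, and increases the sum of the five logarithms by
    1/1000 of its own. Outside further sets of density d, the prime factors of n
    beyond a small power of N are regular and simple, they make up n up to
    another small power, and gcd (p - 1, q - 1) is small for any two prime
    factors p, q of n ([count_exceptional_le]). As the order of c modulo n is
    divisible by the orders of c modulo the large prime factors, it is then at
    least nearly their product ([order_log_sum_le]). All losses can be made
    smaller than the gain, which is fixed once d is; so the five logarithms of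
    orders modulo n add up to more than (8/3 + 5 e0) ln n for some e0 > 0, with
    exceptions of density at most 5 d ([small_orders_density]). Once eps (n) <=
    e0, an integer at which the maximum is at most n^(8/15 + eps (n)) is one of
    these exceptions. *)

Set Implicit Arguments.
Unset Strict Implicit.
Unset Printing Implicit Defensive.

Local Open Scope ring_scope.

(** * Sums, logarithms and products of primes *)

Section SumBounds.
Variable R : numDomainType.

Lemma ler_sum_pred (I : Type) (s : seq I) (P Q : pred I) (F : I -> R) :
  (forall i, P i -> Q i) -> (forall i, Q i -> 0 <= F i) ->
  \sum_(i <- s | P i) F i <= \sum_(i <- s | Q i) F i.
Proof.
move=> PQ F0; rewrite big_mkcond [leRHS]big_mkcond; apply: ler_sum => i _.
by case: ifP => [/PQ->//|_]; case: ifP => // /F0.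
Qed.

Lemma ler_sum_inj (I J : finType) (P : pred I) (Q : pred J) (h : I -> J) (F : J -> R) :
  {in P &, injective h} -> (forall i, P i -> Q (h i)) -> (forall j, Q j -> 0 <= F j) ->
  \sum_(i | P i) F (h i) <= \sum_(j | Q j) F j.
Proof.
move=> hinj PQ F0.
rewrite -(@finset.big_imset _ _ _ _ _ h (fun i => P i) F)//=.
apply: ler_sum_pred => // j /finset.imsetP[i Pi ->]; exact: PQ.
Qed.

Lemma ler_sum_uniq_sub (I : eqType) (s t : seq I) (F : I -> R) :
  uniq s -> uniq t -> {subset s <= t} -> (forall i, i \in t -> 0 <= F i) ->
  \sum_(i <- s) F i <= \sum_(i <- t) F i.
Proof.
elim: s t => [|x s IH] t /=.
  by move=> _ _ _ F0; rewrite big_nil big_seq sumr_ge0.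
move=> /andP[xNs us] ut st F0.
have xt : x \in t by apply: st; rewrite mem_head.
rewrite big_cons (big_rem x xt)/= lerD2l; apply: IH => //.
- exact: rem_uniq.
- move=> y ys; rewrite mem_rem_uniq// !inE st ?inE ?ys ?orbT// andbT.
  by apply: contraNneq xNs => <-.
- by move=> y /mem_rem; exact: F0.
Qed.

Lemma sum_dyadic (m n : nat) (P : pred nat) (F : nat -> R) : (m <= n)%N ->
  \sum_(2 ^ m <= p < 2 ^ n | P p) F p =
  \sum_(m <= i < n) \sum_(2 ^ i <= p < 2 ^ i.+1 | P p) F p.
Proof.
move=> mn; rewrite -(subnKC mn); elim: (n - m)%N => [|k IH].
  by rewrite addn0 !big_geq.
rewrite addnS [RHS]big_nat_recr ?leq_addr//= -IH.
by rewrite -big_cat_nat// leq_exp2l// ?leq_addr.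
Qed.

End SumBounds.

Section NatLog.
Variable R : realType.
Local Notation lnr n := (ln (n%:R : R)).

Lemma lnr_ge0 (n : nat) : 0 <= lnr n.
Proof.
case: n => [|n]; first by rewrite ln0.
by apply: ln_ge0; rewrite ler1n.
Qed.

Lemma lnrM (m n : nat) : (0 < m)%N -> (0 < n)%N -> lnr (m * n)%N = lnr m + lnr n.
Proof. by move=> m0 n0; rewrite natrM lnM ?posrE ?ltr0n. Qed.

Lemma lnrX (m k : nat) : (0 < m)%N -> lnr (m ^ k)%N = k%:R * lnr m.
Proof. by move=> m0; rewrite natrX lnXn ?ltr0n// mulr_natl. Qed.

Lemma ler_lnr (m n : nat) : (0 < m)%N -> (m <= n)%N -> lnr m <= lnr n.
Proof.
by move=> m0 mn; rewrite ler_ln ?posrE ?ltr0n ?ler_nat// (leq_trans m0).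
Qed.

Lemma lnr_prod (I : Type) (s : seq I) (P : pred I) (F : I -> nat) :
  (forall i, P i -> (0 < F i)%N) ->
  lnr (\prod_(i <- s | P i) F i)%N = \sum_(i <- s | P i) lnr (F i).
Proof.
move=> F0; elim: s => [|i s IH]; first by rewrite !big_nil ln1.
rewrite !big_cons; case: ifP => // Pi.
by rewrite lnrM ?F0 ?IH// prodn_cond_gt0.
Qed.

(** Since ln 2 = ln 12 - ln 6, six steps ln (k + 1) - ln k >= 1 / (k + 1) are
    enough. *)
Lemma ln2_ge : 13 / 20 <= lnr 2.
Proof.
have ln_step (k : nat) : (0 < k)%N -> k.+1%:R^-1 <= lnr k.+1 - lnr k.
  move=> k0; rewrite -ln_div ?posrE ?ltr0n//.
  have kR : 0 < k%:R :> R by rewrite ltr0n.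
  have := @le_ln1Dx R (- k.+1%:R^-1).
  have -> : 1 + - k.+1%:R^-1 = (k.+1%:R / k%:R)^-1 :> R.
    by rewrite invf_div -natr1; field; lra.
  rewrite lnV ?posrE ?divr_gt0 ?ltr0n// lerN2; apply.
  by rewrite ltrN2 invf_lt1 ?ltr0n// ltr1n ltnS.
have e12 : lnr 12 = lnr 2 + lnr 6 by rewrite -lnrM.
have := ln_step 6%N isT; have := ln_step 7%N isT; have := ln_step 8%N isT.
have := ln_step 9%N isT; have := ln_step 10%N isT; have := ln_step 11%N isT.
lra.
Qed.

Lemma ln2_gt0 : 0 < lnr 2.
Proof. by have := ln2_ge; lra. Qed.

Lemma ln2_le : lnr 2 <= 1.
Proof.
have := @le_ln1Dx R 1; have -> : 1 + 1 = 2%:R :> R by lra.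
by apply; lra.
Qed.

Lemma ler_divn (n d : nat) : (n %/ d)%:R <= n%:R / d%:R :> R.
Proof.
case: d => [|d]; first by rewrite divn0 invr0 mulr0.
by rewrite ler_pdivlMr ?ltr0n// -natrM ler_nat leq_trunc_div.
Qed.

Lemma ger_divn (n d : nat) : (0 < d)%N -> n%:R / d%:R - 1 <= (n %/ d)%:R :> R.
Proof.
move=> d0; rewrite lerBlDr natr1 ler_pdivrMr ?ltr0n// -natrM ler_nat.
by rewrite ltnW// ltn_ceil.
Qed.

End NatLog.

Section PrimeProducts.
Implicit Types (p q m n : nat) (s : seq nat).

Lemma prime_dvd_prod p s : prime p -> all prime s ->
  (p %| \prod_(q <- s) q)%N -> p \in s.
Proof.
move=> pp; elim: s => [|q s IH] /=.
  by rewrite big_nil dvdn1 => _ /eqP p1; rewrite p1 in pp.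
move=> /andP[pq ps]; rewrite big_cons Euclid_dvdM// inE.
by case/orP => [|/(IH ps)->]; [rewrite dvdn_prime2// => ->|rewrite orbT].
Qed.

Lemma prod_primes_dvd s m : uniq s -> all prime s ->
  {in s, forall p, (p %| m)%N} -> (\prod_(p <- s) p %| m)%N.
Proof.
elim: s => [|p s IH] /=; first by rewrite big_nil dvd1n.
move=> /andP[pNs us] /andP[pp ps] sm; rewrite big_cons Gauss_dvd.
  rewrite sm ?mem_head// IH// => q qs.
  by apply: sm; rewrite inE qs orbT.
rewrite prime_coprime//; apply: contra pNs; exact: prime_dvd_prod.
Qed.

Lemma prime_dvd_fact p n : prime p -> (p %| n`!)%N = (p <= n)%N.
Proof.
move=> pp; apply/idP/idP => [|pn]; last by rewrite dvdn_fact// prime_gt0.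
elim: n => [|n IH].
  by rewrite fact0 dvdn1 => /eqP p1; rewrite p1 in pp.
rewrite factS Euclid_dvdM// => /orP[/dvdn_leq->//|/IH pn]; exact: leqW.
Qed.

End PrimeProducts.

(** * Estimates of Chebyshev and Mertens *)

Section Mertens.
Variable R : realType.
Local Notation lnr n := (ln (n%:R : R)).

Definition theta (n : nat) : R := \sum_(0 <= p < n.+1 | prime p) lnr p.

(** The primes of (n, 2n] divide the central binomial coefficient, which is at
    most 2^(2n). *)
Lemma theta_double n : theta n.*2 <= theta n + (n.*2)%:R * lnr 2.
Proof.
rewrite /theta (big_cat_nat (n := n.+1))//=; last by rewrite ltnS -addnn leq_addr.
rewrite lerD2l -lnr_prod; last by move=> p /prime_gt0.
rewrite -lnrX//.
apply: ler_lnr; first by apply: prodn_cond_gt0 => p /prime_gt0.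
apply: (@leq_trans 'C(n.*2, n)).
  apply: dvdn_leq; first by rewrite bin_gt0 -addnn leq_addr.
  rewrite -big_filter; apply: prod_primes_dvd.
  - by rewrite filter_uniq// iota_uniq.
  - exact: filter_all.
  move=> p; rewrite mem_filter mem_index_iota => /andP[pp /andP[np pn]].
  have := @bin_fact n.*2 n; rewrite -addnn leq_addr addnK => /(_ isT) E.
  have : (p %| (n + n)`!)%N by rewrite prime_dvd_fact// addnn -ltnS.
  by rewrite -E !Euclid_dvdM// !prime_dvd_fact// leqNgt np !orbF.
rewrite -[2%N]/(1 + 1)%N Pascal.
rewrite (bigD1 (inord n : 'I_(n.*2.+1)))//= inordK ?ltnS -?addnn ?leq_addr//.
by rewrite !exp1n !muln1 leq_addr.
Qed.

Lemma theta_pow2 k : theta (2 ^ k) <= 2 * (2 ^ k)%:R * lnr 2.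
Proof.
elim: k => [|k IH].
  rewrite /theta (_ : \sum_(_ <= _ < _ | _) _ = 0); last first.
    by rewrite big_mkcond !big_nat_recl// big_geq//= !addr0.
  by rewrite !mulr_ge0// (ltW (ln2_gt0 _)).
rewrite expnS mul2n; apply: le_trans (theta_double _) _.
rewrite -mul2n natrM; apply: le_trans (lerD IH (lexx _)) _.
by rewrite le_eqVlt; apply/orP; left; apply/eqP; ring.
Qed.

Lemma theta_le n : theta n <= 4 * n%:R * lnr 2.
Proof.
case: n => [|n].
  by rewrite /theta big_mkcond big_nat1/= mulr0 mul0r.
have [k [nk kn]] : exists k, (n.+1 <= 2 ^ k)%N /\ (2 ^ k <= n.+1.*2)%N.
  exists (trunc_log 2 n.+1).+1; split.
    by rewrite ltnW// trunc_log_ltn.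
  by rewrite expnS mul2n leq_double trunc_logP.
apply: (@le_trans _ _ (theta (2 ^ k))).
  rewrite /theta [leRHS](big_cat_nat (n := n.+2))//= lerDl sumr_ge0// => p _.
  exact: lnr_ge0.
apply: le_trans (theta_pow2 k) _; rewrite ler_wpM2r ?(ltW (ln2_gt0 _))//.
by move: kn; rewrite -(@ler_nat R) -mul2n natrM; lra.
Qed.

Definition mertens (n : nat) : R := \sum_(0 <= p < n.+1 | prime p) lnr p / p%:R.

(** Legendre's factorisation of n!; comparing ln n! with n ln n yields both
    Mertens bounds. *)
Lemma ln_fact n : lnr n`! = \sum_(0 <= p < n.+1 | prime p) (logn p n`!)%:R * lnr p.
Proof.
rewrite {1}[n`!]prod_prime_decomp ?fact_gt0// prime_decompE big_map lnr_prod/=; last first.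
  by move=> p _; rewrite expn_gt0; case: p => //=; rewrite logn0 ?eqxx.
rewrite -[RHS]big_filter big_seq (perm_big [seq p <- index_iota 0 n.+1 | prime p]).
  rewrite [RHS]big_seq.
  rewrite [LHS](eq_bigl (fun p => p \in [seq p <- index_iota 0 n.+1 | prime p])).
    apply: eq_bigr => p; rewrite mem_filter => /andP[/prime_gt0 p0 _].
    exact: lnrX.
  move=> p; rewrite mem_filter mem_index_iota mem_primes fact_gt0/=.
  by case: (boolP (prime p)) => //= pp; rewrite prime_dvd_fact.
apply: uniq_perm; rewrite ?primes_uniq ?filter_uniq ?iota_uniq// => p.
rewrite mem_filter mem_index_iota mem_primes fact_gt0/=.
by case: (boolP (prime p)) => //= pp; rewrite prime_dvd_fact.
Qed.

(** The exponent of p in n! is at least n / p - 1, and the resulting error terms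
    ln p add up to [theta n]. *)
Lemma mertens_le n : (0 < n)%N -> mertens n <= lnr n + 4.
Proof.
move=> n0.
have nR : 0 < n%:R :> R by rewrite ltr0n.
have : n%:R * mertens n <= n%:R * lnr n + theta n.
  apply: (@le_trans _ _ (lnr n`! + theta n)); last first.
    rewrite lerD2r -lnrX// ler_lnr ?fact_gt0//.
    elim: {nR} n n0 => // n IH _; rewrite factS expnS leq_mul//.
    case: n IH => // n /(_ isT) IH; apply: leq_trans IH _.
    by rewrite leq_exp2r.
  rewrite ln_fact /theta -big_split/= /mertens mulr_sumr ler_sum// => p pp.
  have p0 := prime_gt0 pp.
  have := @ger_divn R n p p0.
  have : (n %/ p <= logn p n`!)%N.
    rewrite logn_fact// big_ltn// expn1 leq_addr//.
  rewrite -(@ler_nat R) => h1 h2.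
  have -> : n%:R * (lnr p / p%:R) = (n%:R / p%:R) * lnr p by ring.
  rewrite -[X in _ + X]mul1r -mulrDl; apply: ler_wpM2r; first exact: lnr_ge0.
  lra.
move=> h.
have := theta_le n; have := ln2_le R.
have -> : mertens n = n%:R * mertens n / n%:R by rewrite mulrAC mulfV ?mul1r// gt_eqF.
move=> l2 th; rewrite ler_pdivrMr//; apply: le_trans h _.
rewrite mulrDl [lnr n * _]mulrC lerD2l; apply: le_trans th _.
by rewrite -[leRHS]mulr1 ler_wpM2l// mulr_ge0.
Qed.

(** The term (ln n + 2) / n bounds the tail of the series, which lets the
    induction close. *)
Lemma sum_ln_conv n : (0 < n)%N ->
  \sum_(2 <= m < n.+1) lnr m / (m%:R * (m%:R - 1)) <= 2 - (lnr n + 2) / n%:R.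
Proof.
elim: n => // -[_ _|n IH _].
  by rewrite big_geq// ln1; lra.
rewrite big_nat_recr//=; apply: le_trans (lerD (IH isT) (lexx _)) _.
have n1 : 0 < n.+1%:R :> R by rewrite ltr0n.
have n2 : n.+2%:R = n.+1%:R + 1 :> R by rewrite natr1.
have step : n.+2%:R * (lnr n.+2 - lnr n.+1) <= 2.
  rewrite -ln_div ?posrE ?ltr0n//.
  have -> : n.+2%:R / n.+1%:R = 1 + n.+1%:R^-1 :> R by rewrite n2; field; lra.
  have := @le_ln1Dx R n.+1%:R^-1.
  have i0 : 0 < n.+1%:R^-1 :> R by rewrite invr_gt0.
  have i1 : -1 < n.+1%:R^-1 :> R by apply: lt_trans i0; rewrite ltrN10.
  move=> /(_ i1) h.
  apply: (@le_trans _ _ (n.+2%:R * n.+1%:R^-1)).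
    by rewrite ler_wpM2l.
  rewrite ler_pdivrMr// n2.
  have : 1 <= n.+1%:R :> R by rewrite ler1n.
  lra.
rewrite -subr_ge0.
have -> : 2 - (lnr n.+2 + 2) / n.+2%:R -
    (2 - (lnr n.+1 + 2) / n.+1%:R + lnr n.+2 / (n.+2%:R * (n.+2%:R - 1)))
  = (2 - n.+2%:R * (lnr n.+2 - lnr n.+1)) / (n.+1%:R * n.+2%:R).
  by rewrite n2; field; lra.
by rewrite divr_ge0 ?mulr_ge0//; lra.
Qed.

Lemma sum_ln_conv2 n : \sum_(2 <= m < n) lnr m / (m%:R * (m%:R - 1)) <= 2.
Proof.
case: n => [|[|n]]; try by rewrite big_geq.
apply: le_trans (sum_ln_conv _) _ => //.
by rewrite gerBl divr_ge0// addr_ge0// lnr_ge0.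
Qed.

Lemma sum_prime_ln_conv n :
  \sum_(0 <= p < n | prime p) lnr p / (p%:R * (p%:R - 1)) <= 2.
Proof.
apply: le_trans (sum_ln_conv2 n).
case: (ltnP n 2) => n2.
  rewrite [leRHS]big_geq ?(ltnW n2)// big_mkcond big_seq big1// => p.
  rewrite mem_index_iota => /andP[_ pn]; case: ifP => // /prime_gt1.
  by lia.
rewrite (big_cat_nat (n := 2))//= [X in X + _]big1_seq ?add0r; last first.
  move=> p /andP[/prime_gt1]; rewrite mem_index_iota => p1 /andP[_].
  by rewrite ltnNge p1.
rewrite big_mkcond/= ler_sum_nat// => p /andP[p2 _]; case: ifP => // _.
rewrite divr_ge0 ?lnr_ge0// mulr_ge0// subr_ge0 ler1n; lia.
Qed.

Lemma geom_prime p n : (1 < p)%N ->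
  \sum_(1 <= k < n.+1) ((p ^ k)%:R : R)^-1 <= (p%:R - 1)^-1.
Proof.
move=> p1; have pR : 1 < p%:R :> R by rewrite ltr1n.
have : \sum_(1 <= k < n.+1) ((p ^ k)%:R : R)^-1 = (1 - ((p ^ n)%:R)^-1) / (p%:R - 1).
  elim: n => [|n IH]; first by rewrite big_geq// expn0 invr1 subrr mul0r.
  rewrite big_nat_recr//= IH expnS natrM.
  have pn : 0 < (p ^ n)%:R :> R by rewrite ltr0n expn_gt0 ltnW.
  by field; apply/andP; split; [|apply/andP; split]; lra.
move=> ->; rewrite -[leRHS]mul1r ler_wpM2r//.
  by rewrite invr_ge0; lra.
Qed.

Lemma ln_fact_ge n : (0 < n)%N -> n%:R * lnr n - n%:R <= lnr n`!.
Proof.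
elim: n => // -[_ _|n IH _]; first by rewrite ln1; lra.
rewrite factS lnrM ?fact_gt0//.
have := IH isT; have n1 : 0 < n.+1%:R :> R by rewrite ltr0n.
have n2 : n.+2%:R = n.+1%:R + 1 :> R by rewrite natr1.
have : n.+1%:R * (lnr n.+2 - lnr n.+1) <= 1.
  rewrite -ln_div ?posrE ?ltr0n//.
  have -> : n.+2%:R / n.+1%:R = 1 + n.+1%:R^-1 :> R by rewrite n2; field; lra.
  have i0 : 0 < n.+1%:R^-1 :> R by rewrite invr_gt0.
  have i1 : -1 < n.+1%:R^-1 :> R by apply: lt_trans i0; rewrite ltrN10.
  have := le_ln1Dx i1.
  by move=> h; rewrite -ler_pdivlMl// mulr1.
by rewrite n2; lra.
Qed.

(** The exponent of p in n! is at most n / (p - 1); the excess of 1 / (p - 1)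
    over 1 / p gives a convergent series. *)
Lemma mertens_ge n : (0 < n)%N -> lnr n - 3 <= mertens n.
Proof.
move=> n0.
have nR : 0 < n%:R :> R by rewrite ltr0n.
have h : lnr n`! <= n%:R * (mertens n + 2).
  apply: (@le_trans _ _ (n%:R * (mertens n +
     \sum_(0 <= p < n.+1 | prime p) lnr p / (p%:R * (p%:R - 1))))); last first.
    by rewrite ler_wpM2l// lerD2l sum_prime_ln_conv.
  rewrite /mertens -big_split/= mulr_sumr ln_fact ler_sum// => p pp.
  have p1 := prime_gt1 pp; have pR : 1 < p%:R :> R by rewrite ltr1n.
  have -> : n%:R * (lnr p / p%:R + lnr p / (p%:R * (p%:R - 1))) =
     (n%:R / (p%:R - 1)) * lnr p by field; apply/andP; split; lra.
  apply: ler_wpM2r; first exact: lnr_ge0.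
  rewrite logn_fact// natr_sum.
  apply: (@le_trans _ _ (\sum_(1 <= k < n.+1) n%:R * ((p ^ k)%:R : R)^-1)).
    by apply: ler_sum => k _; exact: ler_divn.
  by rewrite -mulr_sumr ler_wpM2l// geom_prime.
have := ln_fact_ge n0 => h2.
have : n%:R * (lnr n - 3) <= n%:R * mertens n by lra.
by rewrite ler_pM2l.
Qed.

End Mertens.

(** * Selberg's sieve *)

Section SelbergSieve.
Import mathcomp.boot.fintype mathcomp.boot.finset.
Variables (R : realType) (z : nat).
Implicit Types (P A B C F G H K : {set 'I_z.+1}).

(** A squarefree integer with prime factors at most z is encoded by the set of
    these factors: divisibility becomes inclusion, lcm union and gcd
    intersection. *)
Definition set_prod A : nat := \prod_(p in A) (p : nat).
Definition level P A : bool := (A \subset P) && (set_prod A <= z)%N.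
(** The value of 1 / phi at the squarefree integer encoded by A. *)
Definition weight A : R := \prod_(p in A) ((p : nat)%:R - 1)^-1.
Definition weight_sum P : R := \sum_(A | level P A) weight A.
(** Selberg's optimal weights, scaled so that the weight of the empty set is
    [weight_sum P] instead of 1. *)
Definition selberg P A : R :=
  (-1) ^+ #|A| * (set_prod A)%:R * \sum_(G | level P G && (A \subset G)) weight G.

Definition prime_pool P := forall p, p \in P -> prime p.

Lemma prime_poolS P A : prime_pool P -> A \subset P -> prime_pool A.
Proof. by move=> pP /subsetP AP p /AP /pP. Qed.

Lemma set_prod_gt0 A : prime_pool A -> (0 < set_prod A)%N.
Proof. by move=> pA; apply: prodn_cond_gt0 => p /pA /prime_gt0. Qed.

Lemma set_prodU A B : [disjoint A & B] ->
  set_prod (A :|: B) = (set_prod A * set_prod B)%N.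
Proof. by move=> dAB; rewrite /set_prod -bigU//; apply: eq_bigl => x; rewrite !inE. Qed.

Lemma weightU A B : [disjoint A & B] -> weight (A :|: B) = weight A * weight B.
Proof. by move=> dAB; rewrite /weight -bigU//; apply: eq_bigl => x; rewrite !inE. Qed.

Lemma set_prodD A B : B \subset A -> set_prod A = (set_prod B * set_prod (A :\: B))%N.
Proof.
move=> BA; rewrite -set_prodU ?setDE ?setUIr ?setUCr ?setIT ?(setUidPr BA)//.
by rewrite -setDE -setI_eq0 setIC setDE -setIA [_ :&: B]setIC setICr setI0.
Qed.

Lemma weightD A B : B \subset A -> weight A = weight B * weight (A :\: B).
Proof.
move=> BA; rewrite -weightU ?setDE ?setUIr ?setUCr ?setIT ?(setUidPr BA)//.
by rewrite -setDE -setI_eq0 setIC setDE -setIA [_ :&: B]setIC setICr setI0.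
Qed.

Lemma set_prodUI A B :
  (set_prod (A :|: B) * set_prod (A :&: B) = set_prod A * set_prod B)%N.
Proof.
have -> : A :|: B = A :|: (B :\: A).
  by apply/setP => x; rewrite !inE; case: (x \in A).
rewrite set_prodU; last by rewrite -setI_eq0 setIC setDE -setIA [_ :&: A]setIC setICr setI0.
rewrite -mulnA; congr (_ * _)%N.
rewrite [RHS](@set_prodD B (A :&: B)) ?subsetIr// mulnC.
by congr (_ * set_prod _)%N; apply/setP => x; rewrite !inE; case: (x \in A); case: (x \in B).
Qed.

Lemma dvd_set_prod P A (p : 'I_z.+1) : prime_pool P -> A \subset P -> p \in P ->
  (p %| set_prod A)%N = (p \in A).
Proof.
move=> pP AP pp; rewrite /set_prod Euclid_dvd_prod ?pP//.
rewrite big_orE; apply/exists_inP/idP => [[q qA]|pA]; last by exists p.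
have pq : prime q by apply: pP; exact: (subsetP AP).
by rewrite (dvdn_prime2 (pP _ pp) pq) => /eqP/val_inj h; rewrite h.
Qed.

Lemma level0 P : (0 < z)%N -> level P set0.
Proof. by move=> z0; rewrite /level sub0set /set_prod big_set0. Qed.

Lemma levelS P A B : prime_pool P -> B \subset A -> level P A -> level P B.
Proof.
move=> pP BA /andP[AP Az]; rewrite /level (subset_trans BA)//=.
apply: leq_trans Az; apply: dvdn_leq; first exact/set_prod_gt0/(prime_poolS pP).
by rewrite (set_prodD BA) dvdn_mulr.
Qed.

Lemma weight_gt0 A : prime_pool A -> 0 < weight A.
Proof.
move=> pA; apply: prodr_gt0 => p /pA /prime_gt1 p1.
by rewrite invr_gt0 subr_gt0 ltr1n.
Qed.

Lemma weight_ge0 P A : prime_pool P -> level P A -> 0 <= weight A.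
Proof. by move=> pP /andP[/(prime_poolS pP)/weight_gt0/ltW]. Qed.

(** By unique factorisation a set of primes is determined by its product. *)
Lemma card_level P : prime_pool P -> (#|[set A | level P A]| <= z.+1)%N.
Proof.
move=> pP; pose f A : 'I_z.+1 := inord (set_prod A).
rewrite -(@card_in_imset _ _ f); first by apply: leq_trans (max_card _) _; rewrite card_ord.
move=> A B; rewrite !inE => /andP[AP Az] /andP[BP Bz] /(congr1 val).
rewrite /= !inordK ?ltnS// => AB; apply/setP => p.
case: (boolP (p \in P)) => [pp|pNP]; first by rewrite -(dvd_set_prod pP AP pp) AB (dvd_set_prod pP).
by rewrite (contraNF (subsetP AP p))// (contraNF (subsetP BP p)).
Qed.

(** Gauss's identity: a squarefree d is the sum of phi (e) over its divisors e. *)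
Lemma sum_weight_inv C : prime_pool C ->
  (set_prod C)%:R = \sum_(F : {set 'I_z.+1} | F \subset C) (weight F)^-1.
Proof.
move=> pC; rewrite /set_prod natr_prod.
transitivity (\prod_(i : 'I_z.+1) ((if i \in C then (i : nat)%:R - 1 else 0) + 1) : R).
  rewrite big_mkcond; apply: eq_bigr => i _.
  by case: ifP; rewrite ?add0r// subrK.
rewrite bigA_distr [RHS]big_mkcond; apply: eq_bigr => F _.
case: ifP => [FC|/negbT/subsetPn[x xF xC]]; last first.
  by rewrite (bigD1 x)//= xF (negbTE xC) mul0r.
rewrite /weight -prodfV [RHS]big_mkcond; apply: eq_bigr => i _.
by case: ifP => // iF; rewrite (subsetP FC)// invrK.
Qed.

(** Expansion of d / phi (d), the product of the factors 1 + 1 / (p - 1). *)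
Lemma sum_weight A : prime_pool A ->
  (set_prod A)%:R * weight A = \sum_(K : {set 'I_z.+1} | K \subset A) weight K.
Proof.
move=> pA; rewrite /set_prod natr_prod /weight -big_split/=.
transitivity (\prod_(i : 'I_z.+1) ((if i \in A then ((i : nat)%:R - 1)^-1 else 0) + 1) : R).
  rewrite big_mkcond; apply: eq_bigr => i _.
  case: ifP => [/pA/prime_gt1 i1|]; rewrite ?add0r//.
  have : 1 < (i : nat)%:R :> R by rewrite ltr1n.
  by move=> ?; field; lra.
rewrite bigA_distr [RHS]big_mkcond; apply: eq_bigr => F _.
case: ifP => [FC|/negbT/subsetPn[x xF xC]]; last first.
  by rewrite (bigD1 x)//= xF (negbTE xC) mul0r.
rewrite [RHS]big_mkcond; apply: eq_bigr => i _.
by case: ifP => // iF; rewrite (subsetP FC).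
Qed.

(** Moebius inversion in the lattice of subsets. *)
Lemma alternating_sum F G : F \subset G ->
  \sum_(A : {set 'I_z.+1} | (F \subset A) && (A \subset G)) (-1) ^+ #|A| =
  (if F == G then (-1) ^+ #|F| else 0) :> R.
Proof.
move=> FG.
have -> : \sum_(A : {set 'I_z.+1} | (F \subset A) && (A \subset G)) (-1) ^+ #|A| =
  \prod_(i : 'I_z.+1) ((if i \in G then -1 else 0) + (if i \in F then 0 else 1)) :> R.
  rewrite bigA_distr big_mkcond; apply: eq_bigr => A _.
  case: ifP => [/andP[FA AG]|].
    rewrite -prodr_const big_mkcond; apply: eq_bigr => i _.
    case: ifP => [/(subsetP AG)->//|iA]; case: ifP => // /(subsetP FA).
    by rewrite iA.
  move=> /negbT; rewrite negb_and => /orP[] /subsetPn[x xF xC].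
    by rewrite (bigD1 x)//= (negbTE xC) xF mul0r.
  by rewrite (bigD1 x)//= xF (negbTE xC) mul0r.
case: eqP => [<-|/eqP FnG].
  rewrite -prodr_const [RHS]big_mkcond; apply: eq_bigr => i _.
  by case: ifP; rewrite ?addr0 ?add0r.
have /subsetPn[x xG xF] : ~~ (G \subset F).
  by apply: contra FnG => GF; rewrite eqEsubset FG.
by rewrite (bigD1 x)//= xG (negbTE xF) addNr mul0r.
Qed.

(** The weights are the Moebius transform of this identity, which is what makes
    the quadratic form of the sieve diagonal. *)
Lemma selberg_dual P F : prime_pool P -> level P F ->
  \sum_(A | level P A && (F \subset A)) selberg P A / (set_prod A)%:R =
  (-1) ^+ #|F| * weight F.
Proof.
move=> pP lF.
transitivity (\sum_(A | level P A && (F \subset A))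
   \sum_(G | level P G && (A \subset G)) (-1) ^+ #|A| * weight G).
  apply: eq_bigr => A /andP[/andP[AP _] _]; rewrite /selberg -mulr_sumr.
  have : (set_prod A)%:R != 0 :> R.
    by rewrite pnatr_eq0 -lt0n; exact/set_prod_gt0/(prime_poolS pP).
  by move=> h; field.
rewrite (exchange_big_dep (fun G => level P G && (F \subset G)))/=; last first.
  by move=> A G /andP[_ FA] /andP[-> AG]/=; exact: subset_trans AG.
transitivity (\sum_(G | level P G && (F \subset G))
   (if F == G then (-1) ^+ #|F| else 0) * weight G).
  apply: eq_bigr => G /andP[lG FG]; rewrite -alternating_sum// mulr_suml.
  apply: eq_bigl => A; rewrite lG /=.
  case: (boolP (A \subset G)) => AG; rewrite ?andbF//= !andbT.
  by rewrite (levelS pP AG).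
rewrite (bigD1 F)/= ?lF ?subxx// eqxx big1 ?addr0// => G /andP[_ GF].
by rewrite eq_sym (negbTE GF) mul0r.
Qed.

(** Since 1 / lcm (d, e) = gcd (d, e) / (d e), Gauss's identity for the gcd
    turns the form into a sum of squares indexed by common divisors F, evaluated
    by [selberg_dual]. *)
Lemma selberg_quadratic P : prime_pool P ->
  \sum_(A | level P A) \sum_(B | level P B)
    selberg P A * selberg P B / (set_prod (A :|: B))%:R = weight_sum P.
Proof.
move=> pP.
have spN0 A : level P A -> (set_prod A)%:R != 0 :> R.
  by move=> /andP[AP _]; rewrite pnatr_eq0 -lt0n; exact/set_prod_gt0/(prime_poolS pP).
transitivity (\sum_(A | level P A) \sum_(B | level P B)
  \sum_(F | level P F && ((F \subset A) && (F \subset B))) (weight F)^-1 *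
    ((selberg P A / (set_prod A)%:R) * (selberg P B / (set_prod B)%:R))).
  apply: eq_bigr => A lA; apply: eq_bigr => B lB.
  rewrite -mulr_suml.
  have -> : \sum_(F | level P F && ((F \subset A) && (F \subset B))) (weight F)^-1
    = (set_prod (A :&: B))%:R.
    rewrite sum_weight_inv; last first.
      apply: (prime_poolS pP); move/andP: lA => [AP _].
      exact: subset_trans (subsetIl _ _) AP.
    apply: eq_bigl => F; rewrite subsetI; case: (boolP (F \subset A)) => FA; rewrite ?andbF//.
    by rewrite (levelS pP FA lA).
  have U0 : (set_prod (A :|: B))%:R != 0 :> R.
    rewrite pnatr_eq0 -lt0n; apply: set_prod_gt0; apply: (prime_poolS pP).
    by move/andP: lA lB => [AP _] /andP[BP _]; rewrite subUset AP.
  have := congr1 (fun n => n%:R : R) (set_prodUI A B); rewrite !natrM => E.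
  have A0 := spN0 _ lA; have B0 := spN0 _ lB.
  have -> : (set_prod (A :&: B))%:R = (set_prod A)%:R * (set_prod B)%:R / (set_prod (A :|: B))%:R :> R.
    by rewrite -E mulrAC mulfV// mul1r.
  by field; rewrite U0 A0 B0.
transitivity (\sum_(F | level P F) (weight F)^-1 *
   (\sum_(A | level P A && (F \subset A)) selberg P A / (set_prod A)%:R) ^+ 2).
  transitivity (\sum_(A | level P A) \sum_(F | level P F)
      \sum_(B | level P B && [&& level P F, F \subset A & F \subset B]) (weight F)^-1 *
      ((selberg P A / (set_prod A)%:R) * (selberg P B / (set_prod B)%:R))).
    apply: eq_bigr => A lA; rewrite (exchange_big_dep (level P))//=.
    by move=> B F _ /andP[].
  rewrite (exchange_big_dep (level P))//=.
  apply: eq_bigr => F lF; rewrite expr2 big_distrlr/= mulr_sumr.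
  rewrite [LHS](eq_bigl (level P)); last by move=> A; rewrite lF andbT.
  rewrite [RHS]big_mkcondr; apply: eq_bigr => A lA.
  case: ifP => FA; last by rewrite big1// => B; rewrite lF /= andbF.
  rewrite mulr_sumr; apply: eq_bigl => B.
  by rewrite lF.
rewrite /weight_sum; apply: eq_bigr => F lF; rewrite selberg_dual// exprMn sqrr_sign mul1r.
have /gt_eqF/negbT w0 : 0 < weight F by move/andP: lF => [/(prime_poolS pP)/weight_gt0].
by rewrite expr2 mulrA mulVf// mul1r.
Qed.

(** Multiplied by the product over A, the weight of a set G containing A is by
    [sum_weight] the sum of the weights of the sets K union (G minus A), for K
    included in A. All these sets are different and of level, so the total is
    part of [weight_sum P]. *)
Lemma selberg_bound P A : prime_pool P -> level P A ->
  `|selberg P A| <= weight_sum P.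
Proof.
move=> pP lA; have pA : prime_pool A by move/andP: lA => [/(prime_poolS pP)].
rewrite /selberg !normrM normrX normrN1 expr1n mul1r ger0_norm//.
rewrite ger0_norm; last by apply: sumr_ge0 => G /andP[/(weight_ge0 pP)].
rewrite mulr_sumr.
apply: (@le_trans _ _ (\sum_(H | level P H && level P (H :|: A)) weight H)); last first.
  rewrite /weight_sum [leRHS](bigID (fun H => level P (H :|: A)))/= lerDl.
  by apply: sumr_ge0 => H /andP[/(weight_ge0 pP)].
rewrite [leRHS](partition_big (fun H => H :|: A) (fun G => level P G && (A \subset G)))/=; last first.
  by move=> H /andP[_ ->]; rewrite subsetUr.
apply: ler_sum => G /andP[lG AG].
rewrite (weightD AG) mulrA sum_weight// mulr_suml.
rewrite [leRHS](reindex_onto (fun K => K :|: (G :\: A)) (fun H => H :&: A))/=; last first.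
  move=> H /andP[_ /eqP <-]; apply/setP => x; rewrite !inE.
  by case: (x \in A); case: (x \in H).
rewrite le_eqVlt; apply/orP; left; apply/eqP.
apply: eq_big => [K|K KA]; last first.
  rewrite weightU// -setI_eq0; apply/eqP/setP => x; rewrite !inE.
  case: (boolP (x \in K)) => //= xK.
  by rewrite (subsetP KA).
apply/idP/idP => [KA|/andP[_ /eqP <-]]; last exact: subsetIr.
have e1 : K :|: G :\: A :|: A = G.
  apply/setP => x; rewrite !inE.
  case: (boolP (x \in A)) => xA; first by rewrite orbT (subsetP AG).
  by rewrite /= orbF; case: (boolP (x \in K)) => //= /(subsetP KA); rewrite (negbTE xA).
rewrite e1 lG eqxx !andbT; apply/andP; split.
  apply: levelS lG => //; rewrite subUset (subset_trans KA)//= subsetDl//.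
apply/eqP/setP => x; rewrite !inE.
case: (boolP (x \in A)) => xA; rewrite ?andbT/= ?orbF// andbF.
by apply/esym/negbTE; apply: contra xA; exact: subsetP.
Qed.

(** The square of the sum of the Selberg weights of the divisors of m is the
    square of [weight_sum P] when m has no prime factor in P, and nonnegative
    otherwise. Expanded and summed over M, it gives X times the diagonalised
    form and at most (z + 1)^2 error terms, each bounded by [selberg_bound]. *)
Theorem selberg_sieve P (M : seq nat) (X : R) : prime_pool P -> (0 < z)%N ->
  (forall C, C \subset P ->
    `|(count (fun m => set_prod C %| m)%N M)%:R - X / (set_prod C)%:R| <= 1) ->
  (count (fun m => [forall p in P, ~~ (p %| m)%N]) M)%:R * weight_sum P
    <= X + z.+1%:R ^+ 2 * weight_sum P.
Proof.
move=> pP z0 MX.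
set S := weight_sum P; set cnt := count _ M.
have S0 : 0 < S.
  rewrite /S /weight_sum (bigD1 set0)/=; last exact: level0.
  rewrite {1}/weight big_set0; apply: lt_le_trans ltr01 _; rewrite lerDl.
  by apply: sumr_ge0 => A /andP[/(weight_ge0 pP)].
suff : cnt%:R * S ^+ 2 <= X * S + (z.+1%:R * S) ^+ 2.
  rewrite expr2 mulrA exprMn [S ^+ 2]expr2 mulrA -mulrDl.
  by rewrite ler_pM2r.
pose ind (C : {set 'I_z.+1}) (m : nat) : R := ((set_prod C %| m)%N)%:R.
apply: (@le_trans _ _ (\sum_(m <- M) (\sum_(A | level P A) selberg P A * ind A m) ^+ 2)).
  rewrite /cnt -sum1_count natr_sum mulr_suml big_mkcond; apply: ler_sum => m _.
  case: ifP => [/forall_inP sm|_]; last exact: sqr_ge0.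
  rewrite mul1r (bigD1 set0) ?level0//= big1 ?addr0 => [|A /andP[/andP[AP _]]].
    rewrite /ind /selberg cards0 expr0 mul1r /set_prod big_set0 mul1r dvd1n mulr1.
    rewrite (_ : \sum_(_ | _) _ = S)//.
    by apply: eq_bigl => G; rewrite sub0set andbT.
  move=> /set0Pn[p pA]; rewrite /ind (_ : (_ %| _)%N = false) ?mulr0//.
  have pinP := subsetP AP _ pA.
  apply: contraNF (sm p pinP); apply: dvdn_trans.
  by rewrite (dvd_set_prod pP).
have -> : \sum_(m <- M) (\sum_(A | level P A) selberg P A * ind A m) ^+ 2 =
  \sum_(A | level P A) \sum_(B | level P B) selberg P A * selberg P B *
    (count (fun m => set_prod (A :|: B) %| m)%N M)%:R.
  under eq_bigr do rewrite expr2 big_distrlr/=.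
  rewrite exchange_big/=; apply: eq_bigr => A lA.
  rewrite exchange_big/=; apply: eq_bigr => B lB.
  rewrite -sum1_count natr_sum [X in _ = _ * X]big_mkcond [RHS]mulr_sumr; apply: eq_bigr => m _.
  have -> : (if (set_prod (A :|: B) %| m)%N then 1 else 0) = ind (A :|: B) m.
    by rewrite /ind; case: (_ %| _)%N.
  have -> : ind (A :|: B) m = ind A m * ind B m; last by ring.
  rewrite /ind -natrM mulnb; congr (nat_of_bool _)%:R.
  apply/idP/idP => [d|/andP[dA dB]].
    rewrite (dvdn_trans _ d) ?(dvdn_trans _ d)//.
      by rewrite (@set_prodD (A :|: B) B) ?subsetUr// dvdn_mulr.
    by rewrite (@set_prodD (A :|: B) A) ?subsetUl// dvdn_mulr.
  rewrite /set_prod -big_enum/= -(big_map val predT id).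
  have ABP : A :|: B \subset P.
    by move/andP: lA lB => [AP _] /andP[BP _]; rewrite subUset AP.
  apply: prod_primes_dvd.
  - by rewrite (map_inj_uniq val_inj) enum_uniq.
  - apply/allP => r /mapP[p pAB ->]; rewrite mem_enum in pAB.
    by apply: pP; exact: (subsetP ABP).
  move=> r /mapP[p pAB ->]; rewrite mem_enum in pAB.
  have pinP := subsetP ABP _ pAB.
  move: pAB; rewrite inE => /orP[] pA.
    by apply: dvdn_trans dA; move/andP: lA => [AP _]; rewrite (dvd_set_prod pP).
  by apply: dvdn_trans dB; move/andP: lB => [AP _]; rewrite (dvd_set_prod pP).
apply: (@le_trans _ _ (\sum_(A | level P A) \sum_(B | level P B)
   (X * (selberg P A * selberg P B / (set_prod (A :|: B))%:R) + S * S))).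
  apply: ler_sum => A lA; apply: ler_sum => B lB.
  have ABP : A :|: B \subset P.
    by move/andP: lA lB => [AP _] /andP[BP _]; rewrite subUset AP.
  have := MX _ ABP; set c := (count _ M)%:R; set d := _%:R => h.
  rewrite -lerBlDl.
  have -> : selberg P A * selberg P B * c - X * (selberg P A * selberg P B / d) =
     selberg P A * selberg P B * (c - X / d) by ring.
  apply: le_trans (ler_norm _) _; rewrite -[leRHS]mulr1.
  rewrite (normrM (selberg P A * selberg P B)) (normrM (selberg P A)).
  by apply: ler_pM; rewrite ?mulr_ge0//; apply: ler_pM => //; exact: selberg_bound.
under eq_bigr => A lA do rewrite big_split/= -mulr_sumr.
rewrite big_split/= -mulr_sumr selberg_quadratic// lerD2l.
have cl : (\sum_(A | level P A) 1 : R) <= z.+1%:R.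
  rewrite (eq_bigl (fun A => A \in [set A | level P A])); last by move=> A; rewrite inE.
  by rewrite sumr_const ler_nat card_level.
have -> : \sum_(A | level P A) \sum_(B | level P B) (S * S) =
   (\sum_(A | level P A) 1) * (\sum_(A | level P A) 1) * (S * S) :> R.
  rewrite -mulrA mulr_suml; apply: eq_bigr => A _; rewrite mul1r mulr_suml.
  by apply: eq_bigr => B _; rewrite mul1r.
rewrite exprMn expr2 [S ^+ 2]expr2 ler_wpM2r ?mulr_ge0// ?(ltW S0)//.
by rewrite ler_pM// sumr_ge0.
Qed.

End SelbergSieve.

(** * The size of the sieving weights *)

Section WeightSum.
Import mathcomp.boot.fintype mathcomp.boot.finset.
Variables (R : realType) (z : nat).
Implicit Types (P A : {set 'I_z.+1}).
Local Notation lnr n := (ln (n%:R : R)).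

(** Removing q from the sets that contain it leaves sets of level without q. *)
Lemma weight_sum_remove P (q : 'I_z.+1) : prime_pool P -> q \in P ->
  weight_sum R P <= weight_sum R (P :\ q) * (1 + ((q : nat)%:R - 1)^-1).
Proof.
move=> pP qP; have q1 := prime_gt1 (pP _ qP).
have qR : 0 < (q : nat)%:R - 1 :> R by rewrite subr_gt0 ltr1n.
rewrite /weight_sum (bigID (fun A => q \in A))/= addrC mulrDr mulr1 lerD//.
  rewrite le_eqVlt; apply/orP; left; apply/eqP; apply: eq_bigl => A.
  by rewrite /level subsetD1 -!andbA [(_ <= _)%N && _]andbC.
rewrite (reindex_onto (fun A => q |: A) (fun A => A :\ q))/=; last first.
  by move=> A /andP[_ qA]; rewrite setD1K.
rewrite mulr_suml; apply: (@le_trans _ _ (\sum_(A | level (P :\ q) A) weight R (q |: A))).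
  apply: ler_sum_pred => A.
    move=> /andP[/andP[lA _]] /eqP E.
    have qA : q \notin A by rewrite -E !inE eqxx.
    have := levelS pP (subsetUr _ _) lA.
    by rewrite /level subsetD1 qA andbT.
  move=> /andP[]; rewrite subsetD1 => /andP[AP _] _.
  apply/ltW/weight_gt0/(prime_poolS pP).
  by rewrite subUset sub1set qP.
apply: ler_sum => A /andP[]; rewrite subsetD1 => /andP[AP qA] _.
by rewrite weightU ?disjoints1// mulrC {2}/weight big_set1.
Qed.

Definition supp (n : nat) : {set 'I_z.+1} := [set p : 'I_z.+1 | prime p && (p %| n)%N].

Let supp_sum A : R := \sum_(n : 'I_z.+1 | (0 < n)%N && (supp n == A)) (n : nat)%:R^-1.

(** If n has support A, then n / p has support A or A minus p; hence the sum S
    (A) of inverses satisfies S (A) <= (S (A) + S (A minus p)) / p. *)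
Lemma supp_sum_step A p : p \in A -> prime_pool A ->
  supp_sum A <= supp_sum (A :\ p) * ((p : nat)%:R - 1)^-1.
Proof.
move=> pA /(_ _ pA) pp; have p1 := prime_gt1 pp.
have pR : 1 < (p : nat)%:R :> R by rewrite ltr1n.
suff : supp_sum A <= (p : nat)%:R^-1 * (supp_sum A + supp_sum (A :\ p)).
  rewrite ler_pdivlMl ?(lt_trans _ pR)// => E.
  by rewrite ler_pdivlMr ?subr_gt0//; lra.
pose f (n : 'I_z.+1) : 'I_z.+1 := inord (n %/ p).
have fE (n : 'I_z.+1) : (0 < n)%N -> supp n == A -> (p * f n = n)%N.
  move=> n0 /eqP sn; have : p \in supp n by rewrite sn.
  rewrite inE => /andP[_ pn]; rewrite /f inordK; first by rewrite mulnC divnK.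
  by rewrite ltnS (leq_trans (leq_div _ _))// -ltnS.
rewrite {1}/supp_sum.
rewrite (eq_bigr (fun n => (p : nat)%:R^-1 * (f n : nat)%:R^-1)); last first.
  by move=> n /andP[n0 sn]; rewrite -{1}(fE _ n0 sn) natrM invfM.
rewrite -mulr_sumr ler_wpM2l ?invr_ge0//.
apply: (@le_trans _ _ (\sum_(m : 'I_z.+1 | (0 < m)%N && ((supp m == A) || (supp m == A :\ p)))
    (m : nat)%:R^-1)).
  apply: (ler_sum_inj (F := fun m : 'I_z.+1 => (m : nat)%:R^-1)) => //.
  - move=> m n /andP[m0 sm] /andP[n0 sn] E; apply: val_inj => /=.
    by rewrite -(fE _ m0 sm) -(fE _ n0 sn) E.
  move=> n /andP[n0 sn]; have E := fE _ n0 sn.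
  have f0 : (0 < f n)%N by move: n0; rewrite -{1}E muln_gt0 => /andP[].
  rewrite f0 /=.
  have sE : supp n = p |: supp (f n).
    apply/setP => r; rewrite !inE -{1}E.
    case: (boolP (prime r)) => [pr|pr]/=.
      by rewrite Euclid_dvdM// dvdn_prime2// -val_eqE.
    by rewrite orbF; apply/esym/negbTE; apply: contra pr => /eqP ->.
  case: (boolP (p \in supp (f n))) => pf.
    by rewrite -(eqP sn) sE (setUidPr _) ?sub1set// eqxx.
  by rewrite -(eqP sn) sE setU1K// eqxx orbT.
rewrite (bigID (fun m : 'I_z.+1 => supp m == A))/= lerD//.
  by apply: ler_sum_pred => // m /andP[/andP[-> _] ->].
by apply: ler_sum_pred => // m /andP[/andP[-> /orP[->|->]]].
Qed.

(** Without the bound on n this would be an equality, the expansion of the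
    product of the geometric series of 1 / p for p in A. *)
Lemma supp_sum_le A : prime_pool A -> supp_sum A <= weight R A.
Proof.
have [k] := ubnP #|A|; elim: k A => // k IH A.
case: (set_0Vmem A) => [->|[p pA]] Ak pool.
  rewrite /weight big_set0 /supp_sum.
  apply: (@le_trans _ _ (\sum_(n : 'I_z.+1 | n == inord 1) (n : nat)%:R^-1)).
    apply: ler_sum_pred => // n /andP[n0 /eqP sn].
    have n1 : (n : nat) = 1%N.
      apply/eqP; rewrite eqn_leq n0 andbT leqNgt; apply/negP => n1.
      have pn : (pdiv n < z.+1)%N by apply: leq_ltn_trans (ltn_ord n); exact: pdiv_leq.
      have : Ordinal pn \in supp n by rewrite inE/= pdiv_prime// pdiv_dvd.
      by rewrite sn inE.
    by apply/eqP/val_inj; rewrite /= inordK// -n1.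
  rewrite big_pred1_eq; case: (nat_of_ord _) => [|j]; first by rewrite invr0.
  by rewrite invf_le1 ?ltr0n// ler1n.
have := supp_sum_step pA pool; move/le_trans; apply.
have -> : A = p |: (A :\ p) by rewrite setD1K.
have w1 : weight R [set p] = ((p : nat)%:R - 1)^-1 by rewrite /weight big_set1.
rewrite weightU ?disjoints1 ?inE ?eqxx// w1 mulrC setU1K ?inE ?eqxx//.
have p1 := prime_gt1 (pool _ pA).
rewrite ler_wpM2l ?invr_ge0 ?subr_ge0 ?ler1n 1?ltnW//.
apply: IH; last by apply: prime_poolS pool _; exact: subsetDl.
by move: Ak; rewrite (cardsD1 p) pA; lia.
Qed.

Lemma harmonic_ge n : lnr n.+1 <= \sum_(1 <= k < n.+1) k%:R^-1.
Proof.
elim: n => [|n IH]; first by rewrite big_geq// ln1.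
rewrite big_nat_recr//=.
have n1 : 0 < n.+1%:R :> R by rewrite ltr0n.
have i0 : 0 < n.+1%:R^-1 :> R by rewrite invr_gt0.
have i1 : -1 < n.+1%:R^-1 :> R by apply: lt_trans i0; rewrite ltrN10.
have := le_ln1Dx i1.
have -> : 1 + n.+1%:R^-1 = n.+2%:R / n.+1%:R :> R.
  have n2 : n.+2%:R = n.+1%:R + 1 :> R by rewrite natr1.
  by rewrite n2; field; lra.
rewrite ln_div ?posrE ?ltr0n// lerBlDl => h1.
by apply: le_trans h1 _; rewrite lerD2r.
Qed.

(** Grouped by supports, the harmonic sum up to z is at most a sum of weights by
    [supp_sum_le]. *)
Lemma weight_sum_ge : (0 < z)%N -> lnr z <= weight_sum R [set p : 'I_z.+1 | prime p].
Proof.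
move=> z0; apply: (@le_trans _ _ (lnr z.+1)); first by rewrite ler_lnr.
apply: le_trans (harmonic_ge z) _.
have -> : \sum_(1 <= k < z.+1) k%:R^-1 = \sum_(n : 'I_z.+1 | (0 < n)%N) (n : nat)%:R^-1 :> R.
  rewrite -(big_mkord (fun n => 0 < n)%N (fun n => n%:R^-1 : R)).
  by rewrite big_mkcond [RHS]big_mkcond/= [RHS]big_nat_recl//= add0r big_add1.
rewrite (partition_big (fun n : 'I_z.+1 => supp n) (level [set p : 'I_z.+1 | prime p]))/=; last first.
  move=> n n0; apply/andP; split.
    by apply/subsetP => p; rewrite !inE => /andP[].
  apply: (@leq_trans n); last by rewrite -ltnS.
  apply: dvdn_leq => //; rewrite /set_prod -big_enum/= -(big_map val predT id).
  apply: prod_primes_dvd.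
  - by rewrite (map_inj_uniq val_inj) enum_uniq.
  - by apply/allP => r /mapP[p + ->]; rewrite mem_enum inE => /andP[].
  by move=> r /mapP[p + ->]; rewrite mem_enum inE => /andP[].
apply: ler_sum => A /andP[AP _]; apply: supp_sum_le.
by move=> p /(subsetP AP); rewrite inE.
Qed.

End WeightSum.

(** * Primes in the progression 1 modulo a prime *)

Section Progressions.
Variable R : realType.
Local Notation lnr n := (ln (n%:R : R)).

Lemma count_mod (n M c : nat) : (c < M)%N ->
  count (fun m => m %% M == c)%N (iota 0 n) = ((n + (M - 1 - c)) %/ M)%N.
Proof.
move=> cM; have M0 : (0 < M)%N by lia.
elim: n => [|n IH]; first by rewrite /= add0n divn_small//; lia.
rewrite -addn1 iotaD count_cat IH/= add0n addn0 -addnA add1n addnS divnS// addnC.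
congr (_ + _)%N; congr nat_of_bool.
have -> : (n + (M - 1 - c)).+1 = (n + (M - c))%N by lia.
have [nc|nc] := leqP c (n %% M).
  have -> : (n + (M - c) = (n %/ M) * M + M + (n %% M - c))%N.
    by rewrite {1}(divn_eq n M); have := ltn_pmod n M0; lia.
  rewrite -mulSnr dvdn_addr ?dvdn_mull//.
  apply/idP/idP => [/eqP->|]; first by rewrite subnn dvdn0.
  have := ltn_pmod n M0 => h1 h2; apply/eqP; move: h2 => h2.
  have : (n %% M - c < M)%N by lia.
  case E : (n %% M - c)%N h2 => [|k]; first by lia.
  by move=> /dvdn_leq/= /(_ isT); lia.
have -> : (n + (M - c) = (n %/ M) * M + (M - (c - n %% M)))%N.
  by rewrite {1}(divn_eq n M); lia.
rewrite dvdn_addr ?dvdn_mull// (ltn_eqF nc); apply/esym/negP => /dvdn_leq.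
lia.
Qed.

Lemma count_mod_near (s l M c : nat) : (c < M)%N ->
  `|(count (fun m => m %% M == c)%N (iota s l))%:R - l%:R / M%:R| <= 1 :> R.
Proof.
move=> cM; have M0 : (0 < M)%N by lia.
have E : (count (fun m => m %% M == c) (iota s l) =
   (s + l + (M - 1 - c)) %/ M - (s + (M - 1 - c)) %/ M)%N.
  rewrite -!count_mod// iotaD count_cat add0n; lia.
rewrite E natrB; last by rewrite leq_div2r// leq_add2r leq_addr.
have MR : 0 < M%:R :> R by rewrite ltr0n.
have := ler_divn R (s + l + (M - 1 - c)) M.
have := ger_divn R (s + l + (M - 1 - c)) M0.
have := ler_divn R (s + (M - 1 - c)) M.
have := ger_divn R (s + (M - 1 - c)) M0.
set u := (_ %/ _)%:R; set v := (_ %/ _)%:R.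
rewrite !natrD !mulrDl ler_norml.
set a := s%:R / _; set b := l%:R / _; set e := (_ - _)%:R / _.
lra.
Qed.

(** By the Chinese remainder theorem both conditions together define one residue
    class modulo q r. *)
Lemma count_mod1_dvd_near (s l q r : nat) : coprime q r -> (0 < q)%N -> (0 < r)%N ->
  `|(count (fun m => (m == 1 %[mod q]) && (r %| m))%N (iota s l))%:R
     - l%:R / q%:R / r%:R| <= 1 :> R.
Proof.
move=> qr q0 r0.
have c_lt : (chinese q r 1 0 %% (q * r) < q * r)%N by rewrite ltn_pmod// muln_gt0 q0.
have := count_mod_near s l c_lt.
rewrite natrM invfM mulrA; congr (`|_%:R - _| <= 1); apply: eq_count => m /=.
have cE : (chinese q r 1 0 %% (q * r) = chinese q r 1 0 %[mod q * r])%N by rewrite modn_mod.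
by rewrite (chinese_remainder qr) (chinese_modl qr) (chinese_modr qr) mod0n.
Qed.

(** The primes to be counted have no prime factor at most z, so the integers of
    [x, 2x) that are 1 modulo q can be sieved by the primes at most z other than
    q; leaving out q costs at most a factor 1 - 1 / q in [weight_sum_ge]. *)
Theorem sieve_prime_progression (x q z : nat) : prime q -> (1 < z)%N -> (z < x)%N ->
  (count (fun p => prime p && (q %| p.-1)%N) (iota x x))%:R
    <= x%:R / ((q%:R - 1) * lnr z) + z.+1%:R ^+ 2 :> R.
Proof.
move=> pq z1 zx; have q1 := prime_gt1 pq.
have qR : 1 < q%:R :> R by rewrite ltr1n.
pose P := finset (fun p : 'I_z.+1 => prime p && ((p : nat) != q)).
have pP : prime_pool P by move=> p; rewrite finset.inE => /andP[].
have lz : 0 < lnr z by rewrite ln_gt0// ltr1n.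
have Sge : (1 - q%:R^-1) * lnr z <= weight_sum R P.
  have qi : 0 < q%:R^-1 :> R by rewrite invr_gt0; lra.
  have z0 : (0 < z)%N by lia.
  have := @weight_sum_ge R z z0; set P0 := finset _ => W.
  case: (leqP q z) => qz.
    have qz' : (q < z.+1)%N by [].
    have pP0 : prime_pool P0 by move=> p; rewrite finset.inE.
    have qP0 : Ordinal qz' \in P0 by rewrite finset.inE.
    have := weight_sum_remove R pP0 qP0.
    have -> : finset.setD P0 (finset.set1 (Ordinal qz')) = P.
      by apply/finset.setP => p; rewrite !finset.inE andbC -val_eqE.
    move=> /(le_trans W) /= h.
    have e : 1 + (q%:R - 1)^-1 = (1 - q%:R^-1)^-1 :> R by field; lra.
    move: h; rewrite e ler_pdivlMr; first by rewrite mulrC.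
    by rewrite subr_gt0 invf_lt1//; lra.
  have -> : P = P0.
    apply/finset.setP => p; rewrite !finset.inE andb_idr// => _.
    by rewrite ltn_eqF// (leq_trans _ qz)// ltn_ord.
  apply: le_trans W; rewrite ler_piMl ?(ltW lz)//; lra.
have S0 : 0 < weight_sum R P.
  apply: lt_le_trans Sge; rewrite mulr_gt0// subr_gt0 invf_lt1//; lra.
pose M := [seq m <- iota x x | m == 1 %[mod q]].
have := @selberg_sieve R z P M (x%:R / q%:R) pP (ltnW z1).
have near1 (C : {set 'I_z.+1}) : C \subset P ->
  `|(count (fun m => set_prod C %| m)%N M)%:R - x%:R / q%:R / (set_prod C)%:R| <= 1 :> R.
  move=> CP; rewrite /M count_filter.
  have pC := prime_poolS pP CP.
  rewrite (eq_count (a2 := fun m => (m == 1 %[mod q]) && (set_prod C %| m)%N)); last first.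
    by move=> m /=; rewrite andbC.
  apply: count_mod1_dvd_near; rewrite ?set_prod_gt0 ?(prime_gt0 pq)//.
  rewrite (prime_coprime _ pq) /set_prod Euclid_dvd_prod// big_orE.
  apply/existsP => -[p /andP[pC']]; rewrite dvdn_prime2 ?pC//.
  by have := fintype.subsetP CP _ pC'; rewrite finset.inE eq_sym => /andP[_ /negP].
move=> /(_ near1) h.
apply: (@le_trans _ _ (x%:R / q%:R / weight_sum R P + z.+1%:R ^+ 2)); last first.
  rewrite lerD2r -mulrA ler_wpM2l// -invfM lef_pV2 ?posrE ?mulr_gt0//; try lra.
  apply: le_trans (_ : q%:R * ((1 - q%:R^-1) * lnr z) <= _); last by rewrite ler_wpM2l.
  rewrite mulrA mulrBr mulr1 mulfV ?lexx//; lra.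
rewrite -(ler_pM2r S0) mulrDl mulfVK ?gt_eqF//; apply: le_trans h.
rewrite ler_wpM2r ?(ltW S0)// ler_nat /M count_filter.
rewrite -(eq_in_count (a1 := fun p => (p \in iota x x) && (prime p && (q %| p.-1)%N))); last first.
  by move=> p /= ->.
apply: sub_count => p /=.
rewrite mem_iota => /andP[/andP[xp _] /andP[pp qp]].
apply/andP; split.
  apply/fintype.forall_inP => r; rewrite finset.inE => /andP[pr _].
  by rewrite dvdn_prime2// neq_ltn (leq_trans (ltn_ord r))// (leq_trans zx).
by rewrite eqn_mod_dvd ?prime_gt0// subn1.
Qed.

End Progressions.

(** * The friable part of p - 1 *)

Section ShiftedPrimes.
Variable R : realType.
Local Notation lnr n := (ln (n%:R : R)).

Lemma sum_ln_pred n : (0 < n)%N ->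
  \sum_(0 <= q < n.+1 | prime q) lnr q / (q%:R - 1) <= lnr n + 6.
Proof.
move=> n0; have := mertens_le R n0; have := sum_prime_ln_conv R n.+1.
have -> : \sum_(0 <= q < n.+1 | prime q) lnr q / (q%:R - 1) =
  mertens R n + \sum_(0 <= q < n.+1 | prime q) lnr q / (q%:R * (q%:R - 1)).
  rewrite /mertens -big_split/=; apply: eq_bigr => q /prime_gt1 q1.
  have qR : 1 < q%:R :> R by rewrite ltr1n.
  by field; apply/andP; split; lra.
lra.
Qed.

(** Logarithm of the largest squarefree Q-friable divisor of n. *)
Definition small_log (Q n : nat) : R :=
  \sum_(0 <= q < Q.+1 | prime q && (q %| n)%N) lnr q.

(** About x^(17/100) for x = 2^i. The exponent must exceed 1/6, about the
    largest exponent of a co-index of a regular prime that is not strong, and be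
    small enough for [sum_small_log_le] to stay below 2/3. *)
Definition smooth_cut (i : nat) : nat := (2 ^ (17 * (i %/ 100)))%N.

(** After exchanging the sums, each prime q <= Q = x^(17/100) contributes ln q
    times the number of primes that are 1 modulo q. The sieve of level z =
    x^(41/100) gives the main term x ln Q / ln z = (17/41) x, with error terms
    of total size about z^2 Q = x^(99/100). *)
Lemma sum_small_log_le (i : nat) : (50 <= i %/ 100)%N ->
  \sum_(2 ^ i <= p < 2 ^ i.+1 | prime p) small_log (smooth_cut i) p.-1
    <= 17 / 40 * (2 ^ i)%:R.
Proof.
set t := (i %/ 100)%N => t50; set x := (2 ^ i)%N.
(* Up to bounded factors x = 2^(100 t), z = x^(41/100) and Q = x^(17/100), so
   that z^2 Q = x^(99/100). *)
pose z := (2 ^ (41 * t))%N; set Q := smooth_cut i.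
have tR : 50 <= t%:R :> R by rewrite ler_nat.
have x0 : 0 < x%:R :> R by rewrite ltr0n expn_gt0.
have l2 := ln2_ge R; have l2' := ln2_le R.
have z1 : (1 < z)%N by rewrite -[1%N]/(2 ^ 0)%N ltn_exp2l//; lia.
have ti : (100 * t <= i)%N by rewrite mulnC leq_trunc_div.
have zx : (z < x)%N by rewrite ltn_exp2l//; lia.
have lzE : lnr z = 41 * t%:R * lnr 2 by rewrite lnrX// natrM.
have Q0 : (0 < Q)%N by rewrite expn_gt0.
have lQE : lnr Q = 17 * t%:R * lnr 2 by rewrite lnrX// natrM.
have lz0 : 0 < lnr z by rewrite lzE mulr_gt0 ?mulr_gt0//; lra.
have -> : \sum_(x <= p < 2 ^ i.+1 | prime p) small_log Q p.-1 =
  \sum_(0 <= q < Q.+1 | prime q) lnr q *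
    (count (fun p => prime p && (q %| p.-1)%N) (iota x x))%:R.
  rewrite /small_log (exchange_big_dep prime)/=; last by move=> p q _ /andP[].
  apply: eq_bigr => q pq; rewrite -sum1_count natr_sum mulr_sumr.
  rewrite /index_iota (_ : 2 ^ i.+1 - x = x)%N; last by rewrite expnS; lia.
  by apply: eq_big => [p|p _]; rewrite ?mulr1// pq.
apply: (@le_trans _ _ (\sum_(0 <= q < Q.+1 | prime q)
   (x%:R / lnr z * (lnr q / (q%:R - 1)) + z.+1%:R ^+ 2 * lnr q))).
  apply: ler_sum => q pq.
  apply: le_trans (ler_wpM2l (lnr_ge0 _ _) (sieve_prime_progression R pq z1 zx)) _.
  have qR : 1 < q%:R :> R by rewrite ltr1n prime_gt1.
  rewrite le_eqVlt; apply/orP; left; apply/eqP; field.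
  by apply/andP; split; [lra|rewrite gt_eqF].
rewrite big_split/= -!mulr_sumr.
have h1 := sum_ln_pred Q0.
have h2 := theta_le R Q; rewrite /theta in h2.
apply: (@le_trans _ _ (x%:R / lnr z * (lnr Q + 6) + z.+1%:R ^+ 2 * (4 * Q%:R))).
  apply: lerD; first by rewrite ler_wpM2l// divr_ge0// ltW.
  rewrite ler_wpM2l ?exprn_ge0//; apply: le_trans h2 _.
  by rewrite ler_piMr// mulr_ge0.
have h3 : x%:R / lnr z * (lnr Q + 6) <= 42 / 100 * x%:R.
  rewrite mulrAC ler_pdivrMr// lQE lzE -subr_ge0.
  have -> : 42 / 100 * x%:R * (41 * t%:R * lnr 2) - x%:R * (17 * t%:R * lnr 2 + 6) =
    x%:R * (22 / 100 * (t%:R * lnr 2) - 6) by field.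
  rewrite mulr_ge0 ?(ltW x0)//.
  have : 50 * (13 / 20) <= t%:R * lnr 2 by apply: ler_pM; lra.
  lra.
have h4 : z.+1%:R ^+ 2 * (4 * Q%:R) <= 1 / (2 * 100) * x%:R :> R.
  have zz : z.+1%:R <= 2 * z%:R :> R by rewrite -natrM ler_nat; move: z1; clear; lia.
  apply: (@le_trans _ _ ((2 * z%:R) ^+ 2 * (4 * Q%:R) : R)).
    by rewrite ler_wpM2r ?mulr_ge0// lerXn2r ?nnegrE ?mulr_ge0.
  have -> : (2 * z%:R) ^+ 2 * (4 * Q%:R) = 16 * (2 ^ (99 * t))%:R :> R.
    have -> : (2 ^ (99 * t) = z ^ 2 * Q)%N.
      by rewrite /z /Q /smooth_cut -/t -expnM -expnD; congr (_ ^ _)%N; clear; lia.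
    by rewrite natrM natrX; ring.
  have : (2 ^ (99 * t + 50) <= x)%N by rewrite leq_exp2l//; move: ti t50; clear; lia.
  rewrite -(@ler_nat R) expnD natrM => h5.
  have h6 : 16 * (16 * 16) <= (2 ^ 50)%:R :> R.
    by rewrite -!natrM ler_nat -[(16 * (16 * 16))%N]/(2 ^ 12)%N leq_exp2l.
  have h7 : (2 ^ (99 * t))%:R * (16 * (16 * 16)) <= x%:R :> R.
    by apply: le_trans h5; rewrite ler_wpM2l.
  have x0' := ltW x0; move: x0' h7; clear; lra.
lra.
Qed.

End ShiftedPrimes.

(** * Products and least common multiples *)

Section GcdLcm.
Implicit Types (x y g : nat).

Lemma gcdn_lcm_le x y L : (0 < x)%N -> (gcdn x (lcmn y L) <= gcdn x y * gcdn x L)%N.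
Proof.
move=> x0; apply: dvdn_leq; first by rewrite muln_gt0 !gcdn_gt0 x0.
have dx := dvdn_gcdl x (lcmn y L).
have dyL : (gcdn x (lcmn y L) %| y * L)%N.
  by apply: (dvdn_trans (dvdn_gcdr _ _)); rewrite -muln_lcm_gcd dvdn_mulr.
by rewrite muln_gcdl !muln_gcdr !dvdn_gcd dyL !(dvdn_mulr _ dx) (dvdn_mull _ dx).
Qed.

Definition lcm_over (I : Type) (s : seq I) (f : I -> nat) : nat :=
  \big[lcmn/1%N]_(i <- s) f i.

Lemma lcm_over_dvd (I : eqType) (s : seq I) (f : I -> nat) m :
  {in s, forall i, (f i %| m)%N} -> (lcm_over s f %| m)%N.
Proof.
rewrite /lcm_over; elim: s => [|i s IH] fm; first by rewrite big_nil dvd1n.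
rewrite big_cons dvdn_lcm fm ?mem_head// IH// => j js.
by apply: fm; rewrite inE js orbT.
Qed.

Lemma prime_dvd_lcm_over (I : eqType) (s : seq I) (f : I -> nat) q : prime q ->
  (q %| lcm_over s f)%N -> exists2 i, i \in s & (q %| f i)%N.
Proof.
move=> pq; rewrite /lcm_over; elim: s => [|i s IH].
  by rewrite big_nil Euclid_dvd1.
rewrite big_cons => qL.
have : (q %| f i * \big[lcmn/1%N]_(j <- s) f j)%N.
  by rewrite -muln_lcm_gcd dvdn_mulr.
rewrite Euclid_dvdM// => /orP[qi|/IH[j js qj]]; first by exists i; rewrite ?mem_head.
by exists j; rewrite // inE js orbT.
Qed.

(** Adding i to the family multiplies the lcm by f i / gcd (f i, lcm), and that
    gcd is at most g to the number of other members. *)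
Lemma prod_le_lcm (I : eqType) (s : seq I) (f : I -> nat) g : uniq s -> (0 < g)%N ->
  {in s, forall i, (0 < f i)%N} ->
  {in s &, forall i j, i != j -> (gcdn (f i) (f j) <= g)%N} ->
  (\prod_(i <- s) f i <= g ^ (size s ^ 2) * lcm_over s f)%N.
Proof.
move=> + g0; rewrite /lcm_over; elim: s => [|i s IH] /=; first by rewrite !big_nil.
move=> /andP[iNs us] f0 fg; rewrite !big_cons.
set L := \big[lcmn/1%N]_(j <- s) f j.
have fi0 : (0 < f i)%N by rewrite f0 ?mem_head.
have E := muln_lcm_gcd (f i) L.
have gL : (gcdn (f i) L <= g ^ size s)%N.
  have : {in s, forall j, (gcdn (f i) (f j) <= g)%N}.
    move=> j js; apply: fg; rewrite ?mem_head ?inE ?js ?orbT//.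
    by apply: contraNneq iNs => ->.
  rewrite /L; elim: {us iNs f0 fg L E IH} s => [|j s IH] h.
    by rewrite big_nil gcdn1.
  rewrite big_cons expnS; apply: leq_trans (gcdn_lcm_le _ _ fi0) _.
  apply: leq_mul; first by rewrite h ?mem_head.
  by apply: IH => k ks; apply: h; rewrite inE ks orbT.
have IH' : (\prod_(j <- s) f j <= g ^ (size s ^ 2) * L)%N.
  apply: IH => // [j js|j k js ks]; first by rewrite f0// inE js orbT.
  by apply: fg; rewrite inE ?js ?ks orbT.
apply: (leq_trans (leq_mul (leqnn (f i)) IH')).
rewrite mulnCA -E [(lcmn _ _ * _)%N]mulnC mulnA leq_mul2r; apply/orP; right.
apply: (leq_trans (leq_mul (leqnn _) gL)); rewrite -expnD leq_pexp2l//; lia.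
Qed.

End GcdLcm.

(** * Orders modulo a prime *)

Section Orders.
Variable p : nat.
Hypothesis pp : prime p.
Local Notation red c := (c%:~R : 'F_p).

Lemma red_eq0 (m : int) : (red m == 0) = (p%:Z %| m)%Z.
Proof.
have natE (n : nat) : ((n%:R : 'F_p) == 0) = (p %| n)%N.
  by rewrite -(dvdn_pcharf (pchar_Fp pp)).
case: m => n; first by rewrite -[red n]/(n%:R) natE dvdzE.
by rewrite NegzE mulrNz oppr_eq0 -[red n.+1]/(n.+1%:R) natE dvdzE abszN.
Qed.

Lemma red_unit_eq (c : int) k : (red c ^+ k == 1) = (p%:Z %| c ^+ k - 1)%Z.
Proof. by rewrite -red_eq0 rmorphB/= rmorphXn/= subr_eq0. Qed.

(** The powers of a unit are purely periodic, so that periods are exponents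
    killing it. *)
Lemma eventual_period_red (c : int) d : red c != 0 ->
  eventual_period c p d <-> (0 < d)%N /\ red c ^+ d = 1.
Proof.
move=> c0; split=> [[d0 [N h]]|[d0 h]]; split=> //; last first.
  exists 0%N => m _; apply/eqP; rewrite eqz_mod_dvd -red_eq0 rmorphB/= !rmorphXn/=.
  by rewrite exprD h mulr1 subrr.
have /eqP := h N (leqnn N); rewrite eqz_mod_dvd -red_eq0 rmorphB/= !rmorphXn/=.
rewrite subr_eq0 exprD => /eqP e.
by apply: (mulfI (expf_neq0 N c0)); rewrite mulr1.
Qed.

Lemma ell_gt0 (c : int) n : (0 < n)%N -> (0 < ell c n)%N.
Proof. by move=> n0; case: (ellP c n0) => -[]. Qed.

Lemma ell_dvdE (c : int) k : red c != 0 -> (ell c p %| k)%N = (red c ^+ k == 1).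
Proof.
move=> c0; have p0 := prime_gt0 pp.
have [/(eventual_period_red _ c0)[l0 l1] lmin] := ellP c p0.
apply/idP/eqP => [/dvdnP[m ->]|ck]; first by rewrite mulnC exprM l1 expr1n.
rewrite /dvdn; apply/negPn/negP; rewrite -lt0n => r0.
have := ltn_pmod k l0; rewrite ltnNge => /negP; apply; apply: lmin.
apply/(eventual_period_red _ c0); split=> //.
move: ck; rewrite {1}(divn_eq k (ell c p)) exprD mulnC exprM l1 expr1n mul1r.
by [].
Qed.

(** A period modulo n is a period modulo p. *)
Lemma ell_dvd_ell (c : int) n : red c != 0 -> (0 < n)%N -> (p %| n)%N ->
  (ell c p %| ell c n)%N.
Proof.
move=> c0 n0 pn; have [[d0 [N h]] _] := ellP c n0.
have ep : eventual_period c p (ell c n).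
  split=> //; exists N => m /h /eqP; rewrite eqz_mod_dvd => hd.
  apply/eqP; rewrite eqz_mod_dvd; apply: dvdz_trans hd.
  by rewrite dvdzE.
by rewrite ell_dvdE//; have [_ ->] := (eventual_period_red (ell c n) c0).1 ep.
Qed.

Lemma ell_dvd_pred (c : int) : red c != 0 -> (ell c p %| p.-1)%N.
Proof.
move=> c0; rewrite ell_dvdE//.
have := expf_card (red c); rewrite card_Fp// => e.
apply/eqP/(mulfI c0); rewrite mulr1 -exprS prednK ?prime_gt0//.
Qed.

End Orders.

(** * The five orders modulo a prime *)

Section FiveOrders.
Variables (p : nat) (a b : int).
Hypothesis pp : prime p.
Local Notation red c := (c%:~R : 'F_p).
Hypotheses (a0 : red a != 0) (b0 : red b != 0).

(** Exponent vectors of a, b, ab, a^2 b and a b^2; any two have determinant 1, 2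
    or 3 up to sign. *)
Definition five : seq (nat * nat) := [:: (1, 0); (0, 1); (1, 1); (2, 1); (1, 2)]%N.
Definition mono (a b : int) (e : nat * nat) : int := a ^+ e.1 * b ^+ e.2.
(** The order of the subgroup generated by a and b, a cyclic group, when p is a
    prime not dividing a b. *)
Definition join_order (a b : int) (p : nat) : nat := lcmn (ell a p) (ell b p).

Local Notation D := (join_order a b p).

Lemma red_mono e : red (mono a b e) = red a ^+ e.1 * red b ^+ e.2.
Proof. by rewrite /mono rmorphM/= !rmorphXn. Qed.

Lemma red_mono_neq0 e : red (mono a b e) != 0.
Proof. by rewrite red_mono mulf_neq0// expf_neq0. Qed.

Lemma join_order_gt0 : (0 < D)%N.
Proof. by rewrite lcmn_gt0 !ell_gt0// prime_gt0. Qed.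

Lemma join_order_dvdE k : (D %| k)%N = (red a ^+ k == 1) && (red b ^+ k == 1).
Proof. by rewrite dvdn_lcm !ell_dvdE. Qed.

Lemma ell_dvd_join e : (ell (mono a b e) p %| D)%N.
Proof.
rewrite ell_dvdE ?red_mono_neq0// red_mono exprMn -!exprM.
have := dvdnn D; rewrite join_order_dvdE => /andP[/eqP h1 /eqP h2].
by rewrite mulnC exprM h1 expr1n mul1r mulnC exprM h2 expr1n.
Qed.

Lemma join_order_dvd_pred : (D %| p.-1)%N.
Proof. by rewrite dvdn_lcm !ell_dvd_pred. Qed.

(** Cramer's rule: if the forms e and f are killed by L, then a and b are killed
    by L times the determinant of e and f. *)
Lemma join_dvd_det (e f : nat * nat) L d : (e.1 * f.2 = f.1 * e.2 + d)%N ->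
  (ell (mono a b e) p %| L)%N -> (ell (mono a b f) p %| L)%N -> (D %| d * L)%N.
Proof.
move=> det; rewrite !ell_dvdE ?red_mono_neq0// !red_mono.
set x := red a; set y := red b => /eqP he /eqP hf.
rewrite join_order_dvdE -/x -/y; apply/andP; split; apply/eqP.
  have h1 : x ^+ (e.1 * f.2 * L) * y ^+ (e.2 * f.2 * L) = 1.
    by rewrite -[RHS](expr1n _ f.2) -he -exprM exprMn -!exprM; congr (_ ^+ _ * _ ^+ _); lia.
  have h2 : x ^+ (f.1 * e.2 * L) * y ^+ (e.2 * f.2 * L) = 1.
    by rewrite -[RHS](expr1n _ e.2) -hf -exprM exprMn -!exprM; congr (_ ^+ _ * _ ^+ _); lia.
  have nz : x ^+ (f.1 * e.2 * L) * y ^+ (e.2 * f.2 * L) != 0 by rewrite h2 oner_neq0.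
  apply: (mulfI nz); rewrite mulr1 [RHS]h2 -[RHS]h1 det mulnDl exprD.
  by rewrite mulrAC.
have h1 : x ^+ (e.1 * f.1 * L) * y ^+ (f.1 * e.2 * L) = 1.
  by rewrite -[RHS](expr1n _ f.1) -he -exprM exprMn -!exprM; congr (_ ^+ _ * _ ^+ _); lia.
have h2 : x ^+ (e.1 * f.1 * L) * y ^+ (e.1 * f.2 * L) = 1.
  by rewrite -[RHS](expr1n _ e.1) -hf -exprM exprMn -!exprM; congr (_ ^+ _ * _ ^+ _); lia.
have nz : x ^+ (e.1 * f.1 * L) * y ^+ (f.1 * e.2 * L) != 0 by rewrite h1 oner_neq0.
by apply: (mulfI nz); rewrite mulr1 [RHS]h1 -[RHS]h2 det mulnDl exprD mulrA.
Qed.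

(** The index of the subgroup generated by the form e in the subgroup generated
    by a and b. *)
Definition co_index (a b : int) (p : nat) (e : nat * nat) : nat :=
  (join_order a b p %/ ell (mono a b e) p)%N.
Local Notation u := (co_index a b p).

Lemma co_indexE e : (ell (mono a b e) p * u e)%N = D.
Proof. by rewrite mulnC divnK// ell_dvd_join. Qed.

Lemma co_index_gt0 e : (0 < u e)%N.
Proof. by have := join_order_gt0; rewrite -(co_indexE e) muln_gt0 => /andP[]. Qed.

Lemma co_index_dvd e : (u e %| D)%N.
Proof. by rewrite -(co_indexE e) dvdn_mull. Qed.

(** If g divides both co-indices, both forms are killed by D / g. By
    [join_dvd_det] D divides det * D / g, so that g divides the determinant. *)
Lemma gcd_co_index_le e f : e \in five -> f \in five -> e != f ->
  (gcdn (u e) (u f) <= 3)%N.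
Proof.
have key e' f' d : (e'.1 * f'.2 = f'.1 * e'.2 + d)%N -> (0 < d <= 3)%N ->
    (gcdn (u e') (u f') <= 3)%N.
  move=> det /andP[d0 d3]; apply: leq_trans d3; apply: dvdn_leq => //.
  set g := gcdn _ _; have g0 : (0 < g)%N by rewrite gcdn_gt0 co_index_gt0.
  have gD : (g %| D)%N by apply: dvdn_trans (co_index_dvd e'); exact: dvdn_gcdl.
  have DE : D = (D %/ g * g)%N by rewrite divnK.
  have q0 : (0 < D %/ g)%N by rewrite divn_gt0// dvdn_leq// join_order_gt0.
  have dv e'' : (g %| u e'')%N -> (ell (mono a b e'') p %| D %/ g)%N.
    move=> gu; rewrite -(co_indexE e'') -muln_divA// dvdn_mulr//.
  have := join_dvd_det det (dv e' (dvdn_gcdl _ _)) (dv f' (dvdn_gcdr _ _)).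
  by rewrite {1}DE [(d * _)%N]mulnC dvdn_pmul2l.
move=> e5 f5 ef.
have : all (fun e' => all (fun f' => (e' == f') ||
   ((0 < (e'.1 * f'.2 - f'.1 * e'.2) + (f'.1 * e'.2 - e'.1 * f'.2) <= 3)%N)) five) five by [].
move=> /allP/(_ e e5)/allP/(_ f f5); rewrite (negbTE ef)/=.
case: (leqP (f.1 * e.2) (e.1 * f.2)) => h d3.
  apply: (key e f (e.1 * f.2 - f.1 * e.2)%N); first by rewrite subnKC.
  by move: d3; rewrite [(f.1 * _ - _)%N](eqP h) addn0.
rewrite gcdnC; apply: (key f e (f.1 * e.2 - e.1 * f.2)%N).
  by rewrite subnKC// ltnW.
by move: d3; rewrite [(e.1 * _ - _)%N](eqP (ltnW h)).
Qed.

Lemma prod_co_index_le : (\prod_(e <- five) u e <= 3 ^ 25 * D)%N.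
Proof.
have h : (\prod_(e <- five) u e <= 3 ^ (size five ^ 2) * lcm_over five u)%N.
  apply: prod_le_lcm => // [e _|e f]; first exact: co_index_gt0.
  exact: gcd_co_index_le.
apply: leq_trans h _; rewrite leq_mul2l; apply/orP; right.
apply: dvdn_leq; first exact: join_order_gt0.
by apply: lcm_over_dvd => e _; exact: co_index_dvd.
Qed.

(** A prime larger than all co-indices is coprime to their lcm, and can be added
    to the product for free. *)
Lemma prod_co_index_prime_le q : prime q -> (q %| D)%N ->
  {in five, forall e, (u e < q)%N} -> (q * \prod_(e <- five) u e <= 3 ^ 25 * D)%N.
Proof.
move=> pq qD uq.
have h : (\prod_(e <- five) u e <= 3 ^ (size five ^ 2) * lcm_over five u)%N.
  apply: prod_le_lcm => // [e _|e f]; first exact: co_index_gt0.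
  exact: gcd_co_index_le.
apply: (leq_trans (leq_mul (leqnn q) h)); rewrite mulnCA leq_mul2l; apply/orP; right.
apply: dvdn_leq; first exact: join_order_gt0.
rewrite Gauss_dvd; last first.
  rewrite prime_coprime//; apply/negP => /(prime_dvd_lcm_over pq)[e e5].
  by move=> /(dvdn_leq (co_index_gt0 e)); rewrite leqNgt uq.
by rewrite qD; apply: lcm_over_dvd => e _; exact: co_index_dvd.
Qed.

End FiveOrders.

(** * Counting primes with small orders *)

Section Counting.

Lemma count_dvd k n : (0 < k)%N -> count (fun m => k %| m)%N (iota 1 n) = (n %/ k)%N.
Proof.
move=> k0; elim: n => [|n IH]; first by rewrite div0n.
by rewrite -[n.+1]addn1 iotaD count_cat IH/= addn0 add1n addn1 divnS// addnC.
Qed.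

Lemma count_exists_le (I J : eqType) (s : seq I) (t : seq J) (A : pred I) (P : J -> pred I) :
  {in s, forall m, A m -> exists2 d, d \in t & P d m} ->
  (count A s <= \sum_(d <- t) count (P d) s)%N.
Proof.
move=> h; have -> : (\sum_(d <- t) count (P d) s = \sum_(m <- s) \sum_(d <- t) P d m)%N.
  rewrite exchange_big/=; apply: eq_bigr => d _.
  by rewrite -sum1_count big_mkcond; apply: eq_bigr => m _; case: (P d m).
rewrite -sum1_count big_mkcond big_seq [leqRHS]big_seq; apply: leq_sum => m /h.
case: (A m) => // /(_ isT)[d dt Pd].
by rewrite (big_rem _ dt)/= Pd.
Qed.

Lemma count_prime_pred_dvd (x k : nat) : (0 < k)%N ->
  (count (fun p => prime p && (k %| p.-1)) (iota x x) <= x.*2 %/ k)%N.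
Proof.
move=> k0; rewrite -count_dvd//.
apply: (@leq_trans (count (fun p => prime p && (k %| p.-1)%N) (iota 0 (2 + x.*2)))).
  have -> : (2 + x.*2 = x + (x + 2))%N by lia.
  by rewrite !iotaD !count_cat add0n addnCA leq_addr.
rewrite iotaD count_cat/= !add0n (iotaDl 1 1) count_map.
by apply: sub_count => m /= /andP[_].
Qed.

(** The product of distinct primes dividing f is at most |f|. *)
Lemma size_primes_le (f : int) (h : nat) (s : seq nat) : uniq s -> all prime s ->
  f != 0 -> (`|f| <= 2 ^ h)%N -> {in s, forall p, (p %| `|f|)%N} -> (size s <= h)%N.
Proof.
move=> us ps f0 fh sf; rewrite -(@leq_exp2l 2)//; apply: leq_trans fh.
have := prod_primes_dvd us ps sf; move=> /dvdn_leq; rewrite absz_gt0 f0 => /(_ isT).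
apply: leq_trans; elim: s {us sf} ps => [|p s IH] /=; first by rewrite big_nil.
by move=> /andP[pp ps]; rewrite big_cons expnS leq_mul ?prime_gt1// IH.
Qed.

Lemma size_primes_family_le (fs : seq int) (h : nat) (s : seq nat) :
  uniq s -> all prime s ->
  {in fs, forall f : int, f != 0 /\ (absz f <= 2 ^ h)%N} ->
  {in s, forall p, exists2 f, f \in fs & (p %| absz f)%N} -> (size s <= size fs * h)%N.
Proof.
move=> us ps fh sf; rewrite -(count_predT s).
apply: (leq_trans (@count_exists_le _ _ s fs predT (fun f p => p %| `|f|)%N _)).
  by move=> p /sf[f ffs pf] _; exists f.
rewrite -sum1_size big_distrl/= big_seq [leqRHS]big_seq; apply: leq_sum => f /fh[f0 fle].
rewrite mul1n -size_filter; apply: size_primes_le f0 fle _.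
- exact: filter_uniq.
- by apply/allP => p; rewrite mem_filter => /andP[_ /(allP ps)].
- by move=> p; rewrite mem_filter => /andP[].
Qed.

End Counting.

Section Collision.
Variables (a b : int).
Hypotheses (a0 : a != 0) (b0 : b != 0).
Hypothesis indep : mult_independent [tuple a%:~R; b%:~R].
Variable h : nat.
Hypotheses (h0 : (0 < h)%N) (ah : (`|a| <= 2 ^ h)%N) (bh : (`|b| <= 2 ^ h)%N).

Lemma indep2 (i j : int) : (a%:~R : rat) ^ i * (b%:~R : rat) ^ j = 1 -> i = 0 /\ j = 0.
Proof.
move=> e; have := indep (e := fun k : 'I_2 => if k == ord0 then i else j).
rewrite !big_ord_recl big_ord0 mulr1 !(tnth_nth 0)/= => /(_ e) H.
by split; [exact: (H ord0)|exact: (H (lift ord0 ord0))].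
Qed.

Lemma mono_neq1 (i j : nat) : (0 < i + j)%N -> a ^+ i * b ^+ j != 1.
Proof.
move=> ij; apply/eqP => /(congr1 (fun c : int => c%:~R : rat)).
rewrite rmorphM/= !rmorphXn/= => e.
have [] := @indep2 i j; first exact: e.
by move=> [i0] [j0]; rewrite i0 j0 in ij.
Qed.

Lemma pow_neq (i j : nat) : (0 < i + j)%N -> a ^+ i != b ^+ j.
Proof.
move=> ij; apply/eqP => /(congr1 (fun c : int => c%:~R : rat)).
rewrite !rmorphXn/= => e.
have [] := @indep2 i (- (j%:Z)).
  rewrite -exprz_inv -[LHS]/(a%:~R ^+ i * b%:~R^-1 ^+ j) e -exprMn mulfV ?expr1n//.
  by rewrite intr_eq0.
move=> [i0] /eqP; rewrite oppr_eq0 => /eqP[j0]; by rewrite i0 j0 in ij.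
Qed.

Lemma absz_exp_le (c : int) (k m : nat) : (`|c| <= 2 ^ m)%N -> (`|c ^+ k| <= 2 ^ (m * k))%N.
Proof. by move=> cm; rewrite abszX expnM; case: k => // k; rewrite leq_exp2r. Qed.

Lemma absz_sub_le (c d : int) (m : nat) : (`|c| <= 2 ^ m)%N -> (`|d| <= 2 ^ m)%N ->
  (`|c - d| <= 2 ^ m.+1)%N.
Proof. by rewrite expnS; lia. Qed.

Definition good_reduction (p : nat) : bool := ~~ (p %| absz a)%N && ~~ (p %| absz b)%N.

Lemma good_reductionP p : prime p -> good_reduction p ->
  ((a%:~R : 'F_p) != 0) /\ ((b%:~R : 'F_p) != 0).
Proof.
by move=> pp; rewrite /good_reduction !red_eq0// !dvdzE => /andP[].
Qed.

(** Such a prime divides mono^k - 1 for some k in [1, K], a nonzero integer with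
    O(h K) binary digits. *)
Lemma count_small_ell (e : nat * nat) (K : nat) (s : seq nat) : e \in five ->
  uniq s -> all prime s -> all good_reduction s ->
  {in s, forall p, (ell (mono a b e) p <= K)%N} -> (size s <= 4 * h * K ^ 2)%N.
Proof.
move=> e5 us ps gs sK.
case: K sK => [|K] sK.
  case: s ps {us gs} sK => // p s /= /andP[pp _] /(_ p (mem_head _ _)).
  by rewrite leqn0 => /eqP; have := ell_gt0 (mono a b e) (prime_gt0 pp); case: ell.
pose fs := [seq mono a b e ^+ k - 1 | k <- iota 1 K.+1].
apply: (@leq_trans (size fs * (3 * h * K.+1).+1)); last first.
  by rewrite size_map size_iota -mulnn; nia.
apply: size_primes_family_le => //.
  move=> f /mapP[k]; rewrite mem_iota add1n ltnS => /andP[k0 kK] ->; split.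
    rewrite subr_eq0 /mono exprMn -!exprM mono_neq1// -mulnDl muln_gt0 k0 andbT.
    by move: e5; rewrite !inE => /or4P[|||/orP[]] /eqP ->.
  apply: absz_sub_le; last by rewrite expn_gt0.
  apply: (@leq_trans (2 ^ (3 * h * k))); last by rewrite leq_exp2l// leq_mul.
  apply: absz_exp_le; rewrite /mono abszM.
  apply: (@leq_trans (2 ^ (h * e.1) * 2 ^ (h * e.2))).
    by rewrite leq_mul// absz_exp_le.
  rewrite -expnD leq_exp2l// -mulnDr mulnC leq_mul2r; apply/orP; right.
  by move: e5; rewrite !inE => /or4P[|||/orP[]] /eqP ->.
move=> p psn; have pp := allP ps _ psn.
have [ra rb] := good_reductionP pp (allP gs _ psn).
exists (mono a b e ^+ ell (mono a b e) p - 1).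
  apply/mapP; exists (ell (mono a b e) p) => //.
  by rewrite mem_iota ell_gt0 ?prime_gt0//= add1n ltnS sK.
have := dvdnn (ell (mono a b e) p).
by rewrite ell_dvdE ?red_mono_neq0// red_unit_eq// dvdzE.
Qed.

(** If D < (K + 1)^2, the (K + 1)^2 elements x^i y^j with i, j <= K cannot be
    different roots of T^D - 1. Cancelling the smaller powers in x^i y^j = x^k
    y^l gives one of two shapes, according to whether k - i and l - j have the
    same sign. *)
Lemma collision p K : prime p -> good_reduction p -> (join_order a b p < K.+1 ^ 2)%N ->
  exists i j : nat, [/\ (i <= K)%N, (j <= K)%N, (0 < i + j)%N &
    (p %| absz (a ^+ i * b ^+ j - 1)%R)%N || (p %| absz (a ^+ i - b ^+ j)%R)%N].
Proof.
move=> pp gp DK; have [ra rb] := good_reductionP pp gp.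
set x : 'F_p := a%:~R in ra *; set y : 'F_p := b%:~R in rb *.
pose f (u : 'I_K.+1 * 'I_K.+1) : 'F_p := x ^+ u.1 * y ^+ u.2.
have /injectivePn[[i j] [[k l] neq ef]] : ~~ injectiveb f.
  apply/negP => /injectiveP fi.
  have := @max_unity_roots 'F_p (join_order a b p) [seq f u | u <- enum {: 'I_K.+1 * 'I_K.+1}].
  rewrite join_order_gt0// size_map -cardE card_prod card_ord (map_inj_uniq fi) enum_uniq.
  rewrite mulnn leqNgt DK => /(_ isT) H; apply: notF; apply: H => //.
  apply/allP => _ /mapP[u _ ->]; rewrite unity_rootE /f exprMn -!exprM.
  have := dvdnn (join_order a b p); rewrite join_order_dvdE// => /andP[/eqP h1 /eqP h2].
  by rewrite [(u.1 * _)%N]mulnC exprM h1 expr1n mul1r [(u.2 * _)%N]mulnC exprM h2 expr1n.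
rewrite /f /= in ef.
have toF (c : int) : (c%:~R : 'F_p) = 0 -> (p %| absz c)%N.
  by move=> /eqP; rewrite red_eq0// dvdzE.
wlog ik : i j k l neq ef / (i <= k)%N.
  move=> W; case: (leqP i k) => [|/ltnW] ik; first exact: (W i j k l).
  by apply: (W k l i j) => //; rewrite eq_sym.
have iK := ltn_ord i; have jK := ltn_ord j; have kK := ltn_ord k; have lK := ltn_ord l.
have ne : (i : nat) != k \/ (j : nat) != l.
  apply/orP; rewrite -negb_and; apply: contra neq => /andP[/eqP e1 /eqP e2].
  by apply/eqP; congr (_, _); exact: val_inj.
case: (leqP j l) => jl.
  exists (k - i)%N, (l - j)%N; split.
  - by move: kK; clear; lia.
  - by move: lK; clear; lia.
  - by move: ne ik jl; clear; lia.
  apply/orP; left; apply: toF; rewrite rmorphB rmorphM/= !rmorphXn/= -/x -/y.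
  apply/eqP; rewrite subr_eq0; apply/eqP.
  have nz : x ^+ i * y ^+ j != 0 by rewrite mulf_neq0// expf_neq0.
  by rewrite rmorph1; apply: (mulfI nz); rewrite mulr1 mulrACA -!exprD !subnKC.
exists (k - i)%N, (j - l)%N; split.
- by move: kK; clear; lia.
- by move: jK; clear; lia.
- by move: jl; clear; lia.
apply/orP; right; apply: toF; rewrite rmorphB/= !rmorphXn/= -/x -/y.
apply/eqP; rewrite subr_eq0; apply/eqP.
have nz : x ^+ i * y ^+ l != 0 by rewrite mulf_neq0// expf_neq0.
by apply: (mulfI nz); rewrite mulrAC -exprD subnKC// -ef -[RHS]mulrA -exprD subnKC// ltnW.
Qed.

(** By [collision] such a prime divides one of O(K^2) nonzero integers with O(h
    K) binary digits. *)
Lemma count_small_join (K : nat) (s : seq nat) :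
  uniq s -> all prime s -> all good_reduction s ->
  {in s, forall p, (join_order a b p < K.+1 ^ 2)%N} -> (size s <= 4 * h * K.+1 ^ 3)%N.
Proof.
move=> us ps gs sK.
pose ij := [seq u <- [seq (i, j) | i <- iota 0 K.+1, j <- iota 0 K.+1] | (0 < u.1 + u.2)%N].
pose fs := [seq a ^+ u.1 * b ^+ u.2 - 1 | u <- ij] ++ [seq a ^+ u.1 - b ^+ u.2 | u <- ij].
have sij : (size ij <= K.+1 ^ 2)%N.
  by rewrite size_filter (leq_trans (count_size _ _))// size_allpairs !size_iota mulnn.
apply: (@leq_trans (size fs * (2 * h * K).+1)); last first.
  rewrite size_cat !size_map addnn.
  apply: (@leq_trans ((K.+1 ^ 2).*2 * (2 * h * K.+1))).
    rewrite leq_mul ?leq_double//; nia.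
  by rewrite -muln2 !expnS expn0; nia.
have ijP u : u \in ij -> [/\ (u.1 <= K)%N, (u.2 <= K)%N & (0 < u.1 + u.2)%N].
  rewrite mem_filter => /andP[u0 /allpairsP[[i j] [iK jK E]]].
  by move: iK jK u0; rewrite E (mem_iota 0 K.+1) (mem_iota 0 K.+1) !add0n !ltnS.
have pa i j : (i <= K)%N -> (j <= K)%N -> (absz (a ^+ i * b ^+ j)%R <= 2 ^ (2 * h * K))%N.
  move=> iK jK; rewrite abszM; apply: (leq_trans (leq_mul (absz_exp_le _ ah) (absz_exp_le _ bh))).
  by rewrite -expnD leq_exp2l//; nia.
apply: size_primes_family_le => //.
  move=> f; rewrite mem_cat => /orP[] /mapP[u /ijP[u1 u2 u0] ->]; split.
  - by rewrite subr_eq0 mono_neq1.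
  - by apply: absz_sub_le; [exact: pa|rewrite expn_gt0].
  - by rewrite subr_eq0 pow_neq.
  - apply: absz_sub_le.
      by have := pa _ _ u1 (leq0n K); rewrite expr0 mulr1.
    by have := pa _ _ (leq0n K) u2; rewrite expr0 mul1r.
move=> p psn; have pp := allP ps _ psn.
have [i [j [iK jK ij0 d]]] := collision pp (allP gs _ psn) (sK _ psn).
have uij : (i, j) \in ij.
  rewrite mem_filter ij0 andTb; apply/allpairsP; exists (i, j).
  by rewrite !(mem_iota 0 K.+1) !add0n !ltnS.
case/orP: d => d.
  exists (a ^+ i * b ^+ j - 1) => //; rewrite mem_cat; apply/orP; left.
  by apply/mapP; exists (i, j).
exists (a ^+ i - b ^+ j) => //; rewrite mem_cat; apply/orP; right.
by apply/mapP; exists (i, j).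
Qed.

End Collision.

(** * Elementary asymptotics *)

Section Asymptotics.
Variable R : realType.
Local Notation lnr n := (ln (n%:R : R)).

Lemma lnr_le_expR (n : nat) (u : R) : lnr n <= u -> n%:R <= expR u.
Proof.
case: n => [|n] h; first exact: expR_ge0.
by rewrite -[leLHS]lnK ?posrE ?ltr0n// ler_expR.
Qed.

Lemma lnr_lt_expR (n : nat) (u : R) : lnr n < u -> n%:R < expR u.
Proof.
case: n => [|n] h; first exact: expR_gt0.
by rewrite -[ltLHS]lnK ?posrE ?ltr0n// ltr_expR.
Qed.

Lemma expR_lt_lnr (n : nat) (u : R) : (0 < n)%N -> u < lnr n -> expR u < n%:R.
Proof. by move=> n0 h; rewrite -[ltRHS]lnK ?posrE ?ltr0n// ltr_expR. Qed.

Lemma pow2_expR (i : nat) : (2 ^ i)%:R = expR (i%:R * lnr 2) :> R.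
Proof. by rewrite -lnrX// lnK// posrE ltr0n expn_gt0. Qed.

Lemma block_lnr (i p : nat) : (2 ^ i <= p < 2 ^ i.+1)%N ->
  i%:R * lnr 2 <= lnr p <= (i%:R + 1) * lnr 2.
Proof.
move=> /andP[ip pi]; have p0 : (0 < p)%N by apply: leq_trans ip; rewrite expn_gt0.
rewrite -lnrX// natr1 -lnrX//.
by rewrite !ler_lnr ?expn_gt0// ltnW.
Qed.

Lemma sum_inv_sqr_le (m n : nat) : (0 < m)%N ->
  \sum_(m <= d < n) ((d ^ 2)%:R : R)^-1 <= 2 / m%:R.
Proof.
move=> m0; case: (leqP n m) => [nm|/ltnW mn].
  by rewrite big_geq// divr_ge0.
suff : \sum_(m <= d < n) ((d ^ 2)%:R : R)^-1 <= 2 / m%:R - 2 / n%:R.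
  by move/le_trans; apply; rewrite gerBl divr_ge0.
rewrite -(subnKC mn); elim: (n - m)%N => [|k IH].
  by rewrite addn0 big_geq// subrr.
rewrite addnS big_nat_recr ?leq_addr//=; apply: le_trans (lerD IH (lexx _)) _.
have d0 : 0 < (m + k)%:R :> R by rewrite ltr0n; lia.
have d1 : 1 <= (m + k)%:R :> R by rewrite ler1n; lia.
set d := (m + k)%N in d0 d1 *.
rewrite -[d.+1%:R]natr1 natrX -subr_ge0.
have -> : 2 / m%:R - 2 / (d%:R + 1) - (2 / m%:R - 2 / d%:R + (d%:R ^+ 2)^-1) =
  (d%:R - 1) / (d%:R ^+ 2 * (d%:R + 1)) :> R.
  have m0' : 0 < m%:R :> R by rewrite ltr0n.
  by field; rewrite !gt_eqF//; lra.
by rewrite divr_ge0 ?mulr_ge0 ?exprn_ge0//; lra.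
Qed.

(** The linear factor is absorbed by half of the decay, a factor sqrt (r)^n. *)
Lemma linear_geometric_small (C r d : R) : 0 < r < 1 -> 0 < d ->
  exists n0, forall n, (n0 <= n)%N -> C * (n%:R + 1) * r ^+ n <= d.
Proof.
move=> /andP[r0 r1] d0.
pose s := Num.sqrt r.
have s0 : 0 < s by rewrite sqrtr_gt0.
have s1 : s < 1 by rewrite -sqrtr1 ltr_sqrt.
have ns (n : nat) : (n%:R + 1) * s ^+ n <= (1 - s)^-1.
  have s1' : `|s| < 1 by rewrite gtr0_norm.
  have := @geometric_le_lim R n.+1 1 s ler01 s0 s1'; rewrite mul1r; apply: le_trans.
  rewrite /series/= natr1 mulr_natl -[n.+1 in leLHS]subn0 -sumr_const_nat.
  apply: ler_sum_nat => k /andP[_ kn]; rewrite mul1r.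
  by rewrite ler_wiXn2l ?(ltW s0) ?(ltW s1)//.
have : (geometric (`|C| / (1 - s)) s n @[n --> \oo] --> (0 : R))%classic.
  by apply: cvg_geometric; rewrite gtr0_norm.
move=> /cvgrPdist_le/(_ _ d0)[n0 _ h]; exists n0 => n n0n.
have := h n n0n; rewrite /= sub0r normrN => h'.
have g0 : 0 <= `|C| / (1 - s) * s ^+ n.
  by rewrite !mulr_ge0 ?invr_ge0 ?subr_ge0 ?exprn_ge0 ?(ltW s0) ?(ltW s1).
rewrite ger0_norm// in h'.
apply: le_trans h'.
have -> : r ^+ n = s ^+ n * s ^+ n.
  by rewrite -exprMn -expr2 sqr_sqrtr// ltW.
rewrite mulrA ler_wpM2r ?exprn_ge0 ?(ltW s0)// -mulrA.
apply: le_trans (ler_norm _) _; rewrite normrM ler_wpM2l//.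
by rewrite ger0_norm ?ns// mulr_ge0 ?exprn_ge0 ?(ltW s0)// addr_ge0.
Qed.

Lemma nat_above (c : R) : exists n : nat, c <= n%:R.
Proof. by exists (Num.truncn c).+1; apply: ltW; exact: truncnS_gt. Qed.

Lemma truncn_scale (c L : R) : 2 <= c * L ->
  c * L / 2 <= (Num.truncn (c * L))%:R <= c * L.
Proof.
move=> cL; have := truncnS_gt (c * L); rewrite -natr1 => h1.
have h2 : (Num.truncn (c * L))%:R <= c * L by rewrite truncn_le; lra.
by rewrite h2 andbT; lra.
Qed.

Lemma divn_scale (L q : nat) : (0 < q)%N -> (2 * q <= L)%N ->
  L%:R / (2 * q%:R) <= (L %/ q)%:R :> R.
Proof.
move=> q0 qL; have := ger_divn R L q0 => h.
have qR : 1 <= q%:R :> R by rewrite ler1n.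
have h' : 2 * q%:R <= L%:R :> R by rewrite -natrM ler_nat.
have h'' : 1 <= L%:R / (2 * q%:R) :> R by rewrite ler_pdivlMr ?mul1r//; lra.
have E : L%:R / q%:R = 2 * (L%:R / (2 * q%:R)) :> R by field; lra.
lra.
Qed.

Lemma square_geometric_small (c d : R) : 0 < c -> 0 < d <= 1 -> exists L0, forall L, (L0 <= L)%N ->
  (L%:R + 2) ^+ 2 * (2 / (2 ^ Num.truncn (c * L%:R))%:R) <= d.
Proof.
move=> c0 /andP[d0 d1]; have l2 := ln2_gt0 R; have l2' := ln2_le R.
pose r := expR (- (c * lnr 2 / 2)).
have r01 : 0 < r < 1.
  by rewrite expR_gt0 expR_lt1 oppr_lt0 !mulr_gt0// invr_gt0.
have [L0 hL0] := linear_geometric_small 8 r01 d0.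
exists L0 => L /hL0 h.
have r0 : 0 <= r by exact: expR_ge0.
have e2 : expR 1 <= 4 :> R.
  have := expR_ge1Dx (- (1 / 2) : R); rewrite expRN => h1.
  have p : 0 < expR (1 / 2) :> R by exact: expR_gt0.
  have h2 : expR (1 / 2) <= 2 :> R.
    have h3 : 1 / 2 <= (expR (1 / 2))^-1 :> R by lra.
    by rewrite -[leLHS]invrK -[leRHS]invrK lef_pV2 ?posrE ?invr_gt0//; lra.
  have -> : expR 1 = expR (1 / 2) ^+ 2 :> R by rewrite -expRM_natl; congr expR; lra.
  rewrite expr2 (_ : 4 = 2 * 2 :> R); last by ring.
  by apply: ler_pM => //; exact: ltW.
have g : 2 / (2 ^ Num.truncn (c * L%:R))%:R <= 2 * 4 * (r ^+ L) ^+ 2.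
  have -> : (r ^+ L) ^+ 2 = expR (- (c * L%:R * lnr 2)).
    by rewrite -!expRM_natl /r; congr expR; lra.
  rewrite -mulrA ler_wpM2l// pow2_expR -expRN.
  apply: (@le_trans _ _ (expR (1 - c * L%:R * lnr 2))).
    rewrite ler_expR; have := truncnS_gt (c * L%:R); rewrite -natr1 => h1.
    have := ler_wpM2r (ltW l2) (ltW h1); lra.
  by rewrite expRD ler_wpM2r ?expR_ge0.
have L0' : 0 <= L%:R :> R by [].
apply: (@le_trans _ _ ((L%:R + 2) ^+ 2 * (2 * 4 * (r ^+ L) ^+ 2))).
  by rewrite ler_wpM2l// exprn_ge0// addr_ge0.
apply: (@le_trans _ _ ((8 * (L%:R + 1) * r ^+ L) ^+ 2)).
  rewrite [leLHS](_ : _ = (2 * 4 * (L%:R + 2) ^+ 2) * (r ^+ L) ^+ 2); last by ring.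
  rewrite [leRHS]exprMn ler_wpM2r ?exprn_ge0// -subr_ge0.
  have -> : (8 * (L%:R + 1)) ^+ 2 - 2 * 4 * (L%:R + 2) ^+ 2 =
    56 * L%:R ^+ 2 + 96 * L%:R + 32 :> R by ring.
  by rewrite !addr_ge0 ?mulr_ge0 ?exprn_ge0.
apply: (@le_trans _ _ (d ^+ 2)).
  by rewrite lerXn2r ?nnegrE ?(ltW d0)// !mulr_ge0 ?exprn_ge0// addr_ge0.
by rewrite expr2 ler_piMl// ltW.
Qed.

End Asymptotics.

(** * Irregular primes are sparse *)

Section Regular.
Variables (R : realType) (a b : int).
Local Notation lnr n := (ln (n%:R : R)).

(** The typical behaviour of a prime with respect to a and b. The last clause
    makes every divisor of p - 1 nearly squarefree, so that its size can be read
    off its set of prime factors. *)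
Definition regular (k : R) (p : nat) : bool :=
  [&& good_reduction a b p,
      all (fun e => (1 / 2 - k) * lnr p <= lnr (ell (mono a b e) p)) five,
      (2 / 3 - k) * lnr p <= lnr (join_order a b p) &
      all (fun d => (d ^ 2 %| p.-1)%N ==> (lnr d <= k * lnr p)) (iota 1 p)].

(** This is x^(1 - k) for x = 2^i: a set of primes of at most that order of size
    in each dyadic block has a convergent sum of inverses. *)
Definition thin_weight (k : R) (i : nat) : R := expR ((1 - k) * (i%:R * lnr 2)).

Lemma thin_weightE k i : thin_weight k i = (2 ^ i)%:R * expR (- (k * lnr 2)) ^+ i.
Proof. by rewrite -expRM_natl pow2_expR -expRD; congr expR; ring. Qed.

Lemma expR_le_thin_weight (k t : R) i : t <= (i%:R + 1) * lnr 2 - k * (i%:R * lnr 2) ->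
  expR t <= 2 * thin_weight k i.
Proof.
move=> h; have -> : 2 * thin_weight k i = expR (lnr 2) * thin_weight k i.
  by rewrite lnK// posrE.
by rewrite -expRD ler_expR; apply: le_trans h _; rewrite le_eqVlt; apply/orP; left; apply/eqP; ring.
Qed.

Lemma mem_block i p : p \in iota (2 ^ i) (2 ^ i) ->
  [/\ (0 < p)%N, i%:R * lnr 2 <= lnr p & lnr p <= (i%:R + 1) * lnr 2].
Proof.
rewrite mem_iota => /andP[ip pi].
have := @block_lnr R i p; rewrite ip expnS mul2n -addnn pi => /(_ isT)/andP[h1 h2].
by split => //; apply: leq_trans ip; rewrite expn_gt0.
Qed.

Lemma filter_prime_block (Q : pred nat) i :
  let s := [seq p <- iota (2 ^ i) (2 ^ i) | prime p && Q p] in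
  [/\ uniq s, all prime s & {in s, forall p, Q p /\ p \in iota (2 ^ i) (2 ^ i)}].
Proof.
split; first by rewrite filter_uniq// iota_uniq.
  by apply/allP => p; rewrite mem_filter => /andP[/andP[]].
by move=> p; rewrite mem_filter => /andP[/andP[]].
Qed.

Section Thin.
Variables (k : R) (i h : nat).
Hypotheses (k0 : 0 < k) (k3 : k <= 1 / 3).
Hypotheses (a0 : a != 0) (b0 : b != 0).
Hypothesis indep : mult_independent [tuple a%:~R; b%:~R].
Hypotheses (h0 : (0 < h)%N) (ah : (absz a <= 2 ^ h)%N) (bh : (absz b <= 2 ^ h)%N).
Local Notation block := (iota (2 ^ i) (2 ^ i)).
Local Notation w := (thin_weight k i).
Local Notation y := ((i%:R + 1) * lnr 2).

Let y_ge0 : 0 <= y.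
Proof. by rewrite mulr_ge0 ?addr_ge0 ?lnr_ge0. Qed.

Let ky_ge : k * (i%:R * lnr 2) <= k * y.
Proof. by rewrite ler_wpM2l ?(ltW k0)// mulrDl mul1r lerDl lnr_ge0. Qed.

Lemma count_bad_reduction_le :
  (count (fun p => prime p && ~~ good_reduction a b p) block)%:R <= (2 * h)%:R * w.
Proof.
have k3' := k3; have w1 : 1 <= w.
  by rewrite -[leLHS]expR0 ler_expR mulr_ge0 ?mulr_ge0 ?lnr_ge0//; lra.
apply: (@le_trans _ _ (2 * h)%:R); last by rewrite ler_peMr.
have [us ps sQ] := filter_prime_block (fun p => ~~ good_reduction a b p) i.
rewrite ler_nat -size_filter; apply: (@size_primes_family_le [:: a; b]) => //.
  by move=> f; rewrite !inE => /orP[] /eqP ->.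
move=> p /sQ[+ _]; rewrite /good_reduction negb_and !negbK => /orP[] d.
  by exists a; rewrite ?mem_head.
by exists b; rewrite // !inE eqxx orbT.
Qed.

Lemma count_small_ell_block_le e : e \in five ->
  (count (fun p => prime p && (good_reduction a b p &&
      (lnr (ell (mono a b e) p) < (1 / 2 - k) * lnr p))) block)%:R <= (8 * h)%:R * w.
Proof.
have k3' := k3; move=> e5; pose V := expR ((1 / 2 - k) * y).
have V0 : 0 <= V by exact: expR_ge0.
apply: (@le_trans _ _ (4 * h * Num.truncn V ^ 2)%:R).
  have [us ps sQ] := filter_prime_block (fun p => good_reduction a b p &&
      (lnr (ell (mono a b e) p) < (1 / 2 - k) * lnr p)) i.
  rewrite ler_nat -size_filter; apply: (count_small_ell a0 b0 indep h0 ah bh e5 us ps).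
    by apply/allP => p /sQ[/andP[]].
  move=> p /sQ[/andP[_ el] /mem_block[p0 _ py]].
  rewrite truncn_ge_nat//; apply: lnr_le_expR; apply: le_trans (ltW el) _.
  by rewrite ler_wpM2l//; lra.
have -> : (8 * h)%:R * w = (4 * h)%:R * (2 * w).
  by rewrite (_ : 8 * h = 4 * h * 2)%N ?natrM; [ring|clear; lia].
rewrite natrM natrX ler_wpM2l//; apply: (@le_trans _ _ (V ^+ 2)).
  by rewrite lerXn2r ?nnegrE// truncn_le.
rewrite -expRM_natl; apply: expR_le_thin_weight.
have := mulr_ge0 (ltW k0) y_ge0; move: ky_ge; lra.
Qed.

Lemma count_small_join_block_le :
  (count (fun p => prime p && (good_reduction a b p &&
      (lnr (join_order a b p) < (2 / 3 - k) * lnr p))) block)%:R <= (64 * h)%:R * w.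
Proof.
have k3' := k3; pose V := expR ((1 / 3 - k / 2) * y).
have V1 : 1 <= V by rewrite /V -[leLHS]expR0 ler_expR mulr_ge0//; lra.
have V0 : 0 <= V by exact: expR_ge0.
have KV : (Num.truncn V).+1%:R <= 2 * V.
  have tV : (Num.truncn V)%:R <= V by rewrite truncn_le.
  by rewrite -[leLHS]natr1; lra.
apply: (@le_trans _ _ (4 * h * (Num.truncn V).+1 ^ 3)%:R).
  have [us ps sQ] := filter_prime_block (fun p => good_reduction a b p &&
      (lnr (join_order a b p) < (2 / 3 - k) * lnr p)) i.
  rewrite ler_nat -size_filter; apply: (count_small_join a0 b0 indep h0 ah bh us ps).
    by apply/allP => p /sQ[/andP[]].
  move=> p /sQ[/andP[_ el] /mem_block[p0 _ py]].
  rewrite -(ltr_nat R) natrX; apply: (lt_trans (lnr_lt_expR el)).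
  apply: (@le_lt_trans _ _ (V ^+ 2)); last by rewrite ltrXn2r// truncnS_gt.
  rewrite -expRM_natl ler_expR mulrA (_ : 2%:R * (1 / 3 - k / 2) = 2 / 3 - k); last by field.
  by rewrite ler_wpM2l//; lra.
have -> : (64 * h)%:R * w = (4 * h)%:R * (8 * (2 * w)).
  by rewrite (_ : 64 * h = 4 * h * 16)%N ?natrM; [ring|clear; lia].
rewrite natrM natrX ler_wpM2l//; apply: (@le_trans _ _ ((2 * V) ^+ 3)).
  by rewrite lerXn2r ?nnegrE ?mulr_ge0.
rewrite exprMn (_ : 2 ^+ 3 = 8); last by ring.
rewrite ler_wpM2l// -expRM_natl; apply: expR_le_thin_weight.
have := mulr_ge0 (ltW k0) y_ge0; move: ky_ge; lra.
Qed.

(** For each d > x^k, at most 2x / d^2 primes of the block are 1 modulo d^2. *)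
Lemma count_square_divisor_le :
  (count (fun p => prime p && has (fun d => (d ^ 2 %| p.-1)%N && (k * lnr p < lnr d)) (iota 1 p))
     block)%:R <= 4 * w.
Proof.
pose x := (2 ^ i)%N; pose T := expR (k * (i%:R * lnr 2)); pose d0 := (Num.truncn T).+1.
have d0T : T < d0%:R by exact: truncnS_gt.
have T0 : 0 < T by exact: expR_gt0.
have step : (count (fun p => prime p && has (fun d => (d ^ 2 %| p.-1)%N && (k * lnr p < lnr d)%R) (iota 1 p)) block
    <= \sum_(d <- iota d0 (x.*2 - d0)) count (fun p => prime p && (d ^ 2 %| p.-1)%N) block)%N.
  apply: count_exists_le => p ps /andP[pp /hasP[d]].
  rewrite mem_iota add1n ltnS => /andP[d1 dp] /andP[dd dk].
  exists d; last by rewrite pp.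
  have [p0 l1 _] := mem_block ps.
  have d0d : (d0 <= d)%N.
    rewrite /d0 truncn_lt_nat ?(ltW T0)//; apply: expR_lt_lnr => //.
    by apply: le_lt_trans dk; rewrite ler_wpM2l// ltW.
  rewrite mem_iota d0d/=.
  by move: ps dp; rewrite mem_iota /x; clear; lia.
apply: (@le_trans _ _ (\sum_(d0 <= d < x.*2) (x.*2)%:R * ((d ^ 2)%:R : R)^-1)).
  rewrite -(ler_nat R) in step; apply: le_trans step _.
  rewrite natr_sum /index_iota big_seq [leRHS]big_seq; apply: ler_sum => d.
  rewrite mem_iota => /andP[d0d _].
  have dd0 : (0 < d ^ 2)%N by rewrite expn_gt0 (leq_trans _ d0d).
  by apply: le_trans (ler_divn R _ _); rewrite ler_nat count_prime_pred_dvd.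
rewrite -mulr_sumr; apply: le_trans (ler_wpM2l (ler0n _ _) (@sum_inv_sqr_le R d0 _ _)) _ => //.
have -> : 4 * w = 2 * x%:R * (2 / T).
  rewrite /w /x pow2_expR /T -expRN.
  rewrite (_ : (1 - k) * _ = i%:R * lnr 2 + - (k * (i%:R * lnr 2))); last by ring.
  by rewrite expRD; ring.
by rewrite -mul2n natrM ler_wpM2l ?mulr_ge0// ler_wpM2l// lef_pV2 ?posrE ?ltr0n// ltW.
Qed.

End Thin.

Hypotheses (a0 : a != 0) (b0 : b != 0).
Hypothesis indep : mult_independent [tuple a%:~R; b%:~R].

Lemma irregular_thin (k : R) : 0 < k <= 1 / 3 ->
  exists C r : R, [/\ 0 <= C, 0 < r < 1 & forall i : nat,
    (count (fun p => prime p && ~~ regular k p) (iota (2 ^ i) (2 ^ i)))%:R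
      <= C * (2 ^ i)%:R * r ^+ i].
Proof.
move=> /andP[k0 k3].
pose h := (absz a + absz b)%N.
have h0 : (0 < h)%N by rewrite /h addn_gt0 absz_gt0 a0.
have ah : (absz a <= 2 ^ h)%N.
  by apply: (@leq_trans h); rewrite ?leq_addr// ltnW// ltn_expl.
have bh : (absz b <= 2 ^ h)%N.
  by apply: (@leq_trans h); rewrite ?leq_addl// ltnW// ltn_expl.
clearbody h.
(* 106 = 2 + 5 * 8 + 64 collects the constants of the four counts below. *)
exists ((106 * h + 4)%:R), (expR (- (k * lnr 2))); split => //.
  by rewrite expR_gt0 expR_lt1 oppr_lt0 mulr_gt0// ln2_gt0.
move=> i; set s := iota _ _.
have n1 := count_bad_reduction_le i k3 a0 b0 ah bh.
pose B1 p := prime p && ~~ good_reduction a b p.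
pose B2 e p := prime p && (good_reduction a b p && (lnr (ell (mono a b e) p) < (1 / 2 - k) * lnr p)).
pose B3 p := prime p && (good_reduction a b p && (lnr (join_order a b p) < (2 / 3 - k) * lnr p)).
pose B4 p := prime p && has (fun d => (d ^ 2 %| p.-1)%N && (k * lnr p < lnr d)) (iota 1 p).
have total : (count (fun p => prime p && ~~ regular k p) s <=
   count B1 s + (\sum_(e <- five) count (B2 e) s + (count B3 s + count B4 s)))%N.
  have cE (P : pred nat) : (count P s = \sum_(p <- s) P p)%N.
    by rewrite -sum1_count big_mkcond; apply: eq_bigr => p _; case: (P p).
  rewrite !cE; under [X in (_ <= _ + (X + _))%N]eq_bigr do rewrite cE.
  rewrite exchange_big/= -!big_split/=; apply: leq_sum => p _.
  case: (boolP (prime p && ~~ regular k p)) => // /andP[pp].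
  rewrite /regular /B1 /B3 /B4 pp !andTb.
  case: (boolP (good_reduction a b p)) => gp; rewrite ?andTb//.
  move=> /nandP[/allPn[e e5 ne]|/nandP[ne|/allPn[d dp nd]]].
  - by rewrite (big_rem e)//= /B2 pp gp/= ltNge ne.
  - rewrite ltNge ne; apply: leq_trans (leq_addl _ _).
    by apply: leq_trans (leq_addl _ _); exact: leq_addr.
  - apply: leq_trans (leq_addl _ _); apply: leq_trans (leq_addl _ _).
    rewrite (_ : has _ _ = true); first exact: leq_addl.
    apply/hasP; exists d => //.
    by move: nd; rewrite negb_imply -ltNge.
rewrite -(ler_nat R) in total; apply: le_trans total _.
rewrite [leLHS]natrD [X in _ + X <= _]natrD [X in _ + (_ + X) <= _]natrD natr_sum.
rewrite -mulrA -thin_weightE.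
have n2 : \sum_(e <- five) (count (B2 e) s)%:R <= (40 * h)%:R * thin_weight k i.
  rewrite big_seq; apply: (@le_trans _ _ (\sum_(e <- five | e \in five) (8 * h)%:R * thin_weight k i)).
    by apply: ler_sum => e; exact: count_small_ell_block_le.
  rewrite -big_seq /five !big_cons big_nil addr0 -!mulrDl ler_wpM2r//.
    by rewrite expR_ge0.
  by rewrite (_ : 40 * h = 8 * h + (8 * h + (8 * h + (8 * h + 8 * h))))%N ?natrD//; clear; lia.
have n3 := count_small_join_block_le i k0 k3 a0 b0 indep h0 ah bh.
have n4 := count_square_divisor_le i k0.
have -> : (106 * h + 4)%:R * thin_weight k i = (2 * h)%:R * thin_weight k i +
    ((40 * h)%:R * thin_weight k i + ((64 * h)%:R * thin_weight k i + 4%:R * thin_weight k i)).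
  by rewrite -!mulrDl -!natrD; congr (_%:R * _); clear; lia.
by apply: lerD n1 _; apply: lerD n2 _; exact: lerD n3 n4.
Qed.

End Regular.

(** * Strong primes *)

Section StrongPrimes.
Variables (R : realType) (a b : int).
Local Notation lnr n := (ln (n%:R : R)).
Local Notation D p := (join_order a b p).
Local Notation regular := (@regular R a b).

(** The margin 1/1000 by which the orders modulo a strong prime exceed the
    generic bound. *)
Definition milli : R := (10 * (10 * 10))^-1.

Lemma milliE (x : R) : 10 * (10 * (10 * (milli * x))) = x.
Proof. by rewrite /milli; field. Qed.

Lemma milli_gt0 : 0 < milli.
Proof. by rewrite /milli invr_gt0; lra. Qed.

Definition order_log (p : nat) : R := \sum_(e <- five) lnr (ell (mono a b e) p).

(** The generic lower bound is 8/3 = 4 * (2/3), from [regular_order_log]. *)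
Definition strong (p : nat) : bool :=
  [&& prime p, regular (milli) p & (8 / 3 + milli) * lnr p <= order_log p].

(** Each of the 5^2 pairs of exponent vectors costs a factor 3 in
    [prod_co_index_le]. *)
Definition order_loss : R := 25 * lnr 3.
Local Notation K := order_loss.

Lemma order_log_co_index p : prime p -> good_reduction a b p ->
  order_log p = 5 * lnr (D p) - lnr (\prod_(e <- five) co_index a b p e).
Proof.
move=> pp /(good_reductionP pp)[ra rb].
rewrite lnr_prod; last by move=> e _; exact: co_index_gt0.
have -> : 5 * lnr (D p) = \sum_(e <- five) lnr (D p).
  by rewrite /five !big_cons big_nil addr0; ring.
rewrite -sumrB; apply: eq_bigr => e _.
rewrite -(co_indexE pp ra rb e) lnrM ?addrK ?co_index_gt0//.
by rewrite ell_gt0// prime_gt0.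
Qed.

Lemma order_log_ge p : prime p -> good_reduction a b p ->
  4 * lnr (D p) - K <= order_log p.
Proof.
move=> pp gp; have [ra rb] := good_reductionP pp gp.
rewrite order_log_co_index//.
have D0 : (0 < D p)%N by exact: join_order_gt0.
have : lnr (\prod_(e <- five) co_index a b p e) <= lnr (3 ^ 25 * D p)%N.
  apply: ler_lnr; last exact: prod_co_index_le.
  by apply: prodn_cond_gt0 => e _; exact: co_index_gt0.
by rewrite lnrM ?expn_gt0// lnrX// -/order_loss; lra.
Qed.

Lemma order_log_prime_ge p q : prime p -> good_reduction a b p -> prime q ->
  (q %| D p)%N -> {in five, forall e, (co_index a b p e < q)%N} ->
  4 * lnr (D p) + lnr q - K <= order_log p.
Proof.
move=> pp gp pq qD uq; have [ra rb] := good_reductionP pp gp.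
rewrite order_log_co_index//.
have D0 : (0 < D p)%N by exact: join_order_gt0.
have u0 : (0 < \prod_(e <- five) co_index a b p e)%N.
  by apply: prodn_cond_gt0 => e _; exact: co_index_gt0.
have : lnr (q * \prod_(e <- five) co_index a b p e)%N <= lnr (3 ^ 25 * D p)%N.
  apply: ler_lnr; first by rewrite muln_gt0 prime_gt0.
  exact: prod_co_index_prime_le.
by rewrite (lnrM R (prime_gt0 pq) u0) lnrM ?expn_gt0// lnrX// -/order_loss; lra.
Qed.

Lemma regular_order_log (k : R) p : prime p -> regular k p ->
  (8 / 3 - 4 * k) * lnr p - K <= order_log p.
Proof.
move=> pp /and4P[gp _ lD _].
by have := order_log_ge pp gp; lra.
Qed.

(** The witness collects half of each exponent, rounded down, which leaves each
    prime at most once. *)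
Lemma ln_radical n : (0 < n)%N -> exists d : nat, [/\ (0 < d)%N, (d ^ 2 %| n)%N &
  lnr n <= \sum_(q <- primes n) lnr q + 2 * lnr d].
Proof.
move=> n0; have nE := prod_prime_decomp n0; rewrite prime_decompE big_map/= in nE.
exists (\prod_(q <- primes n) q ^ (logn q n)./2)%N; split.
- rewrite big_seq_cond; apply: prodn_cond_gt0 => q /andP[].
  by rewrite mem_primes expn_gt0 => /andP[/prime_gt0->].
- rewrite [X in (_ %| X)%N]nE -mulnn -big_split/=.
  elim: (primes n) => [|q s IH]; first by rewrite !big_nil.
  rewrite !big_cons dvdn_mul// -expnD dvdn_exp2l// addnn.
  by rewrite -[leqRHS](odd_double_half (logn q n)) leq_addl.
have qp q : q \in primes n -> (0 < q)%N by rewrite mem_primes => /andP[/prime_gt0].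
have lnp (f : nat -> nat) : lnr (\prod_(q <- primes n) q ^ f q)%N =
    \sum_(q <- primes n) (f q)%:R * lnr q.
  rewrite big_seq lnr_prod; last by move=> q /qp; rewrite expn_gt0 => ->.
  by rewrite [RHS]big_seq; apply: eq_bigr => q /qp; exact: lnrX.
rewrite [leLHS](congr1 (fun m => lnr m) nE) !lnp mulr_sumr -big_split/=.
apply: ler_sum => q _; rewrite mulrA -[X in X + _]mul1r -mulrDl ler_wpM2r ?lnr_ge0//.
rewrite -natrM nat1r ler_nat -{1}(odd_double_half (logn q n)) mul2n.
by case: odd.
Qed.

(** For a regular prime that is not strong, D is at most about p^(2/3) by
    [order_log_ge], and the orders are at least about p^(1/2), so the co-indices
    are at most about p^(1/6). A prime factor of D beyond that bound would make
    p strong by [order_log_prime_ge]. Hence D is friable and, by regularity,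
    nearly squarefree; and D divides p - 1. *)
Lemma weak_small_log (i p : nat) : (200 <= i %/ 100)%N -> K <= milli * (i%:R * lnr 2) ->
  (2 ^ i <= p < 2 ^ i.+1)%N -> prime p -> regular (milli) p -> ~~ strong p ->
  (2 / 3 - 3 * milli) * lnr p <= small_log R (smooth_cut i) p.-1.
Proof.
move=> i100 Ki pi pp rp; rewrite /strong pp rp/= -ltNge => weak.
have /and4P[gp /allP el lD /allP sq] := rp.
have [ra rb] := good_reductionP pp gp.
have /andP[pl pu] := @block_lnr R _ _ pi.
have l2 := ln2_ge R.
have m0 := milli_gt0.
set l := lnr p in weak el lD sq pl pu *.
have ml := milliE l.
have K1 : K <= milli * l.
  by apply: le_trans Ki _; rewrite ler_pM2l.
have i0 : 100 <= i%:R :> R by rewrite ler_nat; move: i100; clear; lia.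
have l0 : 0 < l by apply: (lt_le_trans _ pl); apply: mulr_gt0; lra.
have D0 : (0 < D p)%N by exact: join_order_gt0.
have oge := order_log_ge pp gp.
have lDu : lnr (D p) <= (2 / 3 + milli) * l by lra.
have lu e : e \in five -> lnr (co_index a b p e) <= (1 / 6 + 2 * milli) * l.
  move=> e5; have := el e e5; have : lnr (D p) = lnr (ell (mono a b e) p) + lnr (co_index a b p e).
    rewrite -lnrM ?co_index_gt0// ?co_indexE//.
    by rewrite ell_gt0// prime_gt0.
  lra.
have smooth q : prime q -> (q %| D p)%N -> (q <= smooth_cut i)%N.
  move=> pq qD.
  have lq : lnr q <= (1 / 6 + 2 * milli) * l.
    rewrite leNgt; apply/negP => lq.
    have uq : {in five, forall e, (co_index a b p e < q)%N}.
      move=> e /lu ue; rewrite -(ltr_nat R).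
      rewrite -(@ltr_ln R) ?posrE ?ltr0n ?co_index_gt0 ?prime_gt0//.
      exact: le_lt_trans ue lq.
    have := order_log_prime_ge pp gp pq qD uq; lra.
  rewrite -(ler_nat R) -(@ler_ln R) ?posrE ?ltr0n ?expn_gt0 ?(prime_gt0 pq)//.
  apply: le_trans lq _; rewrite lnrX// natrM.
  have t1 : i%:R <= 100 * (i %/ 100)%:R + 99 :> R.
    by rewrite -natrM -natrD ler_nat; clear; lia.
  have t3 : 100 * (i %/ 100)%:R <= i%:R :> R by rewrite -natrM ler_nat; clear; lia.
  have t2 : 200 <= (i %/ 100)%:R :> R by rewrite ler_nat.
  apply: (@le_trans _ _ (17 / 100 * ((i%:R - 99) * lnr 2))); last first.
    by rewrite mulrA ler_wpM2r//; [lra|move: t1; clear; lra].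
  have h1 : 200 * 100 * lnr 2 <= i%:R * lnr 2.
    by rewrite ler_wpM2r//; [lra|move: t2 t3; clear; lra].
  by move: h1 pu ml l0; clear; lra.
have [d [d0 dD lnD]] := ln_radical D0.
have Dp1 := join_order_dvd_pred pp ra rb.
have p1 : (0 < p.-1)%N by have := prime_gt1 pp; clear; lia.
have ld : lnr d <= milli * l.
  have dp1 : (d ^ 2 %| p.-1)%N by exact: dvdn_trans Dp1.
  have dle : (d <= p.-1)%N.
    by apply: leq_trans (dvdn_leq p1 dp1); rewrite -mulnn leq_pmulr.
  have din : d \in iota 1 p by rewrite mem_iota d0/=; move: dle; clear; lia.
  by have := sq d din; rewrite dp1.
have sub : \sum_(q <- primes (D p)) lnr q <= small_log R (smooth_cut i) p.-1.
  rewrite /small_log -[leRHS]big_filter; apply: ler_sum_uniq_sub.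
  - exact: primes_uniq.
  - by rewrite filter_uniq// iota_uniq.
  - move=> q; rewrite mem_primes => /and3P[pq _ qD].
    rewrite mem_filter pq/= (dvdn_trans qD Dp1)/= mem_index_iota/= ltnS.
    exact: smooth.
  - by move=> q _; exact: lnr_ge0.
lra.
Qed.

Hypotheses (a0 : a != 0) (b0 : b != 0).
Hypothesis indep : mult_independent [tuple a%:~R; b%:~R].

Lemma irregular_tail (k d : R) : 0 < k <= 1 / 3 -> 0 < d -> exists m0, forall m n,
  (m0 <= m)%N ->
  \sum_(2 ^ m <= p < 2 ^ n | prime p && ~~ regular k p) (p%:R : R)^-1 <= d.
Proof.
move=> k03 d0; have [C [r [C0 r01 thin]]] := @irregular_thin R a b a0 b0 indep k k03.
have /andP[r0 r1] := r01.
have [m0 hm0] := linear_geometric_small (C / (1 - r)) r01 d0.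
exists m0 => m n m0m.
case: (leqP m n) => [mn|/ltnW nm]; last first.
  by rewrite big_geq ?leq_exp2l// ltW.
rewrite sum_dyadic//.
apply: (@le_trans _ _ (\sum_(m <= i < n) C * r ^+ i)).
  apply: ler_sum => i _.
  have x0 : 0 < (2 ^ i)%:R :> R by rewrite ltr0n expn_gt0.
  apply: (@le_trans _ _ (\sum_(2 ^ i <= p < 2 ^ i.+1 | prime p && ~~ regular k p) (2 ^ i)%:R^-1)).
    rewrite big_seq_cond [leRHS]big_seq_cond; apply: ler_sum => p.
    rewrite mem_index_iota => /andP[/andP[ip _] /andP[pp _]].
    by rewrite lef_pV2 ?posrE ?ltr0n ?expn_gt0 ?prime_gt0// ler_nat.
  have -> : \sum_(2 ^ i <= p < 2 ^ i.+1 | prime p && ~~ regular k p) ((2 ^ i)%:R : R)^-1 =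
     (count (fun p => prime p && ~~ regular k p) (iota (2 ^ i) (2 ^ i)))%:R * (2 ^ i)%:R^-1.
    rewrite -sum1_count natr_sum mulr_suml /index_iota expnS (_ : 2 * 2 ^ i - 2 ^ i = 2 ^ i)%N; last by clear; lia.
    by apply: eq_bigr => p _; rewrite mul1r.
  by rewrite ler_pdivrMr// mulrAC; exact: thin.
have g : \sum_(m <= i < n) r ^+ i <= r ^+ m / (1 - r).
  have := @geometric_partial_tail R (n - m) m r; rewrite subnKC// => ->.
  by apply: geometric_le_lim; rewrite ?exprn_ge0 ?(ltW r0)// gtr0_norm.
rewrite -mulr_sumr; apply: le_trans (ler_wpM2l C0 g) _.
apply: le_trans (hm0 m m0m).
have -> : C * (r ^+ m / (1 - r)) = C / (1 - r) * 1 * r ^+ m by rewrite mulr1; ring.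
rewrite ler_wpM2r ?exprn_ge0 ?(ltW r0)// ler_wpM2l ?divr_ge0 ?subr_ge0 ?(ltW r1)//.
by rewrite lerDr.
Qed.

(** On each dyadic block, Markov's inequality applied to [weak_small_log] and
    [sum_small_log_le] bounds the sum of ln p / p over primes that are not
    strong, the sparse irregular ones included, by about (17/40) / (2/3) < 9/14.
    The sum over all primes is about ln 2 >= 13/20 > 9/14 per block by the
    Mertens estimates. *)
Lemma strong_block : exists m0, forall m, (m0 <= m)%N ->
  milli <= \sum_(2 ^ m <= p < 2 ^ m.*2 | strong p) (p%:R : R)^-1.
Proof.
have k03 : 0 < (milli : R) <= 1 / 3 by apply/andP; split; have := milli_gt0; have := milliE 1; lra.
have [C [r [C0 r01 thin]]] := @irregular_thin R a b a0 b0 indep _ k03.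
have d0 := milli_gt0.
have mE := milliE 1; rewrite mulr1 in mE.
have [m1 hm1] := linear_geometric_small C r01 d0.
have l2 := ln2_ge R; have l2' := ln2_le R.
have [m2 Km2] : exists m2 : nat, K * (20 * (10 * 10)) < m2%:R.
  by exists (Num.truncn (K * (20 * (10 * 10)))).+1; exact: truncnS_gt.
have [N0 [N1 N2]] : exists N0, (20 * (10 * 10) <= N0)%N /\ (200 * 100 <= N0)%N by exists (200 * 100)%N.
exists (m1 + m2 + N0)%N => m mge.
have N0m : (N0 <= m)%N by move: mge; clear; lia.
have m1m : (m1 <= m)%N by move: mge; clear; lia.
have m2m : (m2 <= m)%N by move: mge; clear; lia.
have mR : 20 * (10 * 10) <= m%:R :> R by rewrite -!natrM ler_nat; exact: leq_trans N1 N0m.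
have m0 : (0 < m)%N by exact: leq_trans (leq_trans N1 N0m).
clear mge.
have Km i : (m <= i)%N -> K <= milli * (i%:R * lnr 2).
  move=> mi.
  have iR : 0 <= i%:R :> R by [].
  have h1 : milli * (i%:R * (13 / 20)) <= milli * (i%:R * lnr 2).
    by rewrite ler_wpM2l ?(ltW d0)// ler_wpM2l.
  have h2 : m2%:R <= i%:R :> R by rewrite ler_nat (leq_trans m2m).
  have h3 : milli * (K * (20 * (10 * 10))) <= milli * i%:R.
    by rewrite ler_wpM2l ?(ltW d0)// ltW// (lt_le_trans Km2).
  have h4 := milliE K; have h5 : 0 <= milli * i%:R by rewrite mulr_ge0 ?(ltW d0).
  have h6 : 10 * (10 * (10 * (milli * K))) = 10 * (10 * 10) * (milli * K) by ring.
  lra.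
have weak_le i : (m <= i)%N ->
    \sum_(2 ^ i <= p < 2 ^ i.+1 | prime p && ~~ strong p) lnr p / p%:R <= 9 / 14.
  move=> mi; have x0 : 0 < (2 ^ i)%:R :> R by rewrite ltr0n expn_gt0.
  have i100 : (200 <= i %/ 100)%N by rewrite leq_divRL// (leq_trans N2)// (leq_trans N0m).
  rewrite (bigID (regular (milli)))/= addrC.
  (* 25/39 slightly exceeds (17/40) / (2/3 - 3/1000), and 25/39 + 1/1000 < 9/14. *)
  apply: (@le_trans _ _ (milli + 25 / 39)); last by lra.
  apply: lerD.
    apply: (@le_trans _ _ (\sum_(2 ^ i <= p < 2 ^ i.+1 | prime p && ~~ regular (milli) p)
       (i%:R + 1) / (2 ^ i)%:R)).
      apply: (@le_trans _ _ (\sum_(2 ^ i <= p < 2 ^ i.+1 | prime p && ~~ regular (milli) p)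
        lnr p / p%:R)).
        apply: ler_sum_pred => p; first by move=> /andP[/andP[-> _] ->].
        by move=> _; rewrite divr_ge0// lnr_ge0.
      rewrite big_seq_cond [leRHS]big_seq_cond; apply: ler_sum => p.
      rewrite mem_index_iota => /andP[pi /andP[pp _]].
      have /andP[_ pu] := @block_lnr R _ _ pi; case/andP: pi => ip _.
      apply: ler_pM; rewrite ?lnr_ge0 ?invr_ge0//.
        apply: le_trans pu _; rewrite ler_piMr// addr_ge0//.
      by rewrite lef_pV2 ?posrE ?ltr0n ?expn_gt0 ?prime_gt0// ler_nat.
    have -> : \sum_(2 ^ i <= p < 2 ^ i.+1 | prime p && ~~ regular (milli) p) (i%:R + 1) / (2 ^ i)%:R =
       (count (fun p => prime p && ~~ regular (milli) p) (iota (2 ^ i) (2 ^ i)))%:R * ((i%:R + 1) / (2 ^ i)%:R) :> R.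
      rewrite -sum1_count natr_sum mulr_suml /index_iota expnS (_ : 2 * 2 ^ i - 2 ^ i = 2 ^ i)%N; last by clear; lia.
      by apply: eq_bigr => p _; rewrite mul1r.
    have m1i : (m1 <= i)%N by exact: leq_trans m1m mi.
    apply: le_trans (hm1 i m1i).
    have i1 : 0 <= (i%:R + 1) / (2 ^ i)%:R :> R by rewrite divr_ge0// addr_ge0.
    apply: le_trans (ler_wpM2r i1 (thin i)) _.
    rewrite le_eqVlt; apply/orP; left; apply/eqP; field; rewrite gt_eqF//.
  have W := @sum_small_log_le R i _.
  apply: (@le_trans _ _ ((2 / 3 - 3 * milli)^-1 / (2 ^ i)%:R *
     \sum_(2 ^ i <= p < 2 ^ i.+1 | prime p) small_log R (smooth_cut i) p.-1)); last first.
    have i50 : (50 <= i %/ 100)%N by exact: leq_trans i100.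
    have c0 : 0 <= (2 / 3 - 3 * milli)^-1 / (2 ^ i)%:R :> R.
      by rewrite divr_ge0// invr_ge0; lra.
    apply: le_trans (ler_wpM2l c0 (W i50)) _.
    have -> : (2 / 3 - 3 * milli)^-1 / (2 ^ i)%:R * (17 / 40 * (2 ^ i)%:R) = (2 / 3 - 3 * milli)^-1 * (17 / 40) :> R.
      by field; rewrite gt_eqF//; lra.
    rewrite mulrC ler_pdivrMr; [lra|lra].
  rewrite mulr_sumr; apply: (@le_trans _ _ (\sum_(2 ^ i <= p < 2 ^ i.+1 | prime p && ~~ strong p && regular (milli) p)
     (2 / 3 - 3 * milli)^-1 / (2 ^ i)%:R * small_log R (smooth_cut i) p.-1)).
    rewrite big_seq_cond [leRHS]big_seq_cond; apply: ler_sum => p.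
    rewrite mem_index_iota => /andP[pi /andP[/andP[pp ps] pr]].
    have := weak_small_log i100 (Km i mi) pi pp pr ps.
    case/andP: pi => ip _; have p0 : 0 < p%:R :> R by rewrite ltr0n prime_gt0.
    rewrite -ler_pdivlMl; last by lra.
    move=> h; rewrite [(_)^-1 / _]mulrC -mulrA.
    apply: (@le_trans _ _ ((2 ^ i)%:R^-1 * lnr p)).
      by rewrite mulrC ler_wpM2r ?lnr_ge0// lef_pV2 ?posrE// ler_nat.
    by rewrite ler_wpM2l// invr_ge0 ltW.
  apply: ler_sum_pred => p; first by move=> /andP[/andP[]].
  move=> _; rewrite mulr_ge0 ?divr_ge0 ?invr_ge0//; first by lra.
  by apply: sumr_ge0 => q _; exact: lnr_ge0.
have mm : (m <= m.*2)%N by clear; lia.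
have x0 n : (0 < 2 ^ n)%N by rewrite expn_gt0.
have x2 : (2 ^ m <= 2 ^ m.*2)%N by rewrite leq_exp2l.
have weak_sum : \sum_(2 ^ m <= p < 2 ^ m.*2 | prime p && ~~ strong p) lnr p / p%:R <= 9 / 14 * m%:R.
  rewrite sum_dyadic//; apply: (@le_trans _ _ (\sum_(m <= i < m.*2) (9 / 14 : R))).
    by apply: ler_sum_nat => i /andP[mi _]; exact: weak_le.
  by rewrite sumr_const_nat (_ : m.*2 - m = m)%N ?mulr_natr//; clear; lia.
have all_sum : (m%:R - 1) * lnr 2 - 7 <= \sum_(2 ^ m <= p < 2 ^ m.*2 | prime p) lnr p / p%:R.
  have e : mertens R (2 ^ m.*2).-1 = mertens R (2 ^ m).-1 +
      \sum_(2 ^ m <= p < 2 ^ m.*2 | prime p) lnr p / p%:R.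
    by rewrite /mertens !prednK// -big_cat_nat.
  have y1 : (2 ^ m.*2.-1 <= (2 ^ m.*2).-1)%N.
    have -> : (2 ^ m.*2 = 2 * 2 ^ m.*2.-1)%N by rewrite -expnS prednK//; move: m0; clear; lia.
    by have := x0 m.*2.-1; clear; lia.
  have y2 : (0 < (2 ^ m.*2).-1)%N by apply: leq_trans y1.
  have y3 : (0 < (2 ^ m).-1)%N.
    by have : (2 ^ 1 <= 2 ^ m)%N; [rewrite leq_exp2l|clear; lia].
  have h1 := mertens_ge R y2; have h2 := mertens_le R y3.
  have h3 : (2 * m%:R - 1) * lnr 2 <= lnr (2 ^ m.*2).-1.
    have := @ler_lnr R _ _ (x0 _) y1; rewrite lnrX//; apply: le_trans.
    rewrite -subn1 natrB; last by move: m0; clear; lia.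
    by rewrite -mul2n natrM.
  have h4 : lnr (2 ^ m).-1 <= m%:R * lnr 2.
    by rewrite -lnrX//; apply: ler_lnr => //; exact: leq_pred.
  lra.
have strong_sum : \sum_(2 ^ m <= p < 2 ^ m.*2 | prime p) lnr p / p%:R =
   \sum_(2 ^ m <= p < 2 ^ m.*2 | strong p) lnr p / p%:R +
   \sum_(2 ^ m <= p < 2 ^ m.*2 | prime p && ~~ strong p) lnr p / p%:R.
  rewrite (bigID strong)/=; congr (_ + _); apply: eq_bigl => p.
  by rewrite /strong; case: (prime p).
have up : \sum_(2 ^ m <= p < 2 ^ m.*2 | strong p) lnr p / p%:R <=
   (2 * m%:R) * \sum_(2 ^ m <= p < 2 ^ m.*2 | strong p) p%:R^-1.
  rewrite mulr_sumr big_seq_cond [leRHS]big_seq_cond; apply: ler_sum => p.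
  rewrite mem_index_iota => /andP[/andP[mp pm] /and3P[pp _ _]].
  rewrite ler_wpM2r ?invr_ge0//; apply: (@le_trans _ _ (lnr (2 ^ m.*2))).
    by apply: ler_lnr (ltnW pm); exact: prime_gt0.
  by rewrite lnrX// -mul2n natrM ler_piMr// mulr_ge0.
have : 2 * (milli * m%:R) <= (2 * m%:R) * \sum_(2 ^ m <= p < 2 ^ m.*2 | strong p) p%:R^-1.
  apply: le_trans up.
  have : (m%:R - 1) * (13 / 20) <= (m%:R - 1) * lnr 2 by rewrite ler_wpM2l//; lra.
  have := milliE m%:R; lra.
rewrite (_ : 2 * (milli * m%:R) = 2 * m%:R * milli); last by ring.
by rewrite ler_pM2l//; lra.
Qed.

End StrongPrimes.

(** * Moments of additive functions *)

Section Moments.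
Variable R : realType.
Local Notation lnr n := (ln (n%:R : R)).

Lemma sum_nat_count (T : Type) (s : seq T) (P : pred T) :
  \sum_(n <- s) (P n)%:R = (count P s)%:R :> R.
Proof.
rewrite -sum1_count natr_sum [RHS]big_mkcond; apply: eq_bigr => n _.
by case: (P n).
Qed.

Lemma count_dvd_le (N k : nat) : (0 < k)%N ->
  (count (dvdn k) (iota 1 N))%:R <= N%:R / k%:R :> R.
Proof. by move=> k0; rewrite count_dvd// ler_divn. Qed.

(** Turan's second moment: the number w of primes of gs dividing n has mean
    about S and variance O(S), while w - S = - S for every n counted on the
    left. *)
Lemma count_free_le (gs : seq nat) (N : nat) : uniq gs -> all prime gs ->
  {in gs, forall p, (p <= N)%N} ->
  (count (fun n => all (fun p => ~~ (p %| n)%N) gs) (iota 1 N))%:R *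
    \sum_(p <- gs) (p%:R : R)^-1 <= 3 * N%:R.
Proof.
move=> us ps gN; set S := \sum_(p <- gs) _; set c := (count _ _)%:R.
pose w (n : nat) : R := \sum_(p <- gs) ((p %| n)%N)%:R.
have S0 : 0 <= S by apply: sumr_ge0 => p _; rewrite invr_ge0.
have [S1|S1] := eqVneq S 0; first by rewrite S1 mulr0 mulr_ge0.
have Sp : 0 < S by rewrite lt_neqAle eq_sym S1.
have gN' : (size gs)%:R <= N%:R :> R.
  rewrite ler_nat -(size_iota 1 N); apply: uniq_leq_size => // p pg.
  by rewrite mem_iota add1n ltnS gN// prime_gt0// (allP ps).
have w1 : N%:R * S - (size gs)%:R <= \sum_(n <- iota 1 N) w n.
  rewrite /w exchange_big/= mulr_sumr -sum1_size natr_sum -sumrB.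
  rewrite big_seq [leRHS]big_seq; apply: ler_sum => p pg.
  have p0 : (0 < p)%N by rewrite prime_gt0// (allP ps).
  by rewrite sum_nat_count count_dvd// ger_divn.
have w2 : \sum_(n <- iota 1 N) w n ^+ 2 <= N%:R * S + N%:R * S ^+ 2.
  have -> : \sum_(n <- iota 1 N) w n ^+ 2 =
     \sum_(p <- gs) \sum_(q <- gs) (count (fun n => (p %| n) && (q %| n))%N (iota 1 N))%:R.
    under eq_bigr do rewrite /w expr2 big_distrlr/=.
    rewrite exchange_big/=; apply: eq_bigr => p _.
    rewrite exchange_big/=; apply: eq_bigr => q _.
    by rewrite -sum_nat_count; apply: eq_bigr => n _; rewrite -natrM mulnb.
  have -> : N%:R * S + N%:R * S ^+ 2 = \sum_(p <- gs) (N%:R / p%:R + N%:R / p%:R * S).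
    by rewrite big_split/= -mulr_suml -mulr_sumr -/S; ring.
  rewrite big_seq [leRHS]big_seq; apply: ler_sum => p pg.
  have pp := allP ps _ pg; have p0 := prime_gt0 pp.
  rewrite (big_rem p pg)/=; apply: lerD.
    apply: le_trans (count_dvd_le N p0).
    by rewrite ler_nat; apply: sub_count => n /= /andP[].
  apply: (@le_trans _ _ (\sum_(q <- rem p gs) N%:R / p%:R * q%:R^-1)).
    rewrite big_seq [leRHS]big_seq; apply: ler_sum => q.
    rewrite mem_rem_uniq// !inE => /andP[qp qg].
    have pq := allP ps _ qg.
    rewrite -mulrA -invfM -natrM.
    apply: le_trans (count_dvd_le N _); last by rewrite muln_gt0 p0 prime_gt0.
    rewrite ler_nat; apply: sub_count => n /= h.
    by rewrite Gauss_dvd// prime_coprime// dvdn_prime2// eq_sym.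
  have Sr : \sum_(q <- rem p gs) (q%:R : R)^-1 <= S.
    by rewrite /S (big_rem p pg)/= lerDr invr_ge0.
  by rewrite -mulr_sumr ler_wpM2l// divr_ge0.
have var : c * S ^+ 2 <= \sum_(n <- iota 1 N) (w n - S) ^+ 2.
  rewrite /c -sum_nat_count mulr_suml; apply: ler_sum => n _.
  case: allP => h; last by rewrite mul0r sqr_ge0.
  rewrite mul1r /w big_seq big1 ?sub0r ?sqrrN// => p pg.
  by rewrite (negbTE (h p pg)).
have var2 : \sum_(n <- iota 1 N) (w n - S) ^+ 2 =
    \sum_(n <- iota 1 N) w n ^+ 2 - 2 * S * \sum_(n <- iota 1 N) w n + N%:R * S ^+ 2.
  have -> : N%:R * S ^+ 2 = \sum_(n <- iota 1 N) S ^+ 2.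
    by rewrite big_const_seq count_predT size_iota iter_addr_0 mulr_natl.
  by rewrite mulr_sumr -sumrB -big_split/=; apply: eq_bigr => n _; ring.
rewrite -(ler_pM2r Sp) -mulrA -expr2; apply: le_trans var _; rewrite var2.
have := ler_wpM2l S0 w1; have := ler_wpM2l S0 gN'; lra.
Qed.

Lemma harmonic_le n : \sum_(1 <= k < n.+1) (k%:R : R)^-1 <= 1 + lnr n.
Proof.
case: n => [|n]; first by rewrite big_geq// ln0// addr0.
elim: n => [|n IH]; first by rewrite big_nat1 invr1 ln1 addr0.
rewrite big_nat_recr//=; apply: le_trans (lerD IH (lexx _)) _.
rewrite -addrA lerD2l -lerBrDl.
have n1 : 0 < n.+1%:R :> R by rewrite ltr0n.
have n2 : 1 < n.+2%:R :> R by rewrite ltr1n.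
have nE : n.+2%:R = n.+1%:R + 1 :> R by rewrite natr1.
have i1 : n.+2%:R^-1 < 1 :> R by rewrite invf_lt1//; lra.
have i2 : -1 < - n.+2%:R^-1 :> R by rewrite ltrN2.
have := le_ln1Dx i2.
have -> : 1 + - n.+2%:R^-1 = (n.+2%:R / n.+1%:R)^-1 :> R.
  by rewrite nE; field; rewrite -?nE; lra.
by rewrite lnV ?posrE ?divr_gt0 ?ltr0n// lerN2 ln_div ?posrE ?ltr0n.
Qed.

(** Forgetting that p is prime, p = d k + 1 > d k. *)
Lemma sum_inv_mod1_le (d L : nat) : (0 < d)%N ->
  \sum_(1 <= p < 2 ^ L.+1 | prime p && (d %| p.-1)%N) (p%:R : R)^-1 <= (L%:R + 2) / d%:R.
Proof.
move=> d0; have dR : 0 < d%:R :> R by rewrite ltr0n.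
set X := (2 ^ L.+1)%N; have X0 : (0 < X)%N by rewrite expn_gt0.
have h1 : \sum_(1 <= p < X | prime p && (d %| p.-1)%N) (p%:R : R)^-1 <=
   \sum_(1 <= k < X.+1) (d * k)%:R^-1.
  rewrite -big_filter; pose f p := (p.-1 %/ d)%N.
  have mk p : p \in [seq p <- index_iota 1 X | prime p && (d %| p.-1)%N] ->
     [/\ (0 < f p)%N, (f p <= X)%N & (d * f p < p)%N].
    rewrite mem_filter mem_index_iota => /andP[/andP[pp dp] /andP[_ pX]].
    have p1 := prime_gt1 pp; have E : (d * f p = p.-1)%N by rewrite mulnC divnK.
    split; last by rewrite E; clear -p1; lia.
      by rewrite divn_gt0// dvdn_leq//; clear -p1; lia.
    by apply: leq_trans (leq_div _ _) _; clear -pX; lia.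
  apply: (@le_trans _ _ (\sum_(p <- [seq p <- index_iota 1 X | prime p && (d %| p.-1)%N]) (d * f p)%:R^-1)).
    rewrite big_seq [leRHS]big_seq; apply: ler_sum => p /mk[f0 _ fp].
    have p0 : (0 < p)%N by apply: leq_ltn_trans fp.
    by rewrite lef_pV2 ?posrE ?ltr0n ?muln_gt0 ?d0// ler_nat ltnW.
  rewrite -(big_map f predT (fun k => (d * k)%:R^-1)).
  apply: ler_sum_uniq_sub => [||k|k _]; last by rewrite invr_ge0.
  - rewrite map_inj_in_uniq ?filter_uniq ?iota_uniq// => p q.
    rewrite !mem_filter => /andP[/andP[pp dp] _] /andP[/andP[pq dq] _] e.
    have : p.-1 = q.-1 by rewrite -(divnK dp) -(divnK dq) -/(f p) -/(f q) e.
    by have := prime_gt0 pp; have := prime_gt0 pq; clear; lia.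
  - exact: iota_uniq.
  - by move=> /mapP[p /mk[f0 fX _] ->]; rewrite mem_index_iota f0.
apply: le_trans h1 _.
have -> : \sum_(1 <= k < X.+1) (d * k)%:R^-1 = (\sum_(1 <= k < X.+1) k%:R^-1) / d%:R :> R.
  by rewrite mulr_suml; apply: eq_bigr => k _; rewrite natrM invfM mulrC.
rewrite ler_wpM2r ?invr_ge0//; apply: le_trans (harmonic_le X) _.
rewrite /X lnrX// -natr1; have := ln2_le R.
have L0 : 0 <= L%:R + 1 :> R by rewrite addr_ge0.
move=> l2; have := ler_wpM2l L0 l2; lra.
Qed.

(** For two primes p and q that are 1 modulo d, at most N / (p q) integers are
    divisible by both; by [sum_inv_mod1_le] this adds up to at most N (L + 2)^2
    / d^2 for each d > g. *)
Lemma count_gcd_le (N L g : nat) : (N < 2 ^ L.+1)%N -> (0 < g)%N ->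
  (count (fun n => has (fun p => has (fun q =>
      [&& p != q, (g < gcdn p.-1 q.-1)%N, prime p & prime q]) (primes n)) (primes n)) (iota 1 N))%:R
    <= N%:R * ((L%:R + 2) ^+ 2 * (2 / g%:R)) :> R.
Proof.
move=> NL g0; set X := (2 ^ L.+1)%N.
pose pr d := [seq p <- index_iota 1 X | prime p && (d %| p.-1)%N].
pose ds := iota g.+1 X.
pose trip := [seq (d, pq) | d <- ds, pq <- [seq (p, q) | p <- pr d, q <- pr d]].
have step : (count (fun n => has (fun p => has (fun q =>
      [&& p != q, (g < gcdn p.-1 q.-1)%N, prime p & prime q]) (primes n)) (primes n)) (iota 1 N) <=
   \sum_(d <- ds) \sum_(p <- pr d) \sum_(q <- pr d) count (fun n => (p != q) && (p * q %| n))%N (iota 1 N))%N.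
  have -> : (\sum_(d <- ds) \sum_(p <- pr d) \sum_(q <- pr d) count (fun n => (p != q) && (p * q %| n))%N (iota 1 N) =
     \sum_(t <- trip) count (fun n => (t.2.1 != t.2.2) && (t.2.1 * t.2.2 %| n))%N (iota 1 N))%N.
    rewrite /trip big_allpairs_dep/=; apply: eq_bigr => d _.
    by rewrite big_allpairs_dep.
  apply: count_exists_le => n; rewrite mem_iota add1n ltnS => /andP[n0 nN].
  move=> /hasP[p]; rewrite mem_primes => /and3P[pp _ pn] /hasP[q].
  rewrite mem_primes => /and3P[pq _ qn] /and4P[npq gpq _ _].
  have plt r : prime r -> (r %| n)%N -> (0 < r < X)%N.
    move=> pr' rn; rewrite prime_gt0//=; apply: leq_ltn_trans NL.
    by apply: leq_trans nN; exact: dvdn_leq.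
  exists (gcdn p.-1 q.-1, (p, q)) => /=; last first.
    by rewrite npq/= Gauss_dvd ?pn// prime_coprime// dvdn_prime2.
  apply/allpairsPdep; exists (gcdn p.-1 q.-1), (p, q); split=> //.
    rewrite /ds mem_iota gpq/=; have := plt p pp pn => /andP[_ pX].
    have : (gcdn p.-1 q.-1 <= p.-1)%N.
      by apply: dvdn_leq (dvdn_gcdl _ _); have := prime_gt1 pp; clear; lia.
    by move: pX; clear; lia.
  apply/allpairsP; exists (p, q); split=> //; rewrite mem_filter mem_index_iota.
    by rewrite pp dvdn_gcdl/= plt.
  by rewrite pq dvdn_gcdr/= plt.
rewrite -(ler_nat R) in step; apply: le_trans step _.
rewrite natr_sum.
have dsum : \sum_(d <- ds) (d ^ 2)%:R^-1 <= 2 / g%:R :> R.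
  have := @sum_inv_sqr_le R g.+1 (g.+1 + X) (ltn0Sn g).
  rewrite /index_iota addKn => /le_trans; apply.
  by rewrite ler_wpM2l// lef_pV2 ?posrE ?ltr0n// ler_nat.
apply: (@le_trans _ _ (\sum_(d <- ds) N%:R * ((L%:R + 2) ^+ 2 * ((d ^ 2)%:R)^-1))); last first.
  by rewrite -mulr_sumr -mulr_sumr ler_wpM2l// ler_wpM2l// exprn_ge0// addr_ge0.
rewrite big_seq [leRHS]big_seq; apply: ler_sum => d.
rewrite mem_iota => /andP[gd _]; have d0 : (0 < d)%N by apply: leq_ltn_trans gd.
have dR : 0 < d%:R :> R by rewrite ltr0n.
have A := @sum_inv_mod1_le d L d0; rewrite -big_filter -/X -/(pr d) in A.
have A0 : 0 <= \sum_(p <- pr d) (p%:R : R)^-1 by apply: sumr_ge0 => p _; rewrite invr_ge0.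
apply: (@le_trans _ _ (N%:R * ((\sum_(p <- pr d) p%:R^-1) * (\sum_(p <- pr d) p%:R^-1)))).
  rewrite big_distrlr/= mulr_sumr natr_sum big_seq [leRHS]big_seq; apply: ler_sum => p.
  rewrite mem_filter => /andP[/andP[pp _] _].
  rewrite mulr_sumr natr_sum big_seq [leRHS]big_seq; apply: ler_sum => q.
  rewrite mem_filter => /andP[/andP[pq _] _].
  rewrite -invfM -natrM; apply: le_trans (count_dvd_le N _); last by rewrite muln_gt0 !prime_gt0.
  by rewrite ler_nat; apply: sub_count => n /= /andP[].
rewrite ler_wpM2l//.
have -> : (L%:R + 2) ^+ 2 / (d ^ 2)%:R = ((L%:R + 2) / d%:R) * ((L%:R + 2) / d%:R) :> R.
  by rewrite natrX; field; rewrite gt_eqF.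
by apply: ler_pM.
Qed.

Lemma logn_fact_le (p N : nat) : prime p -> (logn p N`!)%:R <= N%:R / (p%:R - 1) :> R.
Proof.
move=> pp; have p1 := prime_gt1 pp; rewrite logn_fact// natr_sum.
apply: (@le_trans _ _ (\sum_(1 <= k < N.+1) N%:R * ((p ^ k)%:R : R)^-1)).
  by apply: ler_sum => k _; exact: ler_divn.
by rewrite -mulr_sumr ler_wpM2l// geom_prime.
Qed.

(** Logarithm of the largest y-friable divisor of n. *)
Definition friable_log (y n : nat) : R :=
  \sum_(0 <= p < y.+1 | prime p) (logn p n)%:R * lnr p.

Lemma friable_log_ge0 y n : 0 <= friable_log y n.
Proof. by apply: sumr_ge0 => p _; rewrite mulr_ge0// lnr_ge0. Qed.

(** The exponents of p in the integers n <= N add up to its exponent in N!. *)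
Lemma sum_friable_log_le (y N : nat) : (0 < y)%N ->
  \sum_(n <- iota 1 N) friable_log y n <= N%:R * (lnr y + 6).
Proof.
move=> y0; rewrite /friable_log exchange_big/=.
apply: (@le_trans _ _ (N%:R * \sum_(0 <= p < y.+1 | prime p) lnr p / (p%:R - 1))); last first.
  by rewrite ler_wpM2l// sum_ln_pred.
rewrite mulr_sumr; apply: ler_sum => p pp; rewrite -mulr_suml.
have -> : \sum_(n <- iota 1 N) (logn p n)%:R = (logn p N`!)%:R :> R.
  rewrite -natr_sum; congr (_%:R); elim: N => [|N IH]; first by rewrite big_nil fact0 logn1.
  by rewrite -[N.+1 in LHS]addn1 iotaD big_cat/= big_seq1 IH factS lognM ?fact_gt0// add1n addnC.
apply: le_trans (ler_wpM2r (lnr_ge0 _ _) (logn_fact_le N pp)) _.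
by rewrite mulrA mulrAC.
Qed.

Lemma count_friable_le (y N : nat) (T : R) : (0 < y)%N -> 0 < T ->
  (count (fun n => T < friable_log y n) (iota 1 N))%:R <= N%:R * ((lnr y + 6) / T).
Proof.
move=> y0 T0; rewrite mulrA ler_pdivlMr//; apply: le_trans (sum_friable_log_le N y0).
rewrite -sum_nat_count mulr_suml; apply: ler_sum => n _.
case: (ltP T (friable_log y n)) => [/ltW|_]; first by rewrite mul1r.
by rewrite mul0r friable_log_ge0.
Qed.

End Moments.

(** * Orders modulo a composite integer *)

Section OrdersModuloComposite.
Variables (R : realType) (a b : int).
Local Notation lnr n := (ln (n%:R : R)).
Local Notation regular := (@regular R a b).
Local Notation order_log := (@order_log R a b).
Local Notation strong := (@strong R a b).
Local Notation K := (order_loss R).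
Local Notation milli := (milli R).

(** The order of c modulo n is divisible by the lcm of its orders modulo the
    primes of s; these orders divide p - 1, so their pairwise gcds are at most g
    and [prod_le_lcm] applies. *)
Lemma order_log_sum_le (n g : nat) (s : seq nat) : (0 < n)%N -> uniq s -> (0 < g)%N ->
  {in s, forall p, [/\ prime p, (p %| n)%N & good_reduction a b p]} ->
  {in s &, forall p q, p != q -> (gcdn p.-1 q.-1 <= g)%N} ->
  \sum_(p <- s) order_log p - 5 * ((size s)%:R ^+ 2 * lnr g)
    <= \sum_(e <- five) lnr (ell (mono a b e) n).
Proof.
move=> n0 us g0 sP sg.
have -> : 5 * ((size s)%:R ^+ 2 * lnr g) = \sum_(e <- five) ((size s)%:R ^+ 2 * lnr g) :> R.
  by rewrite /five !big_cons big_nil addr0; ring.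
rewrite /order_log exchange_big/= -sumrB; apply: ler_sum => e _.
rewrite lerBlDl.
have el0 p : p \in s -> (0 < ell (mono a b e) p)%N.
  by move=> /sP[pp _ _]; rewrite ell_gt0// prime_gt0.
have -> : \sum_(p <- s) lnr (ell (mono a b e) p) = lnr (\prod_(p <- s) ell (mono a b e) p)%N.
  by rewrite big_seq [in RHS]big_seq lnr_prod.
have lcm_dvd : (lcm_over s (ell (mono a b e)) %| ell (mono a b e) n)%N.
  apply: lcm_over_dvd => p /sP[pp pn /(good_reductionP pp)[ra rb]].
  by apply: ell_dvd_ell => //; exact: red_mono_neq0.
have lcm_le : (lcm_over s (ell (mono a b e)) <= ell (mono a b e) n)%N.
  by apply: dvdn_leq lcm_dvd; exact: ell_gt0.
have lcm0 : (0 < ell (mono a b e) n)%N by exact: ell_gt0.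
have : (\prod_(p <- s) ell (mono a b e) p <= g ^ (size s ^ 2) * ell (mono a b e) n)%N.
  have h := @prod_le_lcm _ s (ell (mono a b e)) g us g0 el0 _.
  apply: leq_trans (h _) _; last by rewrite leq_mul2l lcm_le orbT.
  move=> p q ps qs pq; apply: leq_trans (sg p q ps qs pq).
  have [pp pn /(good_reductionP pp)[ra rb]] := sP p ps.
  have [pq' qn /(good_reductionP pq')[ra' rb']] := sP q qs.
  apply: dvdn_leq.
    by rewrite gcdn_gt0; have := prime_gt1 pp; clear; lia.
  rewrite dvdn_gcd; apply/andP; split.
    by apply: dvdn_trans (dvdn_gcdl _ _) _; apply: ell_dvd_pred => //; exact: red_mono_neq0.
  by apply: dvdn_trans (dvdn_gcdr _ _) _; apply: ell_dvd_pred => //; exact: red_mono_neq0.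
move/(ler_lnr R); rewrite lnrM ?expn_gt0 ?g0// lnrX// natrX; apply.
by rewrite big_seq; apply: prodn_cond_gt0.
Qed.

Definition rough_primes (y n : nat) : seq nat := [seq p <- primes n | (y < p)%N].

Lemma rough_primesP y n p : p \in rough_primes y n ->
  [/\ prime p, (p %| n)%N & (y < p)%N].
Proof. by rewrite mem_filter mem_primes => /andP[yp /and3P[pp _ pn]]. Qed.

Lemma uniq_rough_primes y n : uniq (rough_primes y n).
Proof. by rewrite filter_uniq// primes_uniq. Qed.

Lemma ln_rough_friable (y n : nat) : (0 < n)%N ->
  {in rough_primes y n, forall p, ~~ (p ^ 2 %| n)%N} ->
  lnr n <= \sum_(p <- rough_primes y n) lnr p + friable_log R y n.
Proof.
move=> n0 sqf; have nE := prod_prime_decomp n0; rewrite prime_decompE big_map/= in nE.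
have -> : lnr n = \sum_(p <- primes n) (logn p n)%:R * lnr p.
  rewrite [LHS](congr1 (fun m => lnr m) nE) big_seq lnr_prod; last first.
    by move=> p; rewrite mem_primes expn_gt0 => /andP[/prime_gt0->].
  by rewrite [RHS]big_seq; apply: eq_bigr => p; rewrite mem_primes => /andP[/prime_gt0 p0 _]; exact: lnrX.
rewrite (bigID (fun p => y < p)%N)/=; apply: lerD.
  rewrite -big_filter -/(rough_primes y n) big_seq [leRHS]big_seq; apply: ler_sum => p ps.
  have [pp pn _] := rough_primesP ps.
  rewrite ler_piMl ?lnr_ge0// -[leRHS]/(1%:R) ler_nat leqNgt; apply: contra (sqf _ ps) => l2.
  by rewrite pfactor_dvdn.
rewrite -big_filter /friable_log -[leRHS]big_filter; apply: ler_sum_uniq_sub.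
- by rewrite filter_uniq// primes_uniq.
- by rewrite filter_uniq// iota_uniq.
- move=> p; rewrite mem_filter mem_primes -leqNgt => /andP[py /and3P[pp _ _]].
  by rewrite mem_filter pp mem_index_iota.
- by move=> p _; rewrite mulr_ge0// lnr_ge0.
Qed.

Lemma size_rough_primes_le (H L n : nat) : (0 < n)%N -> (n < 2 ^ L.+1)%N ->
  (size (rough_primes (2 ^ H) n) * H <= L.+1)%N.
Proof.
move=> n0 nL; rewrite -(@leq_exp2l 2)//; apply: leq_trans (ltnW nL).
have dv : (\prod_(p <- rough_primes (2 ^ H) n) p %| n)%N.
  apply: prod_primes_dvd => [||p /rough_primesP[]//]; first exact: uniq_rough_primes.
  by apply/allP => p /rough_primesP[].
apply: leq_trans (dvdn_leq n0 dv).
have : all (fun p => 2 ^ H < p)%N (rough_primes (2 ^ H) n) by apply/allP => p /rough_primesP[].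
elim: (rough_primes _ _) => [|p s IH] /=; first by rewrite big_nil.
move=> /andP[hp hs]; rewrite big_cons mulSn expnD leq_mul ?IH//.
exact: ltnW.
Qed.

(** The rough prime factors make up n except for its friable part. Each
    contributes at least 8/3 - 5 k1 times its logarithm by [regular_order_log],
    the size of 2^H absorbing the constant K, and p0 contributes an additional
    margin. *)
Lemma order_sum_ge (n H g p0 : nat) (k1 T : R) : (0 < n)%N -> 0 <= k1 -> (0 < g)%N ->
  {in rough_primes (2 ^ H) n, forall p, regular k1 p} ->
  {in rough_primes (2 ^ H) n, forall p, ~~ (p ^ 2 %| n)%N} ->
  {in rough_primes (2 ^ H) n &, forall p q, p != q -> (gcdn p.-1 q.-1 <= g)%N} ->
  K <= k1 * (H%:R * lnr 2) -> friable_log R (2 ^ H) n <= T ->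
  p0 \in rough_primes (2 ^ H) n -> strong p0 -> 5 * k1 <= 8 / 3 ->
  (8 / 3 - 5 * k1) * (lnr n - T) + milli * lnr p0
    - 5 * ((size (rough_primes (2 ^ H) n))%:R ^+ 2 * lnr g)
    <= \sum_(e <- five) lnr (ell (mono a b e) n).
Proof.
move=> n0 k0 g0 reg sqf gcdg Kk frT p0s sp0 k8; set s := rough_primes (2 ^ H) n in reg sqf gcdg p0s *.
have us : uniq s by exact: uniq_rough_primes.
have sP : {in s, forall p, [/\ prime p, (p %| n)%N & good_reduction a b p]}.
  by move=> p ps; have [pp pn _] := rough_primesP ps; have /and4P[gp _ _ _] := reg p ps.
apply: le_trans (order_log_sum_le n0 us g0 sP gcdg); rewrite lerD2r.
have ord_ge p : p \in s -> (8 / 3 - 5 * k1) * lnr p <= order_log p.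
  move=> ps; have [pp pn Hp] := rough_primesP ps.
  have := regular_order_log pp (reg p ps).
  have : H%:R * lnr 2 <= lnr p by rewrite -lnrX// ler_lnr// ?expn_gt0// ltnW.
  by move=> /(ler_wpM2l k0) h1 h2; lra.
have nT : lnr n - T <= \sum_(p <- s) lnr p.
  by have := ln_rough_friable n0 sqf; rewrite -/s; lra.
have k8' : 0 <= 8 / 3 - 5 * k1 by lra.
apply: le_trans (lerD (ler_wpM2l k8' nT) (lexx _)) _.
rewrite (big_rem p0 p0s)/= [leRHS](big_rem p0 p0s)/= mulrDr mulr_sumr addrAC.
apply: lerD.
  have /and3P[_ _ h] := sp0; apply: le_trans h.
  by rewrite -mulrDl ler_wpM2r ?lnr_ge0//; lra.
by rewrite big_seq [leRHS]big_seq; apply: ler_sum => p /mem_rem; exact: ord_ge.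
Qed.

End OrdersModuloComposite.

(** * Integers with five small orders *)

Section Density.
Variables (R : realType) (a b : int).
Local Notation lnr n := (ln (n%:R : R)).
Local Notation regular := (@regular R a b).
Local Notation strong := (@strong R a b).
Local Notation K := (order_loss R).
Local Notation milli := (milli R).
Hypotheses (a0 : a != 0) (b0 : b != 0).
Hypothesis indep : mult_independent [tuple a%:~R; b%:~R].

(** The interval is the union of the intervals [2^l, 2^(2l)) with l = m, 2m, 4m,
    and so on, to each of which [strong_block] applies. *)
Lemma strong_sum_ge : exists m0, forall m J, (m0 <= m)%N ->
  J%:R * milli <= \sum_(2 ^ m <= p < 2 ^ (m * 2 ^ J) | strong p) (p%:R : R)^-1.
Proof.
have [m0 blk] := @strong_block R a b a0 b0 indep; exists m0 => m J m0m.
elim: J => [|J IH].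
  by rewrite mul0r sumr_ge0// => p _; rewrite invr_ge0.
have mJ : (m <= m * 2 ^ J)%N by rewrite leq_pmulr// expn_gt0.
rewrite (big_cat_nat (n := 2 ^ (m * 2 ^ J)))/=; last 2 first.
- by rewrite leq_exp2l.
- by rewrite leq_exp2l// leq_mul2l leq_exp2l// leqnSn orbT.
rewrite -natr1 mulrDl mul1r; apply: lerD => //.
rewrite (_ : m * 2 ^ J.+1 = (m * 2 ^ J).*2)%N; last by rewrite expnS; lia.
exact: blk (leq_trans m0m mJ).
Qed.

(** The losses add up to at most (2/15 + 9/20 + 1/10) gam A, less than the gain. *)
Lemma gain_beats_loss (gam A l gain loss : R) : 0 < gam -> 0 < A -> l <= 2 * A ->
  gam * A <= gain -> loss <= gam / 50 * A ->
  (8 / 3 + 5 * (gam / 50)) * l <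
    (8 / 3 - 5 * (gam / 40)) * (l - gam / 20 * A) + gain - 5 * loss.
Proof.
move=> gam0 A0 lA gainA lossA.
have gA : 0 < gam * A by rewrite mulr_gt0.
have gl : gam * l <= gam * (2 * A) by rewrite ler_wpM2l// ltW.
have ggA : 0 < gam * (gam * A) by rewrite mulr_gt0.
rewrite -subr_gt0.
have -> : (8 / 3 - 5 * (gam / 40)) * (l - gam / 20 * A) + gain - 5 * loss -
    (8 / 3 + 5 * (gam / 50)) * l =
  gain - 5 * loss - 8 / 60 * (gam * A) - (1 / 8 + 1 / 10) * (gam * l)
    + 1 / 160 * (gam * (gam * A)) by field.
lra.
Qed.

(** The obstructions to [order_sum_ge]. Each is rare for a reason of its own: in
    order, the second moment [count_free_le], the convergence [irregular_tail],
    the mean value [count_friable_le], the convergence of the sum of 1 / p^2,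
    and [count_gcd_le]. *)
Definition exceptional (gs : seq nat) (k T : R) (H g n : nat) : bool :=
  [|| all (fun p => ~~ (p %| n)%N) gs,
      has (fun p => (2 ^ H <= p)%N && ~~ regular k p) (primes n),
      T < friable_log R (2 ^ H) n,
      has (fun p => (2 ^ H <= p)%N && (p ^ 2 %| n)%N) (primes n)
    | has (fun p => has (fun q =>
        [&& p != q, (g < gcdn p.-1 q.-1)%N, prime p & prime q]) (primes n)) (primes n)].

Lemma count_exceptional_le (gs : seq nat) (k T d : R) (H g N L : nat) :
  (N < 2 ^ L.+1)%N -> 0 < d -> 0 < T -> (0 < g)%N ->
  uniq gs -> {in gs, forall p, prime p && (p <= N)%N} ->
  3 <= d * \sum_(p <- gs) (p%:R : R)^-1 ->
  \sum_(2 ^ H <= p < 2 ^ L.+1 | prime p && ~~ regular k p) (p%:R : R)^-1 <= d ->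
  (H%:R * lnr 2 + 6) / T <= d -> 2 / (2 ^ H)%:R <= d ->
  (L%:R + 2) ^+ 2 * (2 / g%:R) <= d ->
  (count (exceptional gs k T H g) (iota 1 N))%:R <= 5 * d * N%:R.
Proof.
move=> NL d0 T0 g0 ugs gsP hgs hirr hT hH hg.
pose E1 n := all (fun p => ~~ (p %| n)%N) gs.
pose E2 n := has (fun p => (2 ^ H <= p)%N && ~~ regular k p) (primes n).
pose E3 n := T < friable_log R (2 ^ H) n.
pose E4 n := has (fun p => (2 ^ H <= p)%N && (p ^ 2 %| n)%N) (primes n).
pose E5 n := has (fun p => has (fun q =>
      [&& p != q, (g < gcdn p.-1 q.-1)%N, prime p & prime q]) (primes n)) (primes n).
have mem_range n p : n \in iota 1 N -> p \in primes n -> [/\ prime p, (p %| n)%N & (p < 2 ^ L.+1)%N].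
  rewrite mem_iota add1n ltnS => /andP[n0 nN]; rewrite mem_primes => /and3P[pp _ pn].
  split => //; apply: leq_ltn_trans NL; apply: leq_trans nN; exact: dvdn_leq.
have c1 : (count E1 (iota 1 N))%:R <= d * N%:R.
  have pgs : all prime gs by apply/allP => p /gsP/andP[].
  have gsN : {in gs, forall p, (p <= N)%N} by move=> p /gsP/andP[].
  have h := count_free_le R ugs pgs gsN.
  have S0 : 0 < \sum_(p <- gs) (p%:R : R)^-1.
    by rewrite -(pmulr_rgt0 _ d0); apply: lt_le_trans hgs.
  rewrite -(ler_pM2r S0); apply: le_trans h _.
  by rewrite mulrAC ler_wpM2r.
have c2 : (count E2 (iota 1 N))%:R <= d * N%:R.
  pose t := [seq p <- index_iota (2 ^ H) (2 ^ L.+1) | prime p && ~~ regular k p].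
  have : (count E2 (iota 1 N) <= \sum_(p <- t) count (dvdn p) (iota 1 N))%N.
    apply: count_exists_le => n ns /hasP[p pn /andP[Hp rp]].
    have [pp pdn pX] := mem_range n p ns pn.
    by exists p => //; rewrite mem_filter pp rp mem_index_iota Hp.
  rewrite -(ler_nat R) natr_sum => /le_trans; apply.
  apply: (@le_trans _ _ (\sum_(p <- t) N%:R * p%:R^-1)).
    rewrite big_seq [leRHS]big_seq; apply: ler_sum => p; rewrite mem_filter => /andP[/andP[pp _] _].
    by apply: count_dvd_le; exact: prime_gt0.
  by rewrite -mulr_sumr mulrC ler_wpM2r// big_filter.
have c3 : (count E3 (iota 1 N))%:R <= d * N%:R.
  apply: le_trans (count_friable_le N _ T0) _; first by rewrite expn_gt0.
  by rewrite mulrC ler_wpM2r// lnrX.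
have c4 : (count E4 (iota 1 N))%:R <= d * N%:R.
  have : (count E4 (iota 1 N) <= \sum_(2 ^ H <= p < 2 ^ L.+1) count (dvdn (p ^ 2)) (iota 1 N))%N.
    apply: count_exists_le => n ns /hasP[p pn /andP[Hp rp]].
    have [pp pdn pX] := mem_range n p ns pn.
    by exists p => //; rewrite mem_index_iota Hp.
  rewrite -(ler_nat R) natr_sum => /le_trans; apply.
  apply: (@le_trans _ _ (\sum_(2 ^ H <= p < 2 ^ L.+1) N%:R * (p ^ 2)%:R^-1)).
    rewrite big_seq [leRHS]big_seq; apply: ler_sum => p; rewrite mem_index_iota => /andP[Hp _].
    by apply: count_dvd_le; rewrite expn_gt0 (leq_trans _ Hp)// expn_gt0.
  rewrite -mulr_sumr mulrC ler_wpM2r//; apply: le_trans hH.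
  by apply: sum_inv_sqr_le; rewrite expn_gt0.
have c5 : (count E5 (iota 1 N))%:R <= d * N%:R.
  by apply: le_trans (@count_gcd_le R N L g NL g0) _; rewrite mulrC ler_wpM2r.
have total : (count (exceptional gs k T H g) (iota 1 N) <= count E1 (iota 1 N) +
    (count E2 (iota 1 N) + (count E3 (iota 1 N) + (count E4 (iota 1 N) + count E5 (iota 1 N)))))%N.
  have cE (P : pred nat) : (count P (iota 1 N) = \sum_(n <- iota 1 N) P n)%N.
    by rewrite -sum1_count big_mkcond; apply: eq_bigr => n _; case: (P n).
  rewrite !cE -!big_split/=; apply: leq_sum => n _.
  rewrite /exceptional -/(E1 n) -/(E2 n) -/(E3 n) -/(E4 n) -/(E5 n).
  by clear; case: (E1 n); case: (E2 n); case: (E3 n); case: (E4 n); case: (E5 n).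
rewrite -(ler_nat R) in total; apply: le_trans total _.
rewrite !natrD; move: c1 c2 c3 c4 c5; clear; lra.
Qed.

Lemma unexceptional_order_sum_ge (gs : seq nat) (k T : R) (H g n : nat) :
  (0 < n)%N -> 0 <= k -> 5 * k <= 8 / 3 -> (0 < g)%N -> K <= k * (H%:R * lnr 2) ->
  {in gs, forall p, strong p && (2 ^ H < p)%N} -> ~~ exceptional gs k T H g n ->
  exists2 p0, p0 \in gs & (8 / 3 - 5 * k) * (lnr n - T) + milli * lnr p0
    - 5 * ((size (rough_primes (2 ^ H) n))%:R ^+ 2 * lnr g)
    <= \sum_(e <- five) lnr (ell (mono a b e) n).
Proof.
move=> n0 k0 k8 g0 HK gsP; rewrite /exceptional !negb_or => /and5P[e1 e2 e3 e4 e5].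
have [p0 p0g p0n] : exists2 p0, p0 \in gs & (p0 %| n)%N.
  by move: e1; rewrite -has_predC => /hasP[p pg /= /negPn pn]; exists p.
have /andP[sp0 Hp0] := gsP p0 p0g; have /and3P[pp0 _ _] := sp0.
have p0s : p0 \in rough_primes (2 ^ H) n by rewrite mem_filter mem_primes pp0 n0 p0n Hp0.
have reg : {in rough_primes (2 ^ H) n, forall p, regular k p}.
  move=> p ps; have [pp pn Hp] := rough_primesP ps.
  move: e2; rewrite -all_predC => /allP/(_ p); rewrite mem_primes pp n0 pn => /(_ isT)/=.
  by rewrite (ltnW Hp)/= negbK.
have sqf : {in rough_primes (2 ^ H) n, forall p, ~~ (p ^ 2 %| n)%N}.
  move=> p ps; have [pp pn Hp] := rough_primesP ps.
  move: e4; rewrite -all_predC => /allP/(_ p); rewrite mem_primes pp n0 pn => /(_ isT)/=.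
  by rewrite (ltnW Hp).
have gcdg : {in rough_primes (2 ^ H) n &, forall p q, p != q -> (gcdn p.-1 q.-1 <= g)%N}.
  move=> p r ps rs pr; have [pp pn _] := rough_primesP ps; have [rr rn _] := rough_primesP rs.
  rewrite leqNgt; apply: contra e5 => gp; apply/hasP; exists p; first by rewrite mem_primes pp n0.
  by apply/hasP; exists r; [rewrite mem_primes rr n0|rewrite pr gp pp].
have frT : friable_log R (2 ^ H) n <= T by rewrite leNgt.
by exists p0 => //; exact: order_sum_ge n0 k0 g0 reg sqf gcdg HK frT p0s sp0 k8.
Qed.

(** The parameters are chosen in this order: J such that the strong primes of
    the window have inverses adding up to 3 / d; then the exponent gam of the
    gain, with 2^J in the denominator since a strong prime of the window is only
    known to exceed about N^(1 / 2^(J + 1)); last the exponents of all losses,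
    as small multiples of gam. *)
Theorem small_orders_density (d : R) : 0 < d <= 1 -> exists e0 : R, 0 < e0 /\
  exists N0, forall N, (N0 <= N)%N ->
  (count (fun n => \sum_(e <- five) lnr (ell (mono a b e) n) <= (8 / 3 + 5 * e0) * lnr n)
     (iota 1 N))%:R <= 5 * d * N%:R.
Proof.
move=> d01; have /andP[d0 d1] := d01.
have l2 := ln2_gt0 R; have mi0 := milli_gt0 R.
have mi1 : milli <= 1 by have := milliE (1 : R); rewrite mulr1; lra.
have [m0 strongS] := strong_sum_ge.
have [J hJ] := nat_above (3 / (d * milli)).
pose q := (2 ^ J)%N; have q0 : (0 < q)%N by rewrite expn_gt0.
have qR : 1 <= q%:R :> R by rewrite ler1n.
have [gam [gam0 gamE gam1 gam2]] : exists gam : R,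
    [/\ 0 < gam, 2 * q%:R * gam = milli, gam <= 1 / (2 * q%:R) & gam <= 1 / 2].
  have gam1 : milli / (2 * q%:R) <= 1 / (2 * q%:R) by rewrite ler_wpM2r// invr_ge0; lra.
  exists (milli / (2 * q%:R)); split=> //.
  - by rewrite divr_gt0// mulr_gt0//; lra.
  - by field; lra.
  - by apply: (le_trans gam1); rewrite ler_pdivrMr; lra.
(* N^tau bounds the friable part, N^eta separates small and large primes, N^kap
   bounds the gcds and k is the irregularity; B bounds the number of large prime
   factors of n. *)
pose tau := gam / 20; pose eta := d * tau / 2; pose k := gam / 40.
have tau0 : 0 < tau by rewrite divr_gt0.
have eta0 : 0 < eta by rewrite divr_gt0// mulr_gt0.
have eta1 : eta <= gam / 40.
  by rewrite /eta -mulrA (_ : gam / 40 = tau / 2) /tau; [rewrite ler_piMl// ; lra|lra].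
have k0 : 0 < k by rewrite divr_gt0.
have k13 : 0 < k <= 1 / 3 by rewrite k0 /k; lra.
have k8 : 5 * k <= 8 / 3 by rewrite /k; lra.
pose B := 4 / eta; have B0 : 0 < B by rewrite divr_gt0.
pose kap := gam / (50 * B ^+ 2).
have kap0 : 0 < kap by rewrite divr_gt0// mulr_gt0// exprn_gt0.
exists (gam / 50); split; first by rewrite divr_gt0.
have [h1 irr] := @irregular_tail R a b a0 b0 indep k d k13 d0.
have [Lg hLg] := square_geometric_small kap0 d01.
have [h2 hh2] := nat_above (K / (k * lnr 2)).
have [h3 hh3] := nat_above (2 / d).
have [L1 hL1] := nat_above (2 * (h1 + h2 + h3 + 1)%:R / eta).
have [L2 hL2] := nat_above (12 / (d * tau * lnr 2)).
exists (2 ^ (Lg + L1 + L2 + 2 * q + m0 * q))%N => N hN.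
have N1 : (0 < N)%N by apply: leq_trans hN; rewrite expn_gt0.
pose L := trunc_log 2 N.
have NL1 : (2 ^ L <= N)%N by rewrite trunc_logP.
have NL2 : (N < 2 ^ L.+1)%N by rewrite trunc_log_ltn.
have [LgL L1L L2L q2L mqL] : [/\ Lg <= L, L1 <= L, L2 <= L, 2 * q <= L & m0 * q <= L]%N.
  have : (Lg + L1 + L2 + 2 * q + m0 * q <= L)%N by rewrite trunc_log_max.
  by clear; split; lia.
have L0 : 0 < L%:R :> R by rewrite ltr0n; move: q2L q0; clear; lia.
pose H := Num.truncn (eta * L%:R); pose m := (L %/ q)%N; pose g := (2 ^ Num.truncn (kap * L%:R))%N.
have etaL : 2 * (h1 + h2 + h3 + 1)%:R <= eta * L%:R.
  by rewrite mulrC [leRHS]mulrC -ler_pdivrMr// mulrC; apply: (le_trans hL1); rewrite ler_nat.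
have /andP[Hge Hle] : eta * L%:R / 2 <= H%:R <= eta * L%:R.
  apply: truncn_scale => //; apply: le_trans etaL; rewrite -[leLHS]mulr1 ler_wpM2l// ler1n; clear; lia.
have [Hh1 Hh2 Hh3] : [/\ h1 <= H, h2 <= H & h3 <= H]%N.
  have : (h1 + h2 + h3 + 1 <= H)%N.
    by rewrite -(ler_nat R); apply: le_trans Hge; rewrite ler_pdivlMr// mulrC.
  by clear; split; lia.
have HK : K <= k * (H%:R * lnr 2).
  have kl : 0 < k * lnr 2 by rewrite mulr_gt0.
  have : K / (k * lnr 2) <= H%:R by apply: (le_trans hh2); rewrite ler_nat.
  by rewrite ler_pdivrMr// mulrCA.
have mge : L%:R / (2 * q%:R) <= m%:R :> R by exact: divn_scale.
have Hm : (H < m)%N.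
  rewrite -(ltr_nat R); apply: le_lt_trans Hle _; apply: lt_le_trans mge.
  rewrite mulrC ltr_pM2l//; apply: le_lt_trans eta1 _.
  have g1 : gam <= (2 * q%:R)^-1 by move: gam1; rewrite mul1r.
  by apply: lt_le_trans g1; rewrite ltr_pdivrMr// ltr_pMr// ltr1n.
pose T := tau * (L%:R * lnr 2).
have T0 : 0 < T by rewrite mulr_gt0// mulr_gt0.
pose gs := [seq p <- index_iota (2 ^ m) (2 ^ (m * 2 ^ J)) | strong p].
have gsP p : p \in gs -> [/\ strong p, prime p, (2 ^ m <= p)%N & (p <= N)%N].
  rewrite mem_filter mem_index_iota => /andP[sp /andP[mp pm]].
  have /and3P[pp _ _] := sp; split => //.
  apply: leq_trans NL1; apply: leq_trans (ltnW pm) _.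
  by rewrite leq_exp2l// leq_trunc_div.
have few : (count (exceptional gs k T H g) (iota 1 N))%:R <= 5 * d * N%:R.
  apply: (@count_exceptional_le gs k T d H g N L) => //.
  - by rewrite expn_gt0.
  - by rewrite filter_uniq// iota_uniq.
  - by move=> p /gsP[_ -> _ ->].
  - have m0m : (m0 <= m)%N by rewrite leq_divRL.
    have := ler_wpM2l (ltW d0) (strongS m J m0m); rewrite big_filter; apply: le_trans.
    by rewrite mulrCA -ler_pdivrMr// mulr_gt0.
  - exact: irr.
  - rewrite ler_pdivrMr//.
    have a1 : H%:R * lnr 2 <= eta * L%:R * lnr 2 by rewrite ler_wpM2r// ltW.
    have dt0 : 0 < d * tau * lnr 2 by rewrite mulr_gt0// mulr_gt0.
    have a2 : 12 <= L%:R * (d * tau * lnr 2).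
      by rewrite -(ler_pdivrMr _ _ dt0); apply: (le_trans hL2); rewrite ler_nat.
    by move: a1 a2; rewrite /T /eta; lra.
  - have : 2 / d <= (2 ^ H)%:R.
      apply: (le_trans hh3); rewrite ler_nat; apply: leq_trans Hh3 _.
      by rewrite ltnW// ltn_expl.
    by rewrite !ler_pdivrMr// ?ltr0n ?expn_gt0// mulrC.
  - exact: hLg.
apply: le_trans few; rewrite ler_nat; apply: (@leq_trans (count
    (fun n => (n \in iota 1 N) && (\sum_(e <- five) lnr (ell (mono a b e) n) <= (8 / 3 + 5 * (gam / 50)) * lnr n))
    (iota 1 N))).
  by apply/eq_leq/eq_in_count => n /= ->.
apply: sub_count => n /= /andP[ns]; apply: contraTT => ne; rewrite -ltNge.
have [n0 nN] : (0 < n)%N /\ (n < 2 ^ L.+1)%N.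
  by move: ns; rewrite mem_iota add1n ltnS => /andP[n0 nN]; split=> //; exact: leq_ltn_trans NL2.
have g0 : (0 < g)%N by rewrite expn_gt0.
have gsH : {in gs, forall p, strong p && (2 ^ H < p)%N}.
  by move=> p /gsP[-> _ mp _]; apply: leq_trans mp; rewrite ltn_exp2l.
have [p0 p0g main] := unexceptional_order_sum_ge n0 (ltW k0) k8 g0 HK gsH ne.
apply: lt_le_trans main; apply: gain_beats_loss; rewrite ?mulr_gt0//.
- apply: (@le_trans _ _ ((L%:R + 1) * lnr 2)).
    by rewrite natr1 -lnrX// ler_lnr// ltnW.
  rewrite mulrA ler_wpM2r ?(ltW l2)//.
  have L1' : 1 <= L%:R :> R by rewrite ler1n -(ltr0n R).
  by move: L1'; lra.
- have [_ _ mp _] := gsP p0 p0g.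
  have h4 : m%:R * lnr 2 <= lnr p0 by rewrite -lnrX// ler_lnr// expn_gt0.
  have h5 := ler_wpM2l (ltW mi0) (le_trans (ler_wpM2r (ltW l2) mge) h4).
  apply: le_trans h5; rewrite -gamE le_eqVlt; apply/orP; left; apply/eqP.
  by field; rewrite gt_eqF//; apply: lt_le_trans qR.
- have sB : (size (rough_primes (2 ^ H) n))%:R <= B.
    have := size_rough_primes_le H n0 nN; rewrite -(ler_nat R) natrM => h.
    rewrite /B ler_pdivlMr// -(ler_pM2r L0).
    have L1' : L.+1%:R <= 2 * L%:R :> R.
      by rewrite -natrM ler_nat; move: L0; rewrite ltr0n; clear; lia.
    have h' := le_trans (ler_wpM2l (ler0n R _) Hge) (le_trans h L1').
    by move: h'; lra.
  have lg : lnr g <= kap * L%:R * lnr 2.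
    rewrite /g lnrX// ler_wpM2r ?(ltW l2)// truncn_le.
    by rewrite mulr_ge0 ?(ltW kap0)// ltW.
  apply: (@le_trans _ _ (B ^+ 2 * (kap * L%:R * lnr 2))).
    by apply: ler_pM => //; rewrite ?exprn_ge0 ?lnr_ge0// lerXn2r ?nnegrE// ltW.
  rewrite (_ : B ^+ 2 * (kap * L%:R * lnr 2) = gam / 50 * (L%:R * lnr 2))//.
  by rewrite /kap; field; rewrite gt_eqF.
Qed.

End Density.

Lemma count_failures_le (P : nat -> Prop) (E : pred nat) (n1 N : nat) :
  (forall n, (n1 <= n)%N -> (0 < n)%N -> ~ P n -> E n) ->
  (count_failures P N <= count E (iota 1 N) + n1)%N.
Proof.
move=> h; apply: (@leq_trans (count E (iota 1 N) + count (gtn n1) (iota 1 N))).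
  rewrite /count_failures /index_iota subn1 -!sum1_count.
  rewrite [X in (_ <= X + _)%N]big_mkcond [X in (_ <= _ + X)%N]big_mkcond -big_split/=.
  rewrite big_seq [leqRHS]big_seq; apply: leq_sum => n; rewrite mem_iota => /andP[n0 _].
  case: asboolP => // nP; case: (ltnP n n1) => nn1; first by rewrite addn1.
  by rewrite h.
rewrite leq_add2l -size_filter -[leqRHS](size_iota 0 n1); apply: uniq_leq_size.
  by rewrite filter_uniq// iota_uniq.
by move=> n; rewrite mem_filter mem_iota => /andP[nn1 _]; rewrite mem_iota.
Qed.

Lemma bounded_density_almost_all (R : realType) (P : nat -> Prop) :
  (forall d : R, 0 < d -> exists N0, forall N, (N0 <= N)%N ->
    (count_failures P N)%:R <= d * N%:R) -> almost_all R P.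
Proof.
move=> h; apply/cvgrPdist_le => d d0; have [N0 hN0] := h d d0.
exists (N0%:R + 1); split => [|x xN0]; first by rewrite num_real.
have x0 : 0 < x by apply: le_lt_trans xN0; rewrite addr_ge0.
rewrite sub0r normrN ger0_norm ?divr_ge0// ?(ltW x0)// ler_pdivrMr//.
have N0x : (N0 <= Num.truncn x)%N.
  by rewrite truncn_ge_nat ?(ltW x0)//; move: xN0; lra.
apply: le_trans (hN0 _ N0x) _; rewrite ler_wpM2l ?(ltW d0)//.
by rewrite truncn_le ltW.
Qed.

Local Open Scope classical_set_scope.
Local Open Scope ring_scope.

Theorem theorem1p4 (R : realType) (eps : R -> R)
  (eps_gt0 : forall x : R, 1 <= x -> 0 < eps x)
  (eps_cvg0 : eps x @[x --> +oo%R] --> (0 : R))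
  (a b : int) (a_neq0 : a != 0) (b_neq0 : b != 0)
  (ab_indep : mult_independent [tuple a%:~R; b%:~R]) :
  almost_all R (fun n : nat =>
    (n%:R : R) `^ (8 / 15 + eps n%:R) <
    (\max_(c <- [:: a; b; a * b; a ^+ 2 * b; a * b ^+ 2]%R) ell c n)%N%:R).
Proof.
apply: bounded_density_almost_all => d d0.
pose d' := Num.min 1 (d / 6).
have d'0 : 0 < d' by rewrite lt_min ltr01 divr_gt0.
have d'1 : 0 < d' <= 1 by rewrite d'0 ge_min lexx.
have d'd : 6 * d' <= d.
  have : d' <= d / 6 by rewrite ge_min lexx orbT.
  lra.
have [e0 [e00 [N0 hN0]]] := small_orders_density a_neq0 b_neq0 ab_indep d'1.
have /cvgrPdist_le/(_ _ e00)[M [_ hM]] := eps_cvg0.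
have [n1 hn1] := nat_above (Num.max (M + 1) 1).
have [n2 hn2] := nat_above (n1%:R / d').
exists (N0 + n2)%N => N hN.
pose E n := \sum_(e <- five) ln ((ell (mono a b e) n)%:R : R) <= (8 / 3 + 5 * e0) * ln n%:R.
apply: (@le_trans _ _ (count E (iota 1 N) + n1)%:R).
  rewrite ler_nat; apply: count_failures_le => n n1n n0 /negP; rewrite -leNgt => small.
  have nM : M < n%:R.
    apply: (@lt_le_trans _ _ (Num.max (M + 1) 1)); first by rewrite lt_max ltrDl ltr01.
    by apply: le_trans hn1 _; rewrite ler_nat.
  have epsn : eps n%:R <= e0.
    have := hM _ nM; rewrite sub0r normrN; apply: le_trans; exact: ler_norm.
  have lnn0 : 0 <= ln (n%:R : R) by exact: lnr_ge0.
  have le_e e : e \in five -> ln ((ell (mono a b e) n)%:R : R) <= (8 / 15 + e0) * ln n%:R.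
    move=> e5; apply: (@le_trans _ _ ((8 / 15 + eps n%:R) * ln n%:R)); last first.
      by rewrite ler_wpM2r// lerD2l.
    rewrite -ln_powR ler_ln ?posrE ?ltr0n ?ell_gt0 ?powR_gt0 ?ltr0n//.
    apply: le_trans small; rewrite ler_nat.
    have -> : [:: a; b; a * b; a ^+ 2 * b; a * b ^+ 2] = [seq mono a b e | e <- five].
      by rewrite /five /mono /= !expr0 !expr1 mulr1 !mul1r.
    by rewrite big_map; exact: leq_bigmax_seq.
  rewrite /E (_ : (8 / 3 + 5 * e0) * ln n%:R = \sum_(e <- five) (8 / 15 + e0) * ln n%:R); last first.
    by rewrite /five !big_cons big_nil; field.
  by rewrite big_seq [leRHS]big_seq; exact: ler_sum.
have N0N : (N0 <= N)%N by apply: leq_trans hN; exact: leq_addr.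
have n2N : (n2 <= N)%N by apply: leq_trans hN; exact: leq_addl.
have n1N : n1%:R <= d' * N%:R.
  by rewrite mulrC -ler_pdivrMr//; apply: (le_trans hn2); rewrite ler_nat.
have := hN0 N N0N; rewrite -/E natrD.
have : 6 * d' * N%:R <= d * N%:R by rewrite ler_wpM2r.
lra.
Qed.
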